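(* Let $(R,\mathfrak m,k)$ be a local ring and $E$ the injective hull of $k$. If $W$ is a complex of $R$-modules with $\mathrm{Gfd}_R(W)$ finite, then $$\mathrm{depth}_R(W)=\mathrm{depth}\,R-\sup(E\otimes^{\mathbf L}_R W).$$ In particular, $\sup(E\otimes^{\mathbf L}_R W)$ is finite if and only if $\mathrm{depth}_R(W)$ is finite.
   Context: Local rings are commutative Noetherian. Complexes are indexed homologically; $\sup(X)=\sup\{i\mid \mathrm{H}_i(X)\ne0\}$; a complex is homologically bounded if $\mathrm{H}_i(X)=0$ for $|i|\gg0$. A homological invariant is ''finite'' if it is an integer (neither $\infty$ nor $-\infty$). The homology of $W$ is not assumed finitely generated. Depth. If $K$ is the Koszul complex on a generating sequence of length $n$ for $\mathfrak m$, then $\mathrm{depth}_R(X)=n-\sup(K\otimes_R X)$ for a complex of $R$-modules $X$; it is independent of the generating sequence and may be infinite. G-flat dimension. An $R$-module $G$ is G-flat if there is an exact complex $F=\cdots\to F_{1}\xrightarrow{\partial_1}F_0\xrightarrow{\partial_0}F_{-1}\to\cdots$ of flat $R$-modules with $\mathrm{Coker}(\partial_1)=G$ and $I\otimes_R F$ exact for every injective $R$-module $I$. A G-flat resolution of a homologically bounded complex $X$ of $R$-modules is a complex $G$ of G-flat modules with $G_i=0$ for $i\ll0$ and $G\simeq X$ in the derived category, and $\mathrm{Gfd}_R(X)=\inf\{\sup\{n\mid G_n\neq0\}\mid G\text{ a G-flat resolution of }X\}$. Thus $\mathrm{Gfd}_R(W)$ is defined for homologically bounded $W$. *)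

(* Defs.v *)
From HB Require Import structures.
From mathcomp Require Import all_boot all_order all_algebra.
From mathcomp Require Import freeg.
From mathcomp Require Import ring.
From mathcomp Require Import boolp classical_sets constructive_ereal.

Set Implicit Arguments.
Unset Strict Implicit.
Unset Printing Implicit Defensive.

Import GRing.Theory.
Local Open Scope ring_scope.
Local Open Scope quotient_scope.

Definition mk_linear (R : nzRingType) (U V : lmodType R) (f : U -> V)
    (fL : linear f) : {linear U -> V} :=
  HB.pack f (GRing.isLinear.Build R U V *:%R f fL).

(* The library provides quotients of zmodTypes, but no scaling on them. *)
Section QuotientModule.
Variables (R : nzRingType) (M : lmodType R) (S : submodClosed M).

Definition submod_zmod : zmodClosed M :=
  HB.pack (S : {pred M})
    (GRing.isZmodClosed.Build M (S : {pred M})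
       (GRing.submod_closedB (submodClosedP S))).

Definition qmod := Quotient.quot submod_zmod.
HB.instance Definition _ := GRing.Zmodule.on qmod.

Definition qmod_pi (x : M) : qmod := \pi_(Quotient.quot submod_zmod) x.
Definition qmod_scale (a : R) (x : qmod) : qmod := qmod_pi (a *: repr x).

Lemma qmod_piB : zmod_morphism qmod_pi.
Proof. by move=> x y; rewrite /qmod_pi piE. Qed.

HB.instance Definition _ := GRing.isZmodMorphism.Build M qmod qmod_pi qmod_piB.

Lemma qmod_piE x y : (qmod_pi x == qmod_pi y) = (x - y \in S).
Proof. by rewrite /qmod_pi -Quotient.idealrBE. Qed.

Lemma qmod_pi_surj (q : qmod) : exists x, qmod_pi x = q.
Proof. by exists (repr q); rewrite /qmod_pi reprK. Qed.

Lemma qmod_scaleE a x : qmod_scale a (qmod_pi x) = qmod_pi (a *: x).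
Proof.
apply/eqP; rewrite qmod_piE -scalerBr rpredZ // -qmod_piE.
by rewrite {1}/qmod_pi reprK.
Qed.

Lemma qmod_scaleA a b x : qmod_scale a (qmod_scale b x) = qmod_scale (a * b) x.
Proof. by have [y <-] := qmod_pi_surj x; rewrite !qmod_scaleE scalerA. Qed.

Lemma qmod_scale1 : left_id 1 qmod_scale.
Proof. by move=> x; have [y <-] := qmod_pi_surj x; rewrite qmod_scaleE scale1r. Qed.

Lemma qmod_scaleDr : right_distributive qmod_scale +%R.
Proof.
move=> a x y; have [u <-] := qmod_pi_surj x; have [v <-] := qmod_pi_surj y.
by rewrite -raddfD !qmod_scaleE scalerDr raddfD.
Qed.

Lemma qmod_scaleDl x : {morph qmod_scale^~ x : a b / a + b}.
Proof.
by move=> a b; have [y <-] := qmod_pi_surj x; rewrite !qmod_scaleE scalerDl raddfD.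
Qed.

HB.instance Definition _ := GRing.Zmodule_isLmodule.Build R qmod
  qmod_scaleA qmod_scale1 qmod_scaleDr qmod_scaleDl.

Lemma qmod_pi_linear : linear qmod_pi.
Proof.
by move=> a x y; rewrite raddfD; congr (_ + _); exact: esym (qmod_scaleE a x).
Qed.

HB.instance Definition _ := GRing.isLinear.Build R M qmod *:%R qmod_pi
  qmod_pi_linear.
End QuotientModule.

(* [forall i, V i] carries no module structure in the library. *)
Section DirectSum.
Variables (R : nzRingType) (I : eqType) (V : I -> lmodType R).

Definition dprod := forall i, V i.

HB.instance Definition _ := gen_eqMixin dprod.
HB.instance Definition _ := gen_choiceMixin dprod.

Let add (f g : dprod) : dprod := fun i => f i + g i.
Let opp (f : dprod) : dprod := fun i => - f i.
Let zero : dprod := fun i => 0.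
Let scale a (f : dprod) : dprod := fun i => a *: f i.

Let addA : associative add.
Proof. by move=> f g h; apply: functional_extensionality_dep => i; exact: addrA. Qed.
Let addC : commutative add.
Proof. by move=> f g; apply: functional_extensionality_dep => i; exact: addrC. Qed.
Let add0 : left_id zero add.
Proof. by move=> f; apply: functional_extensionality_dep => i; exact: add0r. Qed.
Let addN : left_inverse zero opp add.
Proof. by move=> f; apply: functional_extensionality_dep => i; exact: addNr. Qed.

HB.instance Definition _ := GRing.isZmodule.Build dprod addA addC add0 addN.

Let scaleA a b f : scale a (scale b f) = scale (a * b) f.
Proof. by apply: functional_extensionality_dep => i; exact: scalerA. Qed.
Let scale1 : left_id 1 scale.
Proof. by move=> f; apply: functional_extensionality_dep => i; exact: scale1r. Qed.
Let scaleDr : right_distributive scale +%R.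
Proof. by move=> a f g; apply: functional_extensionality_dep => i; exact: scalerDr. Qed.
Let scaleDl f : {morph scale^~ f : a b / a + b}.
Proof. by move=> a b; apply: functional_extensionality_dep => i; exact: scalerDl. Qed.

HB.instance Definition _ := GRing.Zmodule_isLmodule.Build R dprod
  scaleA scale1 scaleDr scaleDl.

Definition fin_supp : {pred dprod} :=
  fun f => `[< exists s : seq I, forall i, i \notin s -> f i = 0 >].

Lemma fin_suppP : submod_closed fin_supp.
Proof.
split; first by apply/asboolP; exists [::].
move=> a f g /asboolP[s fs] /asboolP[t gt]; apply/asboolP; exists (s ++ t) => i.
rewrite mem_cat negb_or => /andP[/fs fi0 /gt gi0].
by rewrite [LHS](_ : _ = a *: f i + g i) // fi0 gi0 scaler0 addr0.
Qed.

HB.instance Definition _ := GRing.isSubmodClosed.Build R dprod fin_supp fin_suppP.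

Record dsum := DSum { dsum_val :> dprod ; _ : dsum_val \in fin_supp }.

HB.instance Definition _ := [isSub for dsum_val].
HB.instance Definition _ := [Choice of dsum by <:].
HB.instance Definition _ := [SubChoice_isSubLmodule of dsum by <:].
End DirectSum.

(* M ⊗_R N: the free module on M * N modulo the bilinearity relations. *)
Section Tensor.
Variable R : comNzRingType.

Section Def.
Variables M N : lmodType R.

Definition fgen (x : M) (y : N) : {freeg (M * N) / R} := Freeg [:: (1, (x, y))].

Definition tensor_gens (S : {pred {freeg (M * N) / R}}) : Prop :=
  (forall a x x' y,
     fgen (a *: x + x') y - (a *: fgen x y + fgen x' y) \in S) /\
  (forall a x y y',
     fgen x (a *: y + y') - (a *: fgen x y + fgen x y') \in S).

Definition tensor_rel : {pred {freeg (M * N) / R}} := fun t =>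
  `[< forall S : {pred {freeg (M * N) / R}},
        submod_closed S -> tensor_gens S -> t \in S >].

Lemma tensor_relP : submod_closed tensor_rel.
Proof.
split; first by apply/asboolP => S [].
move=> a x y /asboolP xS /asboolP yS; apply/asboolP => S cS gS.
by case: (cS) => _; apply; [exact: xS | exact: yS].
Qed.

HB.instance Definition _ :=
  GRing.isSubmodClosed.Build R {freeg (M * N) / R} tensor_rel tensor_relP.

Definition tensor : lmodType R := qmod tensor_rel.
Definition tens (x : M) (y : N) : tensor := qmod_pi tensor_rel (fgen x y).

Lemma tens_linearl y : linear (tens^~ y).
Proof.
move=> a x x'; rewrite /tens -linearP; apply/eqP; rewrite qmod_piE.
by apply/asboolP => S _ [].
Qed.

Lemma tens_linearr x : linear (tens x).
Proof.
move=> a y y'; rewrite /tens -linearP; apply/eqP; rewrite qmod_piE.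
by apply/asboolP => S _ [].
Qed.

Lemma tens0r y : tens 0 y = 0.
Proof. exact: (linear0 (mk_linear (tens_linearl y))). Qed.

Lemma tensr0 x : tens x 0 = 0.
Proof. exact: (linear0 (mk_linear (tens_linearr x))). Qed.

Section Lift.
Variables (P : lmodType R) (b : M -> N -> P).
Hypotheses (bl : forall y, linear (b^~ y)) (br : forall x, linear (b x)).

Let F (t : {freeg (M * N) / R}) : P := fglift (fun u => b u.1 u.2) t.

Let F_linear : linear F.
Proof.
have FB := @lift_is_additive R (M * N)%type P (fun u => b u.1 u.2).
pose Fa : {additive {freeg (M * N) / R} -> P} :=
  HB.pack F (GRing.isZmodMorphism.Build _ _ F FB).
have FZ a t : Fa (a *: t) = a *: Fa t.
  rewrite -[t]freeg_sumE scaler_sumr !raddf_sum.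
  apply: eq_bigr => x _.
  have -> : a *: Freeg [:: (coeff x t, x)] = Freeg [:: (a * coeff x t, x)].
    by apply/eqP/freeg_eqP => y; rewrite coeffZ !coeffU mulrA.
  by rewrite /= /F !liftU scalerA.
by move=> a t u; rewrite -[F]/(Fa : _ -> _) raddfD FZ.
Qed.

Let F_rel t : t \in tensor_rel -> F t = 0.
Proof.
move=> /asboolP tr; apply/eqP.
pose Fl := mk_linear F_linear.
have {}tr := tr (fun t => Fl t == 0); apply: tr.
  by split=> [|a x y /eqP x0 /eqP y0]; apply/eqP; rewrite ?linear0 // linearP x0 y0 scaler0 addr0.
have FE x y : Fl (fgen x y) = b x y by rewrite /= /F liftU scale1r.
split=> a x y z; apply/eqP.
  by rewrite linearB linearP !FE [b _ _]bl subrr.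
by rewrite linearB linearP !FE [b _ _]br subrr.
Qed.

Definition tensor_lift (t : tensor) : P := F (repr t).

Lemma tensor_lift_pi t : tensor_lift (qmod_pi tensor_rel t) = F t.
Proof.
apply/eqP; rewrite /tensor_lift -subr_eq0 -[F]/(mk_linear F_linear : _ -> _) -linearB.
apply/eqP/F_rel; rewrite -qmod_piE; apply/eqP.
by rewrite {1}/qmod_pi reprK.
Qed.

Lemma tensor_lift_linear : linear tensor_lift.
Proof.
move=> a t u; have [x <-] := qmod_pi_surj t; have [y <-] := qmod_pi_surj u.
by rewrite -linearP !tensor_lift_pi F_linear.
Qed.

Lemma tensor_liftE x y : tensor_lift (tens x y) = b x y.
Proof. by rewrite tensor_lift_pi /F liftU scale1r. Qed.
End Lift.

Lemma tensor_ext (P : lmodType R) (f g : {linear tensor -> P}) :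
  (forall x y, f (tens x y) = g (tens x y)) -> f =1 g.
Proof.
move=> fg t; have [u <-] := qmod_pi_surj t.
rewrite -[u]freeg_sumE !raddf_sum; apply: eq_bigr => -[x y] _.
have -> : Freeg [:: (coeff (x, y) u, (x, y))] = coeff (x, y) u *: fgen x y.
  by apply/eqP/freeg_eqP => z; rewrite coeffZ !coeffU mul1r.
rewrite /= [qmod_pi _ _]linearZ_LR !linearZ_LR; congr (_ *: _); exact: fg.
Qed.
End Def.

Section Map.
Variables (M M' N N' : lmodType R).
Variables (f : {linear M -> M'}) (g : {linear N -> N'}).

Lemma tensor_map_linearl y : linear (fun x => tens (f x) (g y)).
Proof. by move=> a x x'; rewrite linearP tens_linearl. Qed.
Lemma tensor_map_linearr x : linear (fun y => tens (f x) (g y)).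
Proof. by move=> a y y'; rewrite linearP tens_linearr. Qed.

Definition tensor_map : {linear tensor M N -> tensor M' N'} :=
  mk_linear (tensor_lift_linear tensor_map_linearl tensor_map_linearr).

Lemma tensor_mapE x y : tensor_map (tens x y) = tens (f x) (g y).
Proof. exact: (tensor_liftE tensor_map_linearl tensor_map_linearr). Qed.
End Map.
End Tensor.

Section Modules.
Variable R : comNzRingType.

Definition ideal (I : {pred R}) : Prop := submod_closed (I : {pred R^o}).

Definition generates n (s : 'I_n -> R) (I : {pred R}) : Prop :=
  forall r, r \in I <-> exists c : 'I_n -> R, r = \sum_i c i * s i.

Definition noetherian : Prop :=
  forall I, ideal I -> exists n, exists s : 'I_n -> R, generates s I.

Definition maximal_ideal (I : {pred R}) : Prop :=
  [/\ ideal I, 1 \notin I &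
      forall J, ideal J -> 1 \notin J -> {subset I <= J} -> J =i I].

Definition local_ring (m : {pred R}) : Prop :=
  [/\ noetherian, maximal_ideal m & forall I, maximal_ideal I -> I =i m].

Definition flat (F : lmodType R) : Prop :=
  forall (M N : lmodType R) (f : {linear M -> N}),
    injective f -> injective (tensor_map (idfun : {linear F -> F}) f).

Definition projective (P : lmodType R) : Prop :=
  forall (M N : lmodType R) (p : {linear M -> N}) (f : {linear P -> N}),
    (forall y, exists x, p x = y) ->
    exists g : {linear P -> M}, forall x, p (g x) = f x.

Definition injective_module (I : lmodType R) : Prop :=
  forall (M N : lmodType R) (i : {linear M -> N}) (f : {linear M -> I}),
    injective i -> exists g : {linear N -> I}, forall x, g (i x) = f x.

Definition essential (M E : lmodType R) (i : {linear M -> E}) : Prop :=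
  forall N : {pred E}, submod_closed N ->
    (exists2 y, y \in N & y != 0) -> exists2 x, i x \in N & i x != 0.

Definition injective_hull (M E : lmodType R) : Prop :=
  injective_module E /\
  exists2 i : {linear M -> E}, injective i & essential i.

End Modules.

Section Complexes.
Variable R : comNzRingType.

(* Homological indexing: [diff i j] is the differential X_i -> X_j, which is
   nonzero only for i = j + 1; carrying both indices avoids casts between
   X_(i-1+1) and X_i. *)
Record complex := Complex {
  obj :> int -> lmodType R ;
  diff : forall i j, {linear obj i -> obj j} ;
  diff_shape : forall i j, i != j + 1 -> forall x, diff i j x = 0 ;
  diff_diff : forall i j k x, diff j k (diff i j x) = 0 }.

Record chain_map (X Y : complex) := ChainMap {
  cmap :> forall i, {linear X i -> Y i} ;
  cmap_diff : forall i j x, cmap j (diff X i j x) = diff Y i j (cmap i x) }.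

Definition cycle (X : complex) i (x : X i) : Prop := diff X i (i - 1) x = 0.
Definition boundary (X : complex) i (x : X i) : Prop :=
  exists y, diff X (i + 1) i y = x.

(* H_i(X) = 0. *)
Definition exact_at (X : complex) i : Prop :=
  forall x : X i, cycle x -> boundary x.
Definition acyclic (X : complex) : Prop := forall i, exact_at X i.

Definition hbounded (X : complex) : Prop :=
  exists N : int, forall i, N < `|i| -> exact_at X i.

(* H_i(f) is injective, resp. surjective, for all i. *)
Definition quasi_iso (X Y : complex) (f : chain_map X Y) : Prop :=
  forall i,
    (forall x : X i, cycle x -> boundary (f i x) -> boundary x) /\
    (forall y : Y i, cycle y -> exists2 x : X i, cycle x & boundary (y - f i x)).

(* Isomorphism in the derived category, as a roof of quasi-isomorphisms. *)
Definition derived_iso (X Y : complex) : Prop :=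
  exists (Z : complex) (f : chain_map Z X) (g : chain_map Z Y),
    quasi_iso f /\ quasi_iso g.

Definition supZ (A : set int) : \bar int :=
  supremum -oo%E [set i%:E | i in A].

Definition hsup (X : complex) : \bar int := supZ [set i | ~ exact_at X i].

Section Stalk.
Variable M : lmodType R.

Definition stalk_obj (i : int) : lmodType R := if i == 0 then M else 'rV[R]_0.
Definition stalk_diff i j : {linear stalk_obj i -> stalk_obj j} := \0.

Lemma stalk_shape i j : i != j + 1 -> forall x, stalk_diff i j x = 0.
Proof. by []. Qed.
Lemma stalk_diff_diff i j k x : stalk_diff j k (stalk_diff i j x) = 0.
Proof. by []. Qed.

(* M as a complex concentrated in degree 0. *)
Definition stalk := Complex stalk_shape stalk_diff_diff.
End Stalk.

Section ModuleTensor.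
Variables (M : lmodType R) (X : complex).

Definition mtensor_diff i j : {linear tensor M (X i) -> tensor M (X j)} :=
  tensor_map (idfun : {linear M -> M}) (diff X i j).

Lemma mtensor_shape i j : i != j + 1 -> forall x, mtensor_diff i j x = 0.
Proof.
move=> ij t; rewrite (@tensor_ext R _ _ _ (mtensor_diff i j) \0) // => x y.
by rewrite /mtensor_diff tensor_mapE diff_shape // tensr0.
Qed.

Lemma mtensor_diff_diff i j k x : mtensor_diff j k (mtensor_diff i j x) = 0.
Proof.
pose dd : {linear tensor M (X i) -> tensor M (X k)} :=
  mtensor_diff j k \o mtensor_diff i j.
rewrite -[LHS]/(dd x) (@tensor_ext R _ _ _ dd \0) // => y z.
rewrite -[LHS]/(mtensor_diff j k (mtensor_diff i j (tens y z))).
by rewrite /mtensor_diff !tensor_mapE diff_diff tensr0.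
Qed.

Definition mtensor := Complex mtensor_shape mtensor_diff_diff.
End ModuleTensor.


(* (A ⊗_R B)_n is the direct sum of A_p ⊗ B_q over p + q = n, and
   d(a ⊗ b) = d a ⊗ b + (-1)^p a ⊗ d b for a in A_p. *)
Section ComplexTensor.
Variables A B : complex.

Definition bidegree (n : int) := {pq : int * int | pq.1 + pq.2 == n}.

Definition ctensor_obj (n : int) : lmodType R :=
  dsum (fun u : bidegree n => tensor (A (val u).1) (B (val u).2)).

(* The (p, q) component, read as 0 when p + q <> n. *)
Definition comp n (c : ctensor_obj n) p q : tensor (A p) (B q) :=
  match decP (@idP (p + q == n)) with
  | left pqn => dsum_val c (exist _ (p, q) pqn)
  | right _ => 0
  end.

Lemma comp_linear n p q : linear (fun c : ctensor_obj n => comp c p q).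
Proof. by move=> a c c'; rewrite /comp; case: decP => // _; rewrite scaler0 addr0. Qed.

Lemma compE n (c : ctensor_obj n) (u : bidegree n) :
  comp c (val u).1 (val u).2 = dsum_val c u.
Proof.
case: u => -[p q] pqn; rewrite /comp /=; case: decP => [pqn'|//].
by rewrite (bool_irrelevance pqn' pqn).
Qed.

Lemma comp_out n (c : ctensor_obj n) p q : p + q != n -> comp c p q = 0.
Proof. by rewrite /comp; case: decP => // pqn; rewrite pqn. Qed.

Lemma ctensor_ext n (c c' : ctensor_obj n) :
  (forall p q, p + q = n -> comp c p q = comp c' p q) -> c = c'.
Proof.
move=> cc'; apply: val_inj; apply: functional_extensionality_dep => u /=.
by rewrite -!compE; apply: cc'; apply/eqP; case: u.
Qed.

Definition ctensor_diff_at i (c : ctensor_obj i) p q : tensor (A p) (B q) :=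
  tensor_map (diff A (p + 1) p) (idfun : {linear B q -> B q}) (comp c (p + 1) q)
  + (-1) ^+ `|p|%N *:
    tensor_map (idfun : {linear A p -> A p}) (diff B (q + 1) q) (comp c p (q + 1)).

Definition ctensor_diff_fun i j (c : ctensor_obj i) :
    dprod (fun u : bidegree j => tensor (A (val u).1) (B (val u).2)) :=
  fun u => ctensor_diff_at c (val u).1 (val u).2.
Arguments ctensor_diff_fun {i} j c.

Lemma ctensor_diff_fin i j (c : ctensor_obj i) :
  ctensor_diff_fun j c \in @fin_supp R _ _.
Proof.
case: c => c cfin; have [s cs] := asboolW cfin; apply/asboolP.
pose l := [seq ((val v).1 - 1, (val v).2) | v <- s] ++
          [seq ((val v).1, (val v).2 - 1) | v <- s].
exists (pmap insub l) => -[[p q] pqj] ul.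
have {ul} pql : (p, q) \notin l.
  by apply: contra ul => pql; rewrite mem_pmap_sub.
have nul p' q' : (forall v, v \in s -> val v <> (p', q')) ->
    comp (DSum cfin) p' q' = 0.
  move=> ns; rewrite /comp; case: decP => // pq; rewrite /= cs //.
  by apply/negP => /ns; apply.
have addK (x : int) : x = x + 1 - 1 by rewrite addrK.
rewrite /ctensor_diff_fun /ctensor_diff_at !nul ?raddf0 ?scaler0 ?addr0 //.
- move=> v vs vE; case/negP: pql; rewrite mem_cat; apply/orP; right.
  apply/mapP; exists v => //; rewrite vE.
  exact: (congr1 (pair p) (addK q)).
- move=> v vs vE; case/negP: pql; rewrite mem_cat; apply/orP; left.
  apply/mapP; exists v => //; rewrite vE.
  exact: (congr1 (pair^~ q) (addK p)).
Qed.

Lemma ctensor_diff_linear i j :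
  linear (fun c : ctensor_obj i =>
            DSum (@ctensor_diff_fin i j c) : ctensor_obj j).
Proof.
move=> a c c'; apply: val_inj; apply: functional_extensionality_dep => u /=.
rewrite [RHS](_ : _ = a *: ctensor_diff_fun j c u + ctensor_diff_fun j c' u) //.
rewrite /ctensor_diff_fun /ctensor_diff_at !comp_linear !linearP.
by rewrite scalerDr addrACA.
Qed.

Definition ctensor_diff i j : {linear ctensor_obj i -> ctensor_obj j} :=
  mk_linear (@ctensor_diff_linear i j).

Lemma comp_diff i j (c : ctensor_obj i) p q :
  comp (ctensor_diff i j c) p q = if p + q == j then ctensor_diff_at c p q else 0.
Proof. by rewrite /comp; case: decP => [pqj|/negP/negbTE -> //]; rewrite [in RHS]pqj. Qed.

Lemma ctensor_shape i j : i != j + 1 -> forall c, ctensor_diff i j c = 0.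
Proof.
move=> ij c; apply: ctensor_ext => p q pqj.
have -> : comp (0 : ctensor_obj j) p q = 0 by rewrite /comp; case: decP.
rewrite comp_diff pqj eqxx /ctensor_diff_at !comp_out ?raddf0 ?scaler0 ?addr0 //.
  by rewrite addrA pqj eq_sym.
by rewrite addrAC pqj eq_sym.
Qed.

Lemma signr_absz_add1 (p : int) : (-1) ^+ absz (p + 1) = - (-1) ^+ absz p :> R.
Proof.
case: p => n.
  by rewrite -[Posz n + 1]/(Posz (n + 1)%N) !absz_nat addn1 exprS mulN1r.
have -> : absz (Negz n + 1) = n by rewrite NegzE -addn1 PoszD opprD addrNK abszN.
by rewrite -[absz (Negz n)]/n.+1 exprS mulN1r opprK.
Qed.

Lemma ctensor_diff_diff i j k c : ctensor_diff j k (ctensor_diff i j c) = 0.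
Proof.
have [-> | jk] := eqVneq j (k + 1); last exact: ctensor_shape.
apply: ctensor_ext => p q pqk.
have -> : comp (0 : ctensor_obj k) p q = 0 by rewrite /comp; case: decP.
rewrite comp_diff pqk eqxx {1}/ctensor_diff_at !comp_diff.
rewrite addrAC addrA pqk eqxx /ctensor_diff_at.
have dA t : tensor_map (diff A (p + 1) p) (idfun : {linear B q -> B q})
    (tensor_map (diff A (p + 1 + 1) (p + 1)) (idfun : {linear B q -> B q}) t) = 0.
  pose dd : {linear tensor (A (p + 1 + 1)) (B q) -> tensor (A p) (B q)} :=
    tensor_map (diff A (p + 1) p) (idfun : {linear B q -> B q}) \o
    tensor_map (diff A (p + 1 + 1) (p + 1)) (idfun : {linear B q -> B q}).
  rewrite -[LHS]/(dd t) (@tensor_ext R _ _ _ dd \0) // => x y.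
  rewrite -[LHS]/(tensor_map (diff A (p + 1) p) idfun
                  (tensor_map (diff A (p + 1 + 1) (p + 1)) idfun (tens x y))).
  by rewrite !tensor_mapE diff_diff tens0r.
have dB t : tensor_map (idfun : {linear A p -> A p}) (diff B (q + 1) q)
    (tensor_map (idfun : {linear A p -> A p}) (diff B (q + 1 + 1) (q + 1)) t) = 0.
  pose dd : {linear tensor (A p) (B (q + 1 + 1)) -> tensor (A p) (B q)} :=
    tensor_map (idfun : {linear A p -> A p}) (diff B (q + 1) q) \o
    tensor_map (idfun : {linear A p -> A p}) (diff B (q + 1 + 1) (q + 1)).
  rewrite -[LHS]/(dd t) (@tensor_ext R _ _ _ dd \0) // => x y.
  rewrite -[LHS]/(tensor_map idfun (diff B (q + 1) q)
                  (tensor_map idfun (diff B (q + 1 + 1) (q + 1)) (tens x y))).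
  by rewrite !tensor_mapE diff_diff tensr0.
have dAB t : tensor_map (diff A (p + 1) p) (idfun : {linear B q -> B q})
    (tensor_map (idfun : {linear A (p + 1) -> A (p + 1)}) (diff B (q + 1) q) t) =
  tensor_map (idfun : {linear A p -> A p}) (diff B (q + 1) q)
    (tensor_map (diff A (p + 1) p) (idfun : {linear B (q + 1) -> B (q + 1)}) t).
  pose d1 : {linear tensor (A (p + 1)) (B (q + 1)) -> tensor (A p) (B q)} :=
    tensor_map (diff A (p + 1) p) (idfun : {linear B q -> B q}) \o
    tensor_map (idfun : {linear A (p + 1) -> A (p + 1)}) (diff B (q + 1) q).
  pose d2 : {linear tensor (A (p + 1)) (B (q + 1)) -> tensor (A p) (B q)} :=
    tensor_map (idfun : {linear A p -> A p}) (diff B (q + 1) q) \o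
    tensor_map (diff A (p + 1) p) (idfun : {linear B (q + 1) -> B (q + 1)}).
  rewrite -[LHS]/(d1 t) -[RHS]/(d2 t); apply: tensor_ext => x y.
  rewrite -[LHS]/(tensor_map (diff A (p + 1) p) idfun
                  (tensor_map idfun (diff B (q + 1) q) (tens x y))).
  rewrite -[RHS]/(tensor_map idfun (diff B (q + 1) q)
                  (tensor_map (diff A (p + 1) p) idfun (tens x y))).
  by rewrite !tensor_mapE.
rewrite [tensor_map _ _ (_ + _)]linearD dA add0r.
rewrite [tensor_map _ _ (_ + _)]linearD.
rewrite ![tensor_map _ _ (_ *: _)]linearZ_LR dB scaler0 addr0 dAB.
by rewrite -scalerDl signr_absz_add1 addNr scale0r.
Qed.

Definition ctensor := Complex ctensor_shape ctensor_diff_diff.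

End ComplexTensor.

(* The Koszul complex on s_0, ..., s_(n-1): K_p is free on the p-subsets of 'I_n,
   with d e_S = sum over k in S of (-1)^#{l in S | l < k} s_k e_(S \ k); an element
   is given by its coordinates. *)
Section Koszul.
Variables (n : nat) (s : 'I_n -> R).

Definition psets (p : int) := {S : {set 'I_n} | #|S|%:Z == p}.
Definition koszul_obj (p : int) : lmodType R := {ffun psets p -> R^o}.

Definition kcoef p (c : koszul_obj p) (S : {set 'I_n}) : R :=
  oapp c 0 (insub S).

(* #{l in S | l < k} *)
Definition below (S : {set 'I_n}) (k : 'I_n) : nat := #|[set l in S | (l < k)%N]|.

Definition koszul_diff_fun p q (c : koszul_obj p) : koszul_obj q :=
  [ffun T : psets q => \sum_(k | k \notin val T)
     (-1) ^+ below (val T) k * s k * kcoef c (k |: val T)].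

Lemma kcoef_linear p S : linear (fun c : koszul_obj p => kcoef c S : R^o).
Proof.
move=> a c c'; rewrite /kcoef; case: insub => [T|] /=; first by rewrite !ffunE.
by rewrite scaler0 addr0.
Qed.

Lemma koszul_diff_linear p q : linear (@koszul_diff_fun p q).
Proof.
move=> a c c'; apply/ffunP => T; rewrite !ffunE scaler_sumr -big_split /=.
apply: eq_bigr => k _; rewrite [kcoef _ _]kcoef_linear mulrDr.
by congr (_ + _); rewrite /GRing.scale /= mulrCA.
Qed.

Definition koszul_diff p q : {linear koszul_obj p -> koszul_obj q} :=
  mk_linear (@koszul_diff_linear p q).

Lemma kcoef_out p (c : koszul_obj p) (S : {set 'I_n}) : #|S|%:Z != p -> kcoef c S = 0.
Proof. by move=> Sp; rewrite /kcoef insubN. Qed.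

Lemma card_psetU1 p (T : psets p) k : k \notin val T -> #|k |: val T|%:Z = p + 1.
Proof. by case: T => S /= /eqP Sp kS; rewrite cardsU1 kS -Sp addrC. Qed.

Lemma koszul_shape i j : i != j + 1 -> forall c, koszul_diff i j c = 0.
Proof.
move=> ij c; apply/ffunP => T; rewrite !ffunE big1 // => k kT.
by rewrite kcoef_out ?mulr0 // (card_psetU1 kT) eq_sym.
Qed.

Lemma kcoef_diff p q (c : koszul_obj p) (S : {set 'I_n}) : #|S|%:Z = q ->
  kcoef (koszul_diff p q c) S =
  \sum_(k | k \notin S) (-1) ^+ below S k * s k * kcoef c (k |: S).
Proof.
move=> /eqP Sq; rewrite [LHS]/kcoef insubT /=.
by rewrite [LHS]ffunE.
Qed.

Lemma belowU1 (S : {set 'I_n}) k l : k \notin S ->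
  below (k |: S) l = ((k < l)%N + below S l)%N.
Proof.
move=> kS; rewrite /below; case: (boolP (k < l)%N) => kl.
  have -> : [set x in k |: S | (x < l)%N] = k |: [set x in S | (x < l)%N].
    by apply/setP => x; rewrite !inE; case: eqVneq => [->|] //=; rewrite kl.
  by rewrite cardsU1 !inE (negbTE kS).
congr #|pred_of_set _|; apply/setP => x; rewrite !inE.
by case: eqVneq => [->|] //=; rewrite (negbTE kl) andbF.
Qed.

Lemma koszul_diff_diff i j k c : koszul_diff j k (koszul_diff i j c) = 0.
Proof.
have [-> | jk] := eqVneq j (k + 1); last exact: koszul_shape.
apply/ffunP => T; rewrite [LHS]ffunE [RHS]ffunE.
pose G x y := (-1) ^+ below (val T) x * s x *
  ((-1) ^+ below (x |: val T) y * s y * kcoef c (y |: (x |: val T))).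
transitivity (\sum_(x | x \notin val T)
                \sum_(y | (y != x) && (y \notin val T)) G x y).
  apply: eq_bigr => x xT; rewrite kcoef_diff ?(card_psetU1 xT) // mulr_sumr.
  by apply: eq_bigl => y; rewrite !inE negb_or.
rewrite pair_big_dep /= (bigID (fun u : 'I_n * 'I_n => (u.1 < u.2)%N)) /=.
rewrite [X in _ + X](reindex_inj (h := fun u : 'I_n * 'I_n => (u.2, u.1))) /=; last first.
  by move=> [x y] [x' y'] [-> ->].
rewrite [X in _ + X](eq_bigl (fun u : 'I_n * 'I_n => ((u.1 \notin val T) &&
    ((u.2 != u.1) && (u.2 \notin val T))) && (u.1 < u.2)%N)); last first.
  move=> [x y] /=; rewrite -leqNgt ltn_neqAle [y == x]eq_sym.
  by case: (x == y :> nat) (val_eqE x y) => /= <-; case: (x \in _); case: (y \in _); rewrite /= ?andbF.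
rewrite -big_split big1 //= => -[x y] /= /andP[/and3P[xT yx yT] xy].
rewrite /G !belowU1 // xy ltnNge (ltnW xy) /= add0n finset.setUCA.
by rewrite exprS; ring.
Qed.

Definition koszul := Complex koszul_shape koszul_diff_diff.
End Koszul.

(* Depth, computed from a sequence [s]; meant for [s] generating the maximal
   ideal, in which case it does not depend on [s]. *)
Definition depth n (s : 'I_n -> R) (X : complex) : \bar int :=
  (n%:Z%:E - hsup (ctensor (koszul s) X))%E.

Definition zero_module (M : lmodType R) : Prop := forall x : M, x = 0.

Definition bounded_below (X : complex) : Prop :=
  exists N : int, forall i, i < N -> zero_module (X i).

Definition projective_resolution (X P : complex) (f : chain_map P X) : Prop :=
  [/\ forall i, projective (P i), bounded_below P & quasi_iso f].

(* T represents M ⊗^L X in the derived category.  Such resolutions exist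
   exactly when H_i(X) = 0 for i << 0. *)
Definition derived_tensor (M : lmodType R) (X T : complex) : Prop :=
  exists (P : complex) (f : chain_map P X),
    projective_resolution f /\ derived_iso T (mtensor M P).

(* The last clause says that Coker(F_1 -> F_0) is isomorphic to G. *)
Definition Gflat (G : lmodType R) : Prop :=
  exists F : complex,
    [/\ forall i, flat (F i), acyclic F,
        forall I : lmodType R, injective_module I -> acyclic (mtensor I F) &
        exists2 p : {linear F 0 -> G},
          (forall y, exists x, p x = y) & (forall x, p x = 0 <-> boundary x)].

Definition Gflat_resolution (X G : complex) : Prop :=
  [/\ forall i, Gflat (G i), bounded_below G & derived_iso G X].

(* Meant for homologically bounded X. *)
Definition Gfd (X : complex) : \bar int :=
  infimum +oo%E [set d | exists2 G : complex, Gflat_resolution X G &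
                                d = supZ [set n | ~ zero_module (G n)]].

End Complexes.

(* Main.v *)
Require Import Defs.
From HB Require Import structures.
From mathcomp Require Import all_boot all_order all_algebra.
From mathcomp Require Import freeg ring zify.
From mathcomp Require Import boolp classical_sets constructive_ereal.

(* [path.cycle] would otherwise shadow [Defs.cycle]. *)
Import Defs.

(* Let K be the Koszul complex on s and G a bounded complex of G-flat modules
   isomorphic to W, so that the claim reads sup (K (x) G) = sup K + sup (E (x) G).

   Injective modules tensor the totally acyclic complexes of flat modules that define
   G-flatness to exact complexes.  By dimension shifting, a bounded above complex X of
   flat and injective modules that is exact above degree t satisfies H_j(X (x) M) = 0
   for j > t and every G-flat M.  If moreover the homology of X is torsion, H_t(X)
   embeds in a direct sum J of copies of E, and the cone of the resulting map X -> J[t]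
   is again of this kind, with the same t.  Descending induction on j and the long
   exact sequence of the cone give H_j(X (x) G) = 0 for j > t + sup (E (x) G); this
   applies to X = K.  In degree j = t + sup (E (x) G) with t = sup K the homology does
   not vanish, because maps E -> J' that kill the socle of E factor through
   multiplication by the s_i, hence kill the socle of H(E (x) G). *)

Set Implicit Arguments.
Unset Strict Implicit.
Unset Printing Implicit Defensive.

Import Order.TTheory GRing.Theory Num.Theory.
Local Open Scope ring_scope.

(** * Submodules, quotients and tensor products *)

(** Since the homology of W need not be finitely generated, Nakayama's lemma is out of reach; the
    socle of E replaces it. A nonzero class annihilated by powers of the s_i has a nonzero multiple
    annihilated by every s_i, so a map that is injective on socles is injective on torsion homology.
    The bound t does not grow under the cone construction because X -> J[t] is injective on H_t,
    which makes H_(t+1) of the cone vanish. The terms of the cone stay admissible because one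
    property of them is used, and it passes to direct sums: tensoring with them keeps totally
    acyclic complexes of flat modules exact. The descending induction starts above t + hi, for hi a
    bound on the degrees of G, where filtering by the degree of G suffices. Replacing W by G is
    harmless on the Koszul side because K is bounded with flat terms, and on the side of E because
    the cone of a comparison map P -> G is exact, bounded below and has terms without higher Tor
    against E. The length n of s occurs on both sides and cancels. *)

Section Modules.
Variable R : nzRingType.

Section Subm.
Variables (M : lmodType R) (S : submodClosed M).
Record subm := Subm { subm_val :> M ; _ : subm_val \in S }.
HB.instance Definition _ := [isSub for subm_val].
HB.instance Definition _ := [Choice of subm by <:].
HB.instance Definition _ := [SubChoice_isSubLmodule of subm by <:].
End Subm.

Definition submodule (M : lmodType R) (P : M -> Prop) : Prop :=
  P 0 /\ forall a x y, P x -> P y -> P (a *: x + y).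

Lemma submodule_closed (M : lmodType R) (P : M -> Prop) :
  submodule P -> submod_closed (fun x => `[< P x >]).
Proof.
case=> P0 PD; split; first exact/asboolP.
by move=> a x y /asboolP Px /asboolP Py; apply/asboolP/PD.
Qed.

Definition submodule_pred (M : lmodType R) (P : M -> Prop) (h : submodule P) :
    submodClosed M :=
  HB.pack (fun x => `[< P x >])
    (GRing.isSubmodClosed.Build R M (fun x => `[< P x >]) (submodule_closed h)).

(** Submodules are used up to isomorphism, through an injective map with the prescribed image, so
    that later arguments never unfold the subtype; quotients are treated in the same way. *)
Lemma submodule_carrier (M : lmodType R) (P : M -> Prop) : submodule P ->
  exists (N : lmodType R) (i : {linear N -> M}),
    injective i /\ forall x, P x <-> exists y, i y = x.
Proof.
move=> h; exists (subm (submodule_pred h) : lmodType R).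
have L : linear (fun x : subm (submodule_pred h) => subm_val x) by [].
exists (mk_linear L); split=> [x y /val_inj //|x]; split=> [Px|[[y Py] <-]].
  have Px' : x \in submodule_pred h by apply/asboolP.
  by exists (Subm Px').
exact/asboolP.
Qed.

Lemma quotient_carrier (M : lmodType R) (P : M -> Prop) : submodule P ->
  exists (Q : lmodType R) (p : {linear M -> Q}),
    (forall y, exists x, p x = y) /\ forall x, p x = 0 <-> P x.
Proof.
move=> h; exists (qmod (submodule_pred h) : lmodType R).
exists (qmod_pi (submodule_pred h)); split; first exact: qmod_pi_surj.
move=> x; have E := qmod_piE (submodule_pred h) x 0.
rewrite subr0 linear0 in E.
by split=> [/eqP|Px]; [rewrite E => /asboolP | apply/eqP; rewrite E; apply/asboolP].
Qed.

Lemma kernel_submodule (M N : lmodType R) (f : {linear M -> N}) :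
  submodule (fun x => f x = 0).
Proof.
by split=> [|a x y x0 y0]; rewrite ?linear0 // linearP x0 y0 scaler0 addr0.
Qed.

Lemma image_submodule (M N : lmodType R) (f : {linear M -> N}) :
  submodule (fun y => exists x, f x = y).
Proof.
split=> [|a _ _ [x <-] [y <-]]; first by exists 0; rewrite linear0.
by exists (a *: x + y); rewrite linearP.
Qed.

Lemma linear_inj (M N : lmodType R) (f : {linear M -> N}) :
  (forall x, f x = 0 -> x = 0) -> injective f.
Proof.
move=> f0 x y fxy; apply/eqP; rewrite -subr_eq0; apply/eqP/f0.
by rewrite linearB fxy subrr.
Qed.

Lemma inj_eq0 (M N : lmodType R) (f : {linear M -> N}) x :
  injective f -> f x = 0 -> x = 0.
Proof. by move=> fi fx; apply: fi; rewrite fx linear0. Qed.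

Lemma factor_surj (L M N : lmodType R) (p : {linear L -> M}) (g : {linear L -> N}) :
  (forall y, exists x, p x = y) -> (forall x, p x = 0 -> g x = 0) ->
  exists h : {linear M -> N}, forall x, h (p x) = g x.
Proof.
move=> /choice[q qK] pg.
have qg x : g (q (p x)) = g x.
  by apply/eqP; rewrite -subr_eq0 -linearB pg // linearB qK subrr.
have L' : linear (g \o q).
  move=> a x y /=; rewrite -linearP -(qg (a *: q x + q y)).
  by rewrite linearP !qK.
by exists (mk_linear L').
Qed.

Lemma factor_inj (L M N : lmodType R) (i : {linear N -> M}) (g : {linear L -> M}) :
  injective i -> (forall x, exists y, i y = g x) ->
  exists h : {linear L -> N}, forall x, i (h x) = g x.
Proof.
move=> ii /choice[h hK].
have L' : linear h by move=> a x y; apply: ii; rewrite linearP !hK linearP.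
by exists (mk_linear L').
Qed.

End Modules.

Section Inj.
Variable R : comNzRingType.

(** Extension along a map p that need not be injective: g descends to the image of p, and
    injectivity of J applies to the inclusion of that image. *)
Lemma injective_extend (J L M : lmodType R) (p : {linear L -> M})
    (g : {linear L -> J}) : injective_module J ->
  (forall x, p x = 0 -> g x = 0) -> exists h : {linear M -> J}, forall x, h (p x) = g x.
Proof.
move=> hJ pg; have [N [i [ii iP]]] := submodule_carrier (image_submodule p).
have [q qE] : exists q : {linear L -> N}, forall x, i (q x) = p x.
  by apply: factor_inj => // x; apply/iP; exists x.
have [|x|k kE] := @factor_surj _ _ _ _ q g.
- move=> y; have [x px] : exists x, p x = i y by apply/iP; exists y.
  by exists x; apply: ii; rewrite qE.
- by move=> qx; apply: pg; rewrite -qE qx linear0.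
by have [h hE] := hJ _ _ i k ii; exists h => x; rewrite -qE hE kE.
Qed.

Lemma projective_lift (P L M : lmodType R) (p : {linear L -> M})
    (g : {linear P -> M}) : projective P ->
  (forall x, exists y, p y = g x) -> exists h : {linear P -> L}, forall x, p (h x) = g x.
Proof.
move=> hP pg; have [N [i [ii iP]]] := submodule_carrier (image_submodule p).
have [q qE] : exists q : {linear L -> N}, forall x, i (q x) = p x.
  by apply: factor_inj => // x; apply/iP; exists x.
have [g' g'E] : exists g' : {linear P -> N}, forall x, i (g' x) = g x.
  by apply: factor_inj => // x; apply/iP.
have [|h hE] := hP _ _ q g'.
  move=> y; have [x px] : exists x, p x = i y by apply/iP; exists y.
  by exists x; apply: ii; rewrite qE.
by exists h => x; rewrite -qE hE.
Qed.
End Inj.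

(** * Tensor products of modules *)

Section Tens.
Variable R : comNzRingType.

(** Scalars are absorbed into the first factor of a pure tensor, so pure tensors and sums reach
    everything. *)
Lemma tens_ind (M N : lmodType R) (P : tensor M N -> Prop) :
  (forall x y, P (tens x y)) -> (forall t u, P t -> P u -> P (t + u)) ->
  forall t, P t.
Proof.
move=> Pt PD t; have [u <-] := qmod_pi_surj t.
pose q : {linear {freeg (M * N) / R} -> tensor M N} := qmod_pi (@tensor_rel R M N).
rewrite -[qmod_pi _ _]/(q u) -[u]freeg_sumE raddf_sum; apply: (big_ind P) => //.
  by rewrite -(tens0r M (0 : N)).
move=> -[x y] _.
have -> : Freeg [:: (coeff (x, y) u, (x, y))] = coeff (x, y) u *: fgen x y.
  by apply/eqP/freeg_eqP => z; rewrite coeffZ !coeffU mul1r.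
have E : q (coeff (x, y) u *: fgen x y) = coeff (x, y) u *: tens x y.
  exact: (linearZ_LR q).
apply: (eq_ind_r P _ E).
by have /= <- := linearZ_LR (mk_linear (tens_linearl y)) (coeff (x, y) u) x.
Qed.

Lemma tmap_eq (M M' N N' : lmodType R) (f f' : {linear M -> M'})
    (g g' : {linear N -> N'}) t :
  f =1 f' -> g =1 g' -> tensor_map f g t = tensor_map f' g' t.
Proof.
move=> ff gg; elim/tens_ind: t => [x y|t u Ht Hu]; first by rewrite !tensor_mapE ff gg.
by rewrite !linearD Ht Hu.
Qed.

Lemma tmap_id (M N : lmodType R) (f : {linear M -> M}) (g : {linear N -> N}) t :
  f =1 id -> g =1 id -> tensor_map f g t = t.
Proof.
move=> ff gg; elim/tens_ind: t => [x y|t u Ht Hu]; first by rewrite !tensor_mapE ff gg.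
by rewrite !linearD Ht Hu.
Qed.

Lemma tmap_comp (M M' M'' N N' N'' : lmodType R) (f : {linear M -> M'})
    (g : {linear N -> N'}) (f' : {linear M' -> M''}) (g' : {linear N' -> N''})
    (f2 : {linear M -> M''}) (g2 : {linear N -> N''}) t :
  f' \o f =1 f2 -> g' \o g =1 g2 ->
  tensor_map f' g' (tensor_map f g t) = tensor_map f2 g2 t.
Proof.
move=> ff gg; elim/tens_ind: t => [x y|t u Ht Hu].
  by rewrite !tensor_mapE -ff -gg.
by rewrite !linearD Ht Hu.
Qed.

Lemma tmap0l (M M' N N' : lmodType R) (f : {linear M -> M'}) (g : {linear N -> N'}) t :
  (forall x, f x = 0) -> tensor_map f g t = 0.
Proof.
move=> f0; elim/tens_ind: t => [x y|t u Ht Hu].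
  by rewrite tensor_mapE f0 tens0r.
by rewrite linearD Ht Hu addr0.
Qed.

Lemma tmap0r (M M' N N' : lmodType R) (f : {linear M -> M'}) (g : {linear N -> N'}) t :
  (forall x, g x = 0) -> tensor_map f g t = 0.
Proof.
move=> f0; elim/tens_ind: t => [x y|t u Ht Hu].
  by rewrite tensor_mapE f0 tensr0.
by rewrite linearD Ht Hu addr0.
Qed.

Lemma tensZl (M N : lmodType R) a (x : M) (y : N) : tens (a *: x) y = a *: tens x y.
Proof. exact: (linearZ_LR (mk_linear (tens_linearl y)) a x). Qed.
Lemma tensZr (M N : lmodType R) a (x : M) (y : N) : tens x (a *: y) = a *: tens x y.
Proof. exact: (linearZ_LR (mk_linear (tens_linearr x)) a y). Qed.

Lemma tens_swapl (M N : lmodType R) (y : N) : linear (fun x : M => tens y x).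
Proof. exact: tens_linearr. Qed.
Lemma tens_swapr (M N : lmodType R) (x : M) : linear (fun y : N => tens y x).
Proof. exact: tens_linearl. Qed.

Definition tswap (M N : lmodType R) : {linear tensor M N -> tensor N M} :=
  mk_linear (tensor_lift_linear (@tens_swapl M N) (@tens_swapr M N)).

Lemma tswapE (M N : lmodType R) (x : M) (y : N) : tswap M N (tens x y) = tens y x.
Proof. exact: (tensor_liftE (@tens_swapl M N) (@tens_swapr M N)). Qed.

Lemma tswapK (M N : lmodType R) t : tswap N M (tswap M N t) = t.
Proof.
elim/tens_ind: t => [x y|t u Ht Hu]; first by rewrite !tswapE.
by rewrite !linearD Ht Hu.
Qed.

Lemma tswap_map (M M' N N' : lmodType R) (f : {linear M -> M'}) (g : {linear N -> N'}) t :
  tswap M' N' (tensor_map f g t) = tensor_map g f (tswap M N t).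
Proof.
elim/tens_ind: t => [x y|t u Ht Hu]; first by rewrite !(tensor_mapE, tswapE).
by rewrite !linearD Ht Hu.
Qed.

(** Rather than chasing relations, the proof builds a bilinear map from B and M to the cokernel Q of
    B (x) N -> B (x) L. It is well defined because ker p is contained in the image of i, and it
    shows that the projection to Q factors through B (x) p. *)
Lemma tensor_right_exact (B N L M : lmodType R) (i : {linear N -> L})
    (p : {linear L -> M}) :
  (forall y, exists x, p x = y) -> (forall x, p x = 0 -> exists y, i y = x) ->
  forall t : tensor B L, tensor_map (idfun : {linear B -> B}) p t = 0 ->
  exists u, tensor_map (idfun : {linear B -> B}) i u = t.
Proof.
move=> ps pk t pt0.
have [Q [q [qs qk]]] := quotient_carrier
  (image_submodule (tensor_map (idfun : {linear B -> B}) i)).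
have [b bE] : {b : B -> {linear M -> Q} & forall x y, b x (p y) = q (tens x y)}.
  apply: (@choice _ _ (fun x (b : {linear M -> Q}) => forall y, b (p y) = q (tens x y))).
  move=> x; have L' : linear (fun y => q (tens x y)).
    by move=> a y z; rewrite tens_linearr linearP.
  apply: (factor_surj (g := mk_linear L') ps) => y /pk[z <-] /=.
  by apply/qk; exists (tens x z); rewrite tensor_mapE.
have bl y : linear (b^~ y).
  move=> a x z; have [w <-] := ps y.
  by rewrite !bE -linearP -tens_linearl.
have br x : linear (b x) by move=> a y z; rewrite linearP.
pose F := mk_linear (tensor_lift_linear bl br).
apply/qk.
have -> : q t = F (tensor_map (idfun : {linear B -> B}) p t).
  elim/tens_ind: {pt0} t => [x y|t u Ht Hu].
    by rewrite tensor_mapE -bE; exact: esym (tensor_liftE bl br _ _).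
  by rewrite !linearD Ht Hu.
by rewrite pt0 linear0.
Qed.

Lemma tensor_surj (B L M : lmodType R) (p : {linear L -> M}) :
  (forall y, exists x, p x = y) ->
  forall t, exists u, tensor_map (idfun : {linear B -> B}) p u = t.
Proof.
move=> ps t; elim/tens_ind: t => [x y|t u [t' <-] [u' <-]].
  by have [z <-] := ps y; exists (tens x z); rewrite tensor_mapE.
by exists (t' + u'); rewrite linearD.
Qed.

End Tens.

Notation idL M := (idfun : {linear M -> M}).

(** * Flat modules and direct sum decompositions *)

Section Flat.
Variable R : comNzRingType.

Lemma tmapC (M M' N N' : lmodType R) (f : {linear M -> M'}) (g : {linear N -> N'}) t :
  tensor_map (idL M') g (tensor_map f (idL N) t) =
  tensor_map f (idL N') (tensor_map (idL M) g t).
Proof. by rewrite !(@tmap_comp _ _ _ _ _ _ _ _ _ _ _ f g). Qed.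

Lemma tmap0rr (B L M N : lmodType R) (f : {linear L -> M}) (g : {linear M -> N}) t :
  (forall x, g (f x) = 0) -> tensor_map (idL B) g (tensor_map (idL B) f t) = 0.
Proof. by move=> gf; rewrite (@tmap_comp _ _ _ _ _ _ _ _ _ _ _ (idL B) \0) // tmap0r. Qed.

Lemma tmap0ll (B L M N : lmodType R) (f : {linear L -> M}) (g : {linear M -> N}) t :
  (forall x, g (f x) = 0) -> tensor_map g (idL B) (tensor_map f (idL B) t) = 0.
Proof. by move=> gf; rewrite (@tmap_comp _ _ _ _ _ _ _ _ _ _ _ \0 (idL B)) // tmap0l. Qed.

Lemma tensor_right_exactl (B N L M : lmodType R) (i : {linear N -> L})
    (p : {linear L -> M}) :
  (forall y, exists x, p x = y) -> (forall x, p x = 0 -> exists y, i y = x) ->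
  forall t, tensor_map p (idL B) t = 0 -> exists u, tensor_map i (idL B) u = t.
Proof.
move=> ps pk t pt0; have [|u uE] := tensor_right_exact (B := B) ps pk (t := tswap L B t).
  by rewrite -tswap_map pt0 linear0.
by exists (tswap B N u); rewrite -tswap_map uE tswapK.
Qed.

Lemma tensor_surjl (B L M : lmodType R) (p : {linear L -> M}) :
  (forall y, exists x, p x = y) -> forall t, exists u, tensor_map p (idL B) u = t.
Proof.
move=> ps t; have [u uE] := tensor_surj ps (tswap M B t).
by exists (tswap B L u); rewrite -tswap_map uE tswapK.
Qed.

Lemma tensor_inj_swap (B L M : lmodType R) (f : {linear L -> M}) :
  injective (tensor_map (idL B) f) <-> injective (tensor_map f (idL B)).
Proof.
split=> fi; apply: linear_inj => t t0.
  by rewrite -[t]tswapK (inj_eq0 (x := tswap L B t) fi) ?linear0 // -tswap_map t0 linear0.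
by rewrite -[t]tswapK (inj_eq0 (x := tswap B L t) fi) ?linear0 // -tswap_map t0 linear0.
Qed.

(** The map p factors through L / ker p, which embeds in M. Flatness preserves this embedding, and
    right exactness handles the quotient map. *)
Lemma flat_exact (F N L M : lmodType R) (i : {linear N -> L}) (p : {linear L -> M}) :
  flat F -> (forall x, p x = 0 -> exists y, i y = x) ->
  forall t, tensor_map (idL F) p t = 0 -> exists u, tensor_map (idL F) i u = t.
Proof.
move=> hF pk t pt0; have [Q [q [qs qk]]] := quotient_carrier (kernel_submodule p).
have [j jE] := factor_surj (g := p) qs (fun x => (qk x).1).
have ji : injective j.
  apply: linear_inj => y; have [x <-] := qs y; rewrite jE; exact: (qk x).2.
apply: (tensor_right_exact qs) => [x /qk/pk //|].
apply: (inj_eq0 (hF _ _ _ ji)).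
by rewrite (@tmap_comp _ _ _ _ _ _ _ _ _ _ _ (idL F) p).
Qed.

(* The maps [io i] and [pr i] exhibit A as a direct sum of the V i. *)
Definition decomposition (A : lmodType R) (I : eqType) (V : I -> lmodType R)
    (io : forall i, {linear V i -> A}) (pr : forall i, {linear A -> V i}) : Prop :=
  forall a, exists s : seq I, forall s', uniq s' -> {subset s <= s'} ->
    a = \sum_(i <- s') io i (pr i a).

Section Decomposition.
Variables (A : lmodType R) (I : eqType) (V : I -> lmodType R).
Variables (io : forall i, {linear V i -> A}) (pr : forall i, {linear A -> V i}).
Hypothesis dec : decomposition io pr.

(** The freedom to enlarge the index list in [decomposition] pays off here: for a sum of tensors the
    two lists are concatenated, and each expansion remains valid on the longer list. *)
Lemma decomposition_tensor (N : lmodType R) (t : tensor A N) :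
  exists s : seq I, forall s', uniq s' -> {subset s <= s'} ->
    t = \sum_(i <- s') tensor_map (io i) (idL N) (tensor_map (pr i) (idL N) t).
Proof.
elim/tens_ind: t => [a y|t u [s sE] [r rE]].
  have [s sE] := dec a; exists s => s' us' ss'.
  rewrite {1}(sE s' us' ss').
  transitivity (\sum_(i <- s') tens (io i (pr i a)) y).
    exact: (raddf_sum (mk_linear (tens_linearl y))).
  by apply: eq_bigr => i _; rewrite !tensor_mapE.
exists (s ++ r) => s' us' ss'.
have [ss rs] : {subset s <= s'} /\ {subset r <= s'}.
  by split=> x xs; apply: ss'; rewrite mem_cat xs ?orbT.
rewrite {1}(sE s') // {1}(rE s') // -big_split; apply: eq_bigr => i _.
by rewrite !linearD.
Qed.

Lemma decomposition_tensor_eq0 (N : lmodType R) (t : tensor A N) :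
  (forall i, tensor_map (pr i) (idL N) t = 0) -> t = 0.
Proof.
move=> t0; have [s sE] := decomposition_tensor t.
rewrite (sE (undup s)) ?undup_uniq // ?big1 // => [i _|x]; last by rewrite mem_undup.
by rewrite t0 linear0.
Qed.

Lemma decomposition_flat : (forall i, flat (V i)) -> flat A.
Proof.
move=> hV M N f fi; apply: linear_inj => t t0.
apply: decomposition_tensor_eq0 => i; apply: (inj_eq0 (hV i _ _ _ fi)).
by rewrite tmapC t0 linear0.
Qed.

Lemma decomposition_exact (L M N : lmodType R) (f : {linear L -> M}) (g : {linear M -> N}) :
  (forall i t, tensor_map (idL (V i)) g t = 0 ->
     exists u, tensor_map (idL (V i)) f u = t) ->
  forall t, tensor_map (idL A) g t = 0 -> exists u, tensor_map (idL A) f u = t.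
Proof.
move=> hV t t0; have [s sE] := decomposition_tensor t.
have ex i : exists u, tensor_map (idL (V i)) f u = tensor_map (pr i) (idL M) t.
  by apply: hV; rewrite tmapC t0 linear0.
pose u i := sval (cid (ex i)).
have uE i : tensor_map (idL (V i)) f (u i) = tensor_map (pr i) (idL M) t.
  exact: svalP (cid (ex i)).
exists (\sum_(i <- undup s) tensor_map (io i) (idL L) (u i)).
rewrite raddf_sum [RHS](sE (undup s)) ?undup_uniq //; last by move=> x; rewrite mem_undup.
by apply: eq_bigr => i _; rewrite -uE -tmapC.
Qed.
End Decomposition.

Lemma big_superset (V : nmodType) (I : eqType) (s s' : seq I) (F : I -> V) :
  uniq s -> uniq s' -> {subset s <= s'} -> (forall x, x \notin s -> F x = 0) ->
  \sum_(x <- s') F x = \sum_(x <- s) F x.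
Proof.
move=> us us' ss' F0; rewrite (bigID (mem s)) /= [X in _ + X]big1 ?addr0 //.
rewrite -big_filter; apply: perm_big; apply: uniq_perm; rewrite ?filter_uniq //.
by move=> x; rewrite mem_filter; case: (boolP (x \in s)) => //= /ss' ->.
Qed.

Lemma scale_linearl (L : lmodType R) (y : L) : linear (fun r : R^o => r *: y).
Proof. by move=> a r r'; rewrite scalerDl scalerA. Qed.

Lemma scale_linearr (L : lmodType R) (r : R^o) : linear (fun y : L => r *: y).
Proof. by move=> a y y'; rewrite scalerDr !scalerA mulrC. Qed.

Definition tensor_act (L : lmodType R) : {linear tensor R^o L -> L} :=
  mk_linear (tensor_lift_linear (@scale_linearl L) (@scale_linearr L)).

Lemma tensor_actE (L : lmodType R) (r : R^o) (y : L) : tensor_act L (tens r y) = r *: y.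
Proof. exact: (tensor_liftE (@scale_linearl L) (@scale_linearr L)). Qed.

Lemma tensor_act_map (L L' : lmodType R) (f : {linear L -> L'}) (t : tensor R^o L) :
  tensor_act L' (tensor_map (idL (R^o : lmodType R)) f t) = f (tensor_act L t).
Proof.
elim/tens_ind: t => [r y|t u Ht Hu]; first by rewrite tensor_mapE !tensor_actE linearZ.
by rewrite !linearD Ht Hu.
Qed.

Lemma flat_regular : flat (R^o : lmodType R).
Proof.
move=> M N f fi.
have actK (L : lmodType R) (t : tensor R^o L) : tens (1 : R^o) (tensor_act L t) = t.
  elim/tens_ind: t => [r y|t u Ht Hu].
    by rewrite tensor_actE tensZr -tensZl; congr tens; rewrite /GRing.scale /= mulr1.
  rewrite linearD -{2}Ht -{2}Hu.
  exact: (raddfD (mk_linear (tens_linearr (1 : R^o)))).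
apply: linear_inj => t t0; rewrite -[t]actK.
rewrite (inj_eq0 (x := tensor_act M t) fi) ?tensr0 //.
by rewrite -tensor_act_map t0 linear0.
Qed.

Lemma flat_retract (P L : lmodType R) (i : {linear P -> L}) (p : {linear L -> P}) :
  (forall x, p (i x) = x) -> flat L -> flat P.
Proof.
move=> pK hL M N f fi; apply: linear_inj => t t0.
rewrite -[t](@tmap_id _ _ _ (p \o i) (idL M)) //.
rewrite -(@tmap_comp _ _ _ _ _ _ _ i (idL M) p (idL M)) //.
rewrite (inj_eq0 (x := tensor_map i _ t) (hL _ _ _ fi)) ?linear0 //.
by rewrite tmapC t0 linear0.
Qed.

Lemma fglift_linear (X : choiceType) (M : lmodType R) (h : X -> M) :
  linear (fun D : {freeg X / R} => fglift h D).
Proof.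
pose Fa : {additive {freeg X / R} -> M} :=
  HB.pack (fglift h) (GRing.isZmodMorphism.Build _ _ _ (@lift_is_additive R X M h)).
have FZ a t : Fa (a *: t) = a *: Fa t.
  rewrite -[t]freeg_sumE scaler_sumr !raddf_sum.
  apply: eq_bigr => x _.
  have -> : a *: Freeg [:: (coeff x t, x)] = Freeg [:: (a * coeff x t, x)].
    by apply/eqP/freeg_eqP => y; rewrite coeffZ !coeffU mulrA.
  by rewrite /= !liftU scalerA.
by move=> a t u; rewrite -[LHS]/(Fa _) raddfD FZ.
Qed.

Definition free_lift (X : choiceType) (M : lmodType R) (h : X -> M) :
  {linear {freeg X / R} -> M} := mk_linear (fglift_linear h).

Lemma free_liftU (X : choiceType) (M : lmodType R) (h : X -> M) x :
  free_lift h (Freeg [:: (1, x)]) = h x.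
Proof. by rewrite /= liftU scale1r. Qed.

Lemma free_liftE (X : choiceType) (M : lmodType R) (h : X -> M) D :
  free_lift h D = \sum_(x <- dom D) coeff x D *: h x.
Proof.
rewrite -[D in LHS]freeg_sumE raddf_sum; apply: eq_bigr => x _.
by rewrite /= liftU.
Qed.

Lemma flat_free (X : choiceType) : flat ({freeg X / R} : lmodType R).
Proof.
have cl x : linear (coeff x : {freeg X / R} -> R^o).
  by move=> a D D'; rewrite coeffD coeffZ.
pose pr x : {linear {freeg X / R} -> R^o} := mk_linear (cl x).
pose io x : {linear R^o -> {freeg X / R}} :=
  mk_linear (scale_linearl (Freeg [:: (1, x)] : {freeg X / R})).
apply: (@decomposition_flat _ _ _ io pr) => [D|_]; last exact: flat_regular.
exists (dom D) => s' us' ss'.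
rewrite (big_superset (uniq_dom D)) // => [|x xD].
  rewrite -[LHS]freeg_sumE; apply: eq_bigr => x _ /=.
  by apply/eqP/freeg_eqP => y; rewrite coeffZ !coeffU mul1r.
by rewrite /= coeff_outdom // scale0r.
Qed.

Lemma free_cover_surj (B : lmodType R) y : exists x, free_lift (id : B -> B) x = y.
Proof. by exists (Freeg [:: (1, y)]); rewrite free_liftU. Qed.

(** P is a retract of the free module on its underlying set. *)
Lemma flat_projective (P : lmodType R) : projective P -> flat P.
Proof.
move=> hP; have [g gE] := hP _ _ (free_lift (id : P -> P)) (idL P) (@free_cover_surj P).
by apply: (flat_retract gE); exact: flat_free.
Qed.

Lemma dsum_decomposition (I : eqType) (V : I -> lmodType R) :
  exists (io : forall i, {linear V i -> dsum V}) (pr : forall i, {linear dsum V -> V i}),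
  [/\ decomposition io pr, forall i (c : dsum V), pr i c = dsum_val c i,
      forall i v, pr i (io i v) = v & forall i j v, i != j -> pr j (io i v) = 0].
Proof.
pose dl i (v : V i) : dprod V := dfwith (fun k => 0 : V k) v.
have dl1 i (v : V i) : dl i v i = v by exact: dfwith_in.
have dl0 i j (v : V i) : i != j -> dl i v j = 0 by exact: dfwith_out.
have fin i (v : V i) : dl i v \in fin_supp (V := V).
  apply/asboolP; exists [:: i] => j; rewrite inE => ji.
  by rewrite dl0 // eq_sym.
have iol i : linear (fun v : V i => DSum (fin i v) : dsum V).
  move=> a v w; apply: val_inj; apply: functional_extensionality_dep => j /=.
  rewrite [RHS](_ : _ = a *: dl i v j + dl i w j) //.
  have [<-|ij] := eqVneq i j; first by rewrite !dl1.
  by rewrite !dl0 // scaler0 addr0.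
have prl i : linear (fun c : dsum V => dsum_val c i) by [].
exists (fun i => mk_linear (iol i)), (fun i => mk_linear (prl i)).
split=> [c|//|i v|i j v ij]; [|exact: dl1|exact: dl0].
case: (asboolW (valP c)) => s cs; exists s => s' us' ss'.
apply: val_inj; apply: functional_extensionality_dep => j.
rewrite [RHS](raddf_sum (mk_linear (prl j))) /=.
have [js'|js'] := boolP (j \in s').
  rewrite (bigD1_seq j) //= dl1 big1 ?addr0 // => i ij.
  by rewrite dl0.
have -> : dsum_val c j = 0 by apply: cs; apply: contra js' => /ss'.
rewrite big_seq big1 // => i is'.
by rewrite dl0 //; apply: contraNneq js' => <-.
Qed.

(** Turns a binary product into a direct sum over [bool], so that the lemmas on decompositions apply
    to the terms of cones. *)
Definition pair_family (A B : lmodType R) (b : bool) : lmodType R :=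
  match b return lmodType R with true => A | false => B end.

Lemma pair_decomposition (A B : lmodType R) :
  exists (io : forall b, {linear pair_family A B b -> (A * B)%type})
         (pr : forall b, {linear (A * B)%type -> pair_family A B b}),
  decomposition io pr.
Proof.
have l1 : linear (fun a : A => (a, 0) : (A * B)%type).
  by move=> c a a'; congr pair; rewrite /= scaler0 addr0.
have l2 : linear (fun b : B => (0, b) : (A * B)%type).
  by move=> c a a'; congr pair; rewrite /= scaler0 addr0.
exists (fun b => match b as b return {linear pair_family A B b -> (A * B)%type} with
                 | true => mk_linear l1 | false => mk_linear l2 end).
have m1 : linear (fun u : (A * B)%type => u.1) by [].
have m2 : linear (fun u : (A * B)%type => u.2) by [].
exists (fun b => match b as b return {linear (A * B)%type -> pair_family A B b} with
                 | true => mk_linear m1 | false => mk_linear m2 end).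
move=> [a b]; exists [:: true; false] => s us ss.
rewrite (big_superset (s := [:: true; false])) //; last by case.
rewrite big_cons big_seq1 /=; congr pair; by rewrite /= ?addr0 ?add0r.
Qed.

Lemma ffun_flat (T : finType) : flat ({ffun T -> R^o} : lmodType R).
Proof.
have il (x : T) : linear (fun a : R^o => [ffun y => a *+ (x == y)] : {ffun T -> R^o}).
  move=> c a b; apply/ffunP => y; rewrite !ffunE.
  by case: (x == y); rewrite ?mulr1n // !mulr0n scaler0 addr0.
have pl (x : T) : linear (fun f : {ffun T -> R^o} => f x).
  by move=> a f g; rewrite !ffunE.
apply: (@decomposition_flat _ T (fun=> R^o) (fun x => mk_linear (il x))
          (fun x => mk_linear (pl x))) => [f|_]; last exact: flat_regular.
exists (enum T) => s us ss; apply/ffunP => y.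
rewrite [RHS](raddf_sum (mk_linear (pl y))) /=.
have ys : y \in s by apply: ss; rewrite mem_enum.
rewrite (bigD1_seq y) //= ffunE eqxx mulr1n big1 ?addr0 // => x xy.
by rewrite ffunE (negbTE xy).
Qed.

End Flat.

(** * Vanishing of Tor *)

Section ComplexBasics.
Variable R : comNzRingType.
Implicit Types X Y : complex R.

Lemma cycleP X i (x : X i) : cycle x <-> forall k, diff X i k x = 0.
Proof.
split=> [x0 k|]; last exact.
have [ik|ik] := eqVneq i (k + 1); last exact: diff_shape.
by have -> : k = i - 1 by lia.
Qed.

Lemma boundaryI X i k (x : X i) (y : X k) : diff X k i y = x -> boundary x.
Proof.
move=> <-; have [E|ki] := eqVneq k (i + 1); first by subst k; exists y.
by exists 0; rewrite linear0 diff_shape.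
Qed.

(** The degree k comes with a proof of k = i + 1, which allows degrees such as i and i - 1 + 1 to be
    identified without a cast. *)
Lemma exact_lift X i k : exact_at X i -> k = i + 1 ->
  forall x : X i, (forall l, diff X i l x = 0) -> exists y : X k, diff X k i y = x.
Proof. by move=> h -> x x0; apply: h; apply/cycleP. Qed.

Lemma cycle_submodule X i : submodule (@cycle R X i).
Proof. exact: kernel_submodule. Qed.

Lemma boundary_submodule X i : submodule (@boundary R X i).
Proof. exact: image_submodule. Qed.

Lemma boundaryD X i (x y : X i) : boundary x -> boundary y -> boundary (x + y).
Proof. by move=> [a <-] [b <-]; exists (a + b); rewrite linearD. Qed.
Lemma boundary0 X i : boundary (0 : X i).
Proof. by exists 0; rewrite linear0. Qed.
Lemma boundary_cycle X i (x : X i) : boundary x -> cycle x.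
Proof. by move=> [y <-]; rewrite /cycle diff_diff. Qed.

Lemma boundary_sum X i I (s : seq I) (F : I -> X i) :
  (forall j, boundary (F j)) -> boundary (\sum_(j <- s) F j).
Proof.
by move=> h; apply: big_ind => [|x y|j _]; [exact: boundary0|exact: boundaryD|].
Qed.

Lemma flat_mtensor_exact (M : lmodType R) X i :
  flat M -> exact_at X i -> exact_at (mtensor M X) i.
Proof. by move=> hM hX; apply: flat_exact. Qed.

Lemma chain_boundary X Y (f : chain_map X Y) i (x : X i) : boundary x -> boundary (f i x).
Proof. by move=> [y <-]; exists (f _ y); rewrite cmap_diff. Qed.

Lemma chain_cycle X Y (f : chain_map X Y) i (x : X i) : cycle x -> cycle (f i x).
Proof. by rewrite /cycle -cmap_diff => ->; rewrite linear0. Qed.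

Lemma quasi_iso_exact X Y (f : chain_map X Y) : quasi_iso f ->
  forall i, exact_at X i <-> exact_at Y i.
Proof.
move=> hf i; have [inj srj] := hf i; split=> [hX y cy|hY x cx].
  have [x cx bx] := srj y cy; rewrite -[y](subrK (f i x)).
  by apply: boundaryD => //; apply: chain_boundary; apply: hX.
by apply: inj => //; apply: hY; apply: chain_cycle.
Qed.

Lemma derived_iso_exact X Y : derived_iso X Y -> forall i, exact_at X i <-> exact_at Y i.
Proof.
move=> [Z [f [g [hf hg]]]] i.
by rewrite -(quasi_iso_exact hf) -(quasi_iso_exact hg).
Qed.

End ComplexBasics.

Section Syzygy.
Variable R : comNzRingType.
Implicit Types B F L M N : lmodType R.

Definition free_cover B : {linear {freeg B / R} -> B} := free_lift (id : B -> B).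
(** The cover is free on all elements of B, so no choice is involved and [syz] is a function on
    modules that can be iterated. Tor_(j+1)(B, M) is Tor_1 of the j-th iterate with M. *)
Definition syz B : lmodType R := subm (submodule_pred (kernel_submodule (free_cover B))).

Lemma syz_val_linear B : linear (fun x : syz B => subm_val x).
Proof. by []. Qed.
Definition syz_incl B : {linear syz B -> {freeg B / R}} := mk_linear (@syz_val_linear B).

Lemma syz_inclP B x : free_cover B x = 0 <-> exists y, syz_incl B y = x.
Proof.
split=> [x0|[[y Py] <-]]; last exact: (asboolW Py).
have Px : x \in submodule_pred (kernel_submodule (free_cover B)) by apply/asboolP.
by exists (Subm Px).
Qed.

Lemma syz_incl_inj B : injective (syz_incl B).
Proof. by move=> x y /val_inj. Qed.

Lemma free_coverK B x : free_cover B (syz_incl B x) = 0.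
Proof. by apply/syz_inclP; exists x. Qed.

(* Tor_1(B, M) = 0 *)
Definition tor1_vanish B M : Prop := injective (tensor_map (syz_incl B) (idL M)).

(* Tor_j(B, M) = 0 for all j > 0 *)
Definition tor_vanish B M : Prop := forall j, tor1_vanish (iter j syz B) M.

Definition short_exact N L M (i : {linear N -> L}) (p : {linear L -> M}) : Prop :=
  [/\ injective i, forall y, exists x, p x = y & forall x, p x = 0 <-> exists y, i y = x].

(** This is the segment Tor_1(B, M) -> B (x) N -> B (x) L of the long exact sequence, obtained by a
    chase through the tensor products of the free presentation of B with N, L and M. *)
Lemma tor1_vanish_inj B N L M (i : {linear N -> L}) (p : {linear L -> M}) :
  short_exact i p -> tor1_vanish B M -> injective (tensor_map (idL B) i).
Proof.
move=> [ii ps pk] tM; apply: linear_inj => b b0.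
have pi0 x : p (i x) = 0 by apply/pk; exists x.
have [l lE] := tensor_surjl (@free_cover_surj R _) b.
have [|s sE] := tensor_right_exactl (@free_cover_surj R _) (fun x => (syz_inclP x).1)
    (t := tensor_map (idL _) i l).
  by rewrite -tmapC lE.
have s0 : tensor_map (idL _) p s = 0.
  by apply: (inj_eq0 tM); rewrite -tmapC sE tmap0rr.
have [s' s'E] := tensor_right_exact ps (fun x => (pk x).1) s0.
rewrite -lE.
have -> : l = tensor_map (syz_incl B) (idL N) s'.
  apply: (flat_free ii).
  by rewrite tmapC s'E sE.
exact/tmap0ll/free_coverK.
Qed.

(** The same diagram chased the other way: with F flat, Tor_1(B, M) is the kernel of B (x) N -> B
    (x) F. *)
Lemma flat_tor1_vanish B N F M (i : {linear N -> F}) (p : {linear F -> M}) :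
  short_exact i p -> flat F -> injective (tensor_map (idL B) i) -> tor1_vanish B M.
Proof.
move=> [ii ps pk] hF Bi; apply: linear_inj => s s0.
have pi0 x : p (i x) = 0 by apply/pk; exists x.
have [s1 s1E] := tensor_surj ps s.
have [|l lE] := tensor_right_exact ps (fun x => (pk x).1)
    (t := tensor_map (syz_incl B) (idL F) s1).
  by rewrite tmapC s1E.
have l0 : tensor_map (free_cover B) (idL N) l = 0.
  by apply: (inj_eq0 Bi); rewrite tmapC lE tmap0ll //; apply: free_coverK.
have [s2 s2E] := tensor_right_exactl (@free_cover_surj R _)
  (fun x => (syz_inclP x).1) l0.
rewrite -s1E.
have -> : s1 = tensor_map (idL _) i s2.
  apply: ((tensor_inj_swap _ _).1 (hF _ _ _ (@syz_incl_inj B))).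
  by rewrite -tmapC s2E.
exact: tmap0rr.
Qed.

Lemma flat_tor_vanish B F : flat F -> tor_vanish B F.
Proof. by move=> hF j; apply/tensor_inj_swap/hF/syz_incl_inj. Qed.

(** Tor_(j+1)(B, N) lies between Tor_(j+2)(B, M) and Tor_(j+1)(B, L). The former is Tor_1 of the
    next syzygy, which is why vanishing is required for all j together. *)
Lemma tor_vanish_kernel B N L M (i : {linear N -> L}) (p : {linear L -> M}) :
  short_exact i p -> tor_vanish B M -> tor_vanish B L -> tor_vanish B N.
Proof.
move=> se hM hL j; apply: linear_inj => t t0.
apply: (inj_eq0 (tor1_vanish_inj se (hM j.+1))).
by apply: (inj_eq0 (hL j)); rewrite -tmapC t0 linear0.
Qed.

Lemma tor_vanish_pair B M N : tor_vanish B M -> tor_vanish B N ->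
  tor_vanish B (M * N)%type.
Proof.
move=> hM hN j; apply: linear_inj => t t0; have [io [pr dec]] := pair_decomposition M N.
rewrite -[t]tswapK; set u := tswap _ _ t.
suff -> : u = 0 by rewrite linear0.
apply: (decomposition_tensor_eq0 dec) => b.
have -> : tensor_map (pr b) (idL _) u = tswap _ _ (tensor_map (idL _) (pr b) t).
  by rewrite tswap_map.
suff -> : tensor_map (idL _) (pr b) t = 0 by rewrite linear0.
have hb : tor_vanish B (pair_family M N b) by case: b.
by apply: (inj_eq0 (hb j)); rewrite -tmapC t0 linear0.
Qed.

Lemma tor_vanish_zero B M : zero_module M -> tor_vanish B M.
Proof.
move=> M0 j; apply: linear_inj => t _.
by rewrite -[t](@tmap_id _ _ _ idfun \0) ?tmap0r // => x; rewrite [x]M0.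
Qed.

(* Dimension shifting along the left half of the complex of flat modules. *)
Lemma totally_acyclic_tor_vanish B (F : complex R) :
  (forall i, flat (F i)) -> acyclic F -> acyclic (mtensor B F) ->
  forall i M (p : {linear F i -> M}), (forall y, exists x, p x = y) ->
  (forall x, p x = 0 <-> boundary x) -> tor_vanish B M.
Proof.
move=> hF aF aBF i M p ps pk j; elim: j i M p ps pk => [|j IHj] i M p ps pk.
  (* N consists of the boundaries in F_i. Exactness of B (x) F in degree i + 1 is what makes B (x) N
     -> B (x) F_i injective. *)
  have [N [u [ui uP]]] := submodule_carrier (@boundary_submodule R F i).
  have se : short_exact u p by split=> // x; rewrite pk; exact: uP.
  apply: (flat_tor1_vanish se (hF i)); apply: linear_inj => t t0.
  have [q qE] : exists q : {linear F (i + 1) -> N}, forall x, u (q x) = diff F (i + 1) i x.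
    by apply: factor_inj => // x; apply/uP; exists x.
  have qs y : exists x, q x = y.
    have [x xE] : boundary (u y) by apply/uP; exists y.
    by exists x; apply: ui; rewrite qE.
  have [t1 t1E] := tensor_surj qs t.
  have [|w wE] := @exact_lift _ (mtensor B F) (i + 1) (i + 1 + 1) (aBF _) erefl t1.
    apply/cycleP; rewrite /cycle /= addrK.
    rewrite -[LHS]/(tensor_map (idL B) (diff F (i + 1) i) t1).
    rewrite -(@tmap_comp _ _ _ _ _ _ _ (idL B) q (idL B) u) //.
    by rewrite t1E.
  rewrite -t1E -wE.
  rewrite -[diff _ _ _ w]/(tensor_map (idL B) (diff F (i + 1 + 1) (i + 1)) w).
  by apply: tmap0rr => x; apply: ui; rewrite qE diff_diff linear0.
(* Tor_(j+2)(B, M) is Tor_(j+1)(B, N), and N is again a cokernel of a differential of F, one degree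
   higher. *)
have [N [u [ui uP]]] := submodule_carrier (@boundary_submodule R F i).
have se : short_exact u p by split=> // x; rewrite pk; exact: uP.
have [q qE] : exists q : {linear F (i + 1) -> N}, forall x, u (q x) = diff F (i + 1) i x.
  by apply: factor_inj => // x; apply/uP; exists x.
have hN : tor1_vanish (iter j syz B) N.
  apply: (IHj (i + 1) N q) => [y|x].
    have [x xE] : boundary (u y) by apply/uP; exists y.
    by exists x; apply: ui; rewrite qE.
  split=> [q0|/boundary_cycle/cycleP x0].
    apply: aF; rewrite /cycle addrK -qE q0 linear0 //.
  by apply: ui; rewrite qE x0 linear0.
apply: (flat_tor1_vanish se (hF i)); apply: linear_inj => t t0.
apply: (inj_eq0 hN).
have fi := @flat_free R (iter j syz B) _ _ _ ui.
by apply: (inj_eq0 fi); rewrite tmapC t0 linear0.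
Qed.

Lemma Gflat_tor_vanish B M : injective_module B -> Gflat M -> tor_vanish B M.
Proof.
move=> hB [F [hF aF aIF [p ps pk]]].
exact: (totally_acyclic_tor_vanish hF aF (aIF B hB) ps pk).
Qed.

(** Induction upwards from the lower bound of X along the sequences 0 -> Z_i -> X_i -> Z_(i-1) -> 0,
    which are exact because X is. *)
Lemma tor_vanish_cycles B (X : complex R) : bounded_below X -> acyclic X ->
  (forall i, tor_vanish B (X i)) ->
  forall i (Z : lmodType R) (u : {linear Z -> X i}), injective u ->
  (forall x, cycle x <-> exists y, u y = x) -> tor_vanish B Z.
Proof.
move=> [n0 X0] aX hX i; have [k ik] : exists k : nat, i < n0 + k%:Z.
  by exists (`|i - n0| + 1)%N; lia.
elim: k i ik => [|k IHk] i ik Z u ui uP.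
  apply: tor_vanish_zero => z; apply: (inj_eq0 ui); apply: X0; lia.
have [Z' [u' [u'i u'P]]] := submodule_carrier (@cycle_submodule R X (i - 1)).
have [q qE] : exists q : {linear X i -> Z'}, forall x, u' (q x) = diff X i (i - 1) x.
  by apply: factor_inj => // x; apply/u'P; exact: diff_diff.
have se : short_exact u q.
  split=> // [y|x].
    have /cycleP y0 : cycle (u' y) by apply/u'P; exists y.
    have [|x xE] := exact_lift (k := i) (aX (i - 1)) _ y0; first lia.
    by exists x; apply: u'i; rewrite qE.
  rewrite -uP /cycle -qE; split=> [->|/(inj_eq0 u'i) //]; exact: linear0.
apply: (tor_vanish_kernel se) => //; apply: (IHk (i - 1) _ _ u') => //; lia.
Qed.

(** The inclusion of the cycles Z_(i-1) in X_(i-1) stays injective after tensoring with B, because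
    its cokernel is isomorphic to Z_(i-2), whose Tor_1 against B vanishes. A cycle of B (x) X then
    comes from B (x) Z_i, onto which B (x) X_(i+1) maps surjectively. *)
Lemma tor_vanish_acyclic B (X : complex R) : bounded_below X -> acyclic X ->
  (forall i, tor_vanish B (X i)) -> acyclic (mtensor B X).
Proof.
move=> bX aX hX i t t0.
have [Z [u [ui uP]]] := submodule_carrier (@cycle_submodule R X i).
have [Z' [u' [u'i u'P]]] := submodule_carrier (@cycle_submodule R X (i - 1)).
have [q qE] : exists q : {linear X i -> Z'}, forall x, u' (q x) = diff X i (i - 1) x.
  by apply: factor_inj => // x; apply/u'P; exact: diff_diff.
have [r rE] : exists r : {linear X (i + 1) -> Z}, forall x, u (r x) = diff X (i + 1) i x.
  by apply: factor_inj => // x; apply/uP; rewrite /cycle diff_diff.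
have [Z2 [q2 [q2s q2P]]] := quotient_carrier (@cycle_submodule R X (i - 1)).
have se' : short_exact u' q2 by split=> // x; rewrite q2P; exact: u'P.
have u'B : injective (tensor_map (idL B) u').
  have [j jE] : exists j : {linear Z2 -> X (i - 1 - 1)},
      forall x, j (q2 x) = diff X (i - 1) (i - 1 - 1) x.
    by apply: factor_surj => // x /q2P.
  have ji : injective j.
    by apply: linear_inj => y; have [x <-] := q2s y; rewrite jE => /q2P.
  suff tv : tor_vanish B Z2 by exact: (tor1_vanish_inj se' (tv 0%N)).
  apply: (tor_vanish_cycles bX aX hX ji).
  move=> x; split=> [/cycleP x0|[y <-]].
    have [|y yE] := exact_lift (k := i - 1) (aX (i - 1 - 1)) _ x0; first lia.
    by exists (q2 y); rewrite jE.
  by have [z <-] := q2s y; rewrite jE /cycle diff_diff.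
have q0 : tensor_map (idL B) q t = 0.
  apply: (inj_eq0 u'B).
  by rewrite (@tmap_comp _ _ _ _ _ _ _ _ _ _ _ (idL B) (diff X i (i - 1))).
have qs y : exists x, q x = y.
  have /cycleP y0 : cycle (u' y) by apply/u'P; exists y.
  have [|x xE] := exact_lift (k := i) (aX (i - 1)) _ y0; first lia.
  by exists x; apply: u'i; rewrite qE.
have [|v vE] := tensor_right_exact (i := u) qs _ q0.
  by move=> x; rewrite -uP /cycle -qE => ->; rewrite linear0.
have rs y : exists x, r x = y.
  have [x xE] : boundary (u y) by apply: aX; apply/uP; exists y.
  by exists x; apply: ui; rewrite rE.
have [w wE] := tensor_surj rs v.
exists w; rewrite -vE -wE.
by rewrite (@tmap_comp _ _ _ _ _ _ _ _ _ _ _ (idL B) (diff X (i + 1) i)).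
Qed.

End Syzygy.

(** * Cones and projective resolutions *)

Section Transport.
Variable R : comNzRingType.

Section Tr.
Variable V : int -> lmodType R.

Lemma tr_spec : {t : forall i j, {linear V i -> V j} |
  (forall i x, t i i x = x) /\ (forall i j x, i != j -> t i j x = 0)}.
Proof.
pose t i j (x : V i) : V j := dfwith (fun k => 0 : V k) x j.
have tl i j : linear (@t i j).
  move=> a x y; rewrite /t; have [E|ij] := eqVneq i j.
    by subst j; rewrite !dfwith_in.
  by rewrite !dfwith_out // scaler0 addr0.
exists (fun i j => mk_linear (@tl i j)); split=> [i x|i j x ij].
  exact: dfwith_in.
exact: dfwith_out.
Qed.

(* Transports elements along provable equalities i = j, avoiding casts. *)
Definition tr i j : {linear V i -> V j} := sval tr_spec i j.

Lemma tr_id i x : tr i i x = x.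
Proof. exact: (svalP tr_spec).1. Qed.

Lemma tr_ne i j x : i != j -> tr i j x = 0.
Proof. exact: (svalP tr_spec).2. Qed.

Lemma tr_tr i j k x : i = j -> tr j k (tr i j x) = tr i k x.
Proof. by move=> E; subst j; rewrite tr_id. Qed.

Lemma trK i j x : i = j -> tr j i (tr i j x) = x.
Proof. by move=> E; rewrite tr_tr // tr_id. Qed.
End Tr.

Lemma diff_tr (X : complex R) i j k (x : X i) :
  i = j -> diff X j k (tr X i j x) = diff X i k x.
Proof. by move=> E; subst j; rewrite tr_id. Qed.

(** Valid for all indices: both sides vanish unless j = i - 1 and k = j - 1. This spares case
    distinctions in the computations with cones. *)
Lemma tr_diff (X : complex R) i j k (x : X (i - 1)) :
  tr X (j - 1) k (diff X (i - 1) (j - 1) x) = diff X j k (tr X (i - 1) j x).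
Proof.
have [E|ne] := eqVneq (i - 1) j.
  subst j; rewrite tr_id; have [E|ne] := eqVneq (i - 1 - 1) k.
    by subst k; rewrite tr_id.
  by rewrite tr_ne // diff_shape //; apply: contra ne; lia.
rewrite (tr_ne _ ne) linear0 diff_shape ?linear0 //.
by apply: contra ne; lia.
Qed.

End Transport.
Section Cone.
Variable R : comNzRingType.
Variables (X Y : complex R) (f : chain_map X Y).

Definition cone_obj (i : int) : lmodType R := (X (i - 1)%R * Y i)%type.

(** The transport [tr] vanishes unless j = i - 1, so f contributes in the right degree only. *)
Lemma cone_diff_linear (i j : int) : linear (fun u : cone_obj i =>
  (- diff X (i - 1) (j - 1) u.1, f j (tr X (i - 1) j u.1) + diff Y i j u.2) : cone_obj j).
Proof.
move=> a u v; have E1 : (a *: u + v).1 = a *: u.1 + v.1 by [].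
have E2 : (a *: u + v).2 = a *: u.2 + v.2 by [].
rewrite E1 E2 !linearP; congr pair.
by rewrite [RHS](_ : _ = a *: (f j (tr X (i - 1) j u.1) + diff Y i j u.2) +
  (f j (tr X (i - 1) j v.1) + diff Y i j v.2)) // scalerDr addrACA.
Qed.

Definition cone_diff (i j : int) : {linear cone_obj i -> cone_obj j} :=
  mk_linear (@cone_diff_linear i j).

Lemma cone_shape (i j : int) : i != j + 1 -> forall u, cone_diff i j u = 0.
Proof.
move=> ij u; congr pair; rewrite /= ?tr_ne ?diff_shape ?linear0 ?oppr0 ?addr0 //.
all: lia.
Qed.

Lemma cone_diff_diff i j k u : cone_diff j k (cone_diff i j u) = 0.
Proof.
congr pair; rewrite /=.
  by rewrite [diff _ _ _ (- _)]linearN opprK diff_diff.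
rewrite [tr _ _ _ (- _)]linearN [f _ (- _)]linearN linearD diff_diff addr0.
by rewrite tr_diff cmap_diff addNr.
Qed.

Definition cone : complex R := Complex cone_shape cone_diff_diff.

(** Allows the X-component to live in any degree j with a proof of i = j + 1, instead of literally
    in degree i - 1. *)
Definition cpair i j (x : X j) (y : Y i) : cone i := (tr X j (i - 1) x, y).

Lemma cpair_ex i j (u : cone i) : i = j + 1 -> exists x y, u = cpair (j := j) x y.
Proof.
move=> ij; exists (tr X (i - 1) j u.1), u.2; rewrite /cpair trK; last lia.
by case: u.
Qed.

Lemma cpair_diff i j k (x : X j) (y : Y i) : i = j + 1 -> j = k + 1 ->
  diff cone i j (cpair x y) = cpair (- diff X j k x) (f j x + diff Y i j y).
Proof.
move=> ij jk; have E : k = j - 1 by lia.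
subst k; rewrite /cpair tr_id; congr pair; rewrite /= ?diff_tr //; try lia.
by rewrite trK //; lia.
Qed.

Lemma cpair_inj i j (x x' : X j) (y y' : Y i) : i = j + 1 ->
  cpair x y = cpair x' y' -> x = x' /\ y = y'.
Proof.
move=> ij [xx yy]; split=> //; rewrite -[x](@trK _ X j (i - 1)); last lia.
by rewrite xx trK //; lia.
Qed.

Lemma cpair0 i j : cpair (0 : X j) (0 : Y i) = 0.
Proof. by congr pair; rewrite linear0. Qed.

Lemma cone_in_linear i : linear (fun y : Y i => (0, y) : cone i).
Proof. by move=> a y y'; congr pair; rewrite /= scaler0 addr0. Qed.

Lemma cone_in_diff i j (y : Y i) :
  mk_linear (@cone_in_linear j) (diff Y i j y) =
  diff cone i j (mk_linear (@cone_in_linear i) y).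
Proof. by congr pair; rewrite /= ?linear0 ?oppr0 ?add0r. Qed.

Definition cone_in : chain_map Y cone := ChainMap cone_in_diff.

(** A cycle (x, y) satisfies f x = - d y, so injectivity on homology gives x = d x'. Then y + f x'
    is a cycle, which surjectivity writes as f x2 + d y2 with x2 a cycle, and (x2 - x', y2) bounds
    (x, y). *)
Lemma cone_acyclic : quasi_iso f -> acyclic cone.
Proof.
move=> hf i u u0; have ij : i = (i - 1) + 1 by lia.
have [x [y uE]] := cpair_ex u ij.
have jk : i - 1 = i - 1 - 1 + 1 by lia.
move: u0; rewrite /cycle uE (cpair_diff _ _ ij jk).
rewrite -(cpair0 _ (i - 1 - 1)) => /cpair_inj[]; first lia.
move=> /eqP; rewrite oppr_eq0 => /eqP x0 xy.
have [inj _] := hf (i - 1).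
have [x' x'E] : exists x' : X i, diff X i (i - 1) x' = x.
  have bx : boundary x.
    apply: inj => //; apply: (boundaryI (y := - y)).
    by rewrite linearN; apply/eqP; rewrite eq_sym -subr_eq0 opprK; apply/eqP.
  case: bx => x' <-; exists (tr X _ i x'); rewrite diff_tr //; lia.
have [|x2 x2c [y2 y2E]] := (hf i).2 (y + f i x').
  by rewrite /cycle linearD -cmap_diff x'E [LHS]addrC.
exists (cpair (j := i) (x2 - x') y2); rewrite (cpair_diff _ _ _ ij) // -x'E y2E.
congr cpair; first by rewrite linearB x2c sub0r opprK.
by rewrite linearB [LHS]addrC [LHS]addrA subrK addrK.
Qed.

End Cone.

(** * Null-homotopies and lifts along quasi-isomorphisms *)

Section Homotopy.
Variable R : comNzRingType.

Definition homotopy_upto (P A : complex R) (g : chain_map P A) (n : int)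
    (h : forall i j, {linear P i -> A j}) : Prop :=
  forall i j l x, i < n -> j = i + 1 -> l = i - 1 ->
    g i x = diff A j i (h i j x) + h l i (diff P i l x).

(** By the relation one degree below, g - h d takes values in the cycles of A; exactness makes them
    boundaries, and projectivity of P_n lifts the map. *)
Lemma homotopy_step (P A : complex R) (g : chain_map P A) n h :
  (forall i, projective (P i)) -> acyclic A -> homotopy_upto g n h ->
  exists2 h', homotopy_upto g (n + 1) h' & forall i j, i < n -> h' i j = h i j.
Proof.
move=> hP hA hh.
have ul : linear (fun x => g n x - h (n - 1) n (diff P n (n - 1) x)).
  by move=> a x y; rewrite !linearP [LHS]addrACA -scalerDr.
have [|t tE] := projective_lift (p := diff A (n + 1) n) (g := mk_linear ul) (hP n).
  move=> x; apply: hA => /=; rewrite /cycle linearB -cmap_diff.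
  have -> : g (n - 1) (diff P n (n - 1) x) = diff A n (n - 1) (h (n - 1) n
    (diff P n (n - 1) x)) + h (n - 1 - 1) (n - 1) (diff P (n - 1) (n - 1 - 1)
    (diff P n (n - 1) x)) by apply: hh; lia.
  by rewrite diff_diff linear0 addr0 subrr.
exists (fun i j => if i < n then h i j else tr A (n + 1) j \o t \o tr P i n);
  last by move=> i j ->.
move=> i j l x i_n ji li; have li_n : l < n by lia.
rewrite li_n; case: ifP => [lt_in|ge_in]; first exact: hh.
have E : i = n by lia.
by subst i j l; rewrite /= !tr_id tE /= subrK.
Qed.

Lemma null_homotopy (P A : complex R) (g : chain_map P A) :
  (forall i, projective (P i)) -> bounded_below P -> acyclic A ->
  exists h : forall i j, {linear P i -> A j}, forall i j l x, j = i + 1 -> l = i - 1 ->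
    g i x = diff A j i (h i j x) + h l i (diff P i l x).
Proof.
move=> hP [n0 P0] hA.
pose S k := {h : forall i j, {linear P i -> A j} | homotopy_upto g (n0 + k%:Z) h}.
have h0 : homotopy_upto g (n0 + 0%N%:Z) (fun i j => \0).
  move=> i j l x i0 _ _; have -> : x = 0 by apply: P0; lia.
  by rewrite !linear0 addr0.
have step k (h : S k) : {h' : S k.+1 | forall i j, i < n0 + k%:Z -> sval h' i j = sval h i j}.
  have [h1 h1P h1E] := cid2 (homotopy_step hP hA (svalP h)).
  have h1P' : homotopy_upto g (n0 + k.+1%:Z) h1.
    by have -> : n0 + k.+1%:Z = n0 + k%:Z + 1 by lia.
  by exists (exist _ h1 h1P').
pose H := fix H k : S k :=
  match k with 0%N => exist _ _ h0 | k.+1 => sval (step k (H k)) end.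
have HE k d i j : i < n0 + k%:Z -> sval (H (k + d)%N) i j = sval (H k) i j.
  elim: d => [|d IHd] ik; first by rewrite addn0.
  by rewrite addnS /= (svalP (step _ _)) ?IHd //; lia.
(* Stage m i covers degree i, and later stages no longer change that component; the limit homotopy
   reads each degree from its own stage. *)
pose m (i : int) := (`|i - n0| + 1)%N.
exists (fun i j => sval (H (m i)) i j) => i j l x ji li.
have -> : sval (H (m l)) l i = sval (H (m i)) l i.
  rewrite -(@HE (m l) (m i)); last by rewrite /m; lia.
  have [le|lt] := boolP (l < n0 + (m i)%:Z); first by rewrite addnC HE.
  by exfalso; move: lt; rewrite /m; lia.
by apply: (svalP (H (m i))) => //; rewrite /m; lia.
Qed.

Lemma chain_comp_diff (X Y Z : complex R) (f : chain_map X Y) (g : chain_map Y Z) i j x :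
  (g j \o f j) (diff X i j x) = diff Z i j ((g i \o f i) x).
Proof. by rewrite /= !cmap_diff. Qed.

Definition chain_comp (X Y Z : complex R) (f : chain_map X Y) (g : chain_map Y Z) :
  chain_map X Z := @ChainMap R X Z (fun i => g i \o f i) (chain_comp_diff f g).

Lemma quasi_iso_comp (X Y Z : complex R) (f : chain_map X Y) (g : chain_map Y Z) :
  quasi_iso f -> quasi_iso g -> quasi_iso (chain_comp f g).
Proof.
move=> hf hg i; have [fi fs] := hf i; have [gi gs] := hg i; split.
  by move=> x cx /gi bx; apply: fi => //; apply: bx; apply: chain_cycle.
move=> z cz; have [y cy yz] := gs z cz; have [x cx xy] := fs y cy.
exists x => //=; rewrite -(subrK (g i y) z) -addrA -linearB.
by apply: boundaryD => //; apply: chain_boundary.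
Qed.

(** The composite P -> Y -> cone f is null-homotopic because the cone is acyclic. The X-component of
    the homotopy is a chain map h, and its Y-component is a homotopy between g and f h. *)
Lemma quasi_iso_lift (P X Y : complex R) (f : chain_map X Y) (g : chain_map P Y) :
  (forall i, projective (P i)) -> bounded_below P -> quasi_iso f -> quasi_iso g ->
  exists h : chain_map P X, quasi_iso h.
Proof.
move=> hP bP hf hg.
have [s sE] := null_homotopy (chain_comp g (cone_in f)) hP bP (cone_acyclic hf).
have hl i : linear (fun x : P i => tr X (i + 1 - 1) i (s i (i + 1) x).1).
  by move=> a x y; rewrite linearP linearP.
have hd i j x : mk_linear (@hl j) (diff P i j x) = diff X i j (mk_linear (@hl i) x).
  have [E|ij] := eqVneq i (j + 1); last by rewrite !diff_shape // linear0.
  subst i; rewrite /= -tr_diff; congr (tr X _ _ _).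
  have ji : j = j + 1 - 1 by lia.
  have /(congr1 fst) E := sE (j + 1) (j + 1 + 1) j x erefl ji.
  by apply/eqP; rewrite -subr_eq0 [X in X == _]addrC; apply/eqP/esym.
pose h : chain_map P X := ChainMap hd.
have gE i x : cycle x -> exists y, g i x = f i (h i x) + diff Y (i + 1) i y.
  move=> cx; exists (s i (i + 1) x).2.
  have := sE i (i + 1) (i - 1) x erefl erefl.
  by rewrite cx linear0 addr0 => /(congr1 snd).
exists h => i; split=> [x cx bx|z cz].
  apply: (hg i).1 => //; have [y ->] := gE i x cx.
  by apply: boundaryD; [exact: chain_boundary|exists y].
have [x cx bx] := (hg i).2 _ (chain_cycle f cz).
exists x => //; apply: (hf i).1.
  by rewrite /cycle linearB cz (chain_cycle h cx) subrr.
have [y E] := gE i x cx; rewrite linearB.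
have -> : f i z - f i (h i x) = (f i z - g i x) + diff Y (i + 1) i y.
  by rewrite E opprD addrA subrK.
by apply: boundaryD => //; exists y.
Qed.

Lemma resolution_quasi_iso (W P G : complex R) (p : chain_map P W) :
  projective_resolution p -> derived_iso G W -> exists phi : chain_map P G, quasi_iso phi.
Proof.
move=> [hP bP hp] [Z [f [g [hf hg]]]].
have [h hh] := quasi_iso_lift hP bP hg hp.
by exists (chain_comp h f); apply: quasi_iso_comp.
Qed.

End Homotopy.

(** * Tensor products of complexes *)

Section TotalTensor.
Variable R : comNzRingType.
Implicit Types A B X Y : complex R.

Lemma comp_bounded A B n (c : ctensor_obj A B n) :
  exists N : nat, forall p q, (N <= `|p|)%N -> comp c p q = 0.
Proof.
case: (asboolW (valP c)) => s cs.
exists (\max_(u <- s) `|(val u).1|%N).+1 => p q lt_p.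
rewrite /comp; case: decP => // pqn; apply: (cs (exist _ (p, q) pqn)); apply/negP => us.
have := @leq_bigmax_seq _ s xpredT (fun u => `|(val u).1|%N) _ us erefl.
by rewrite leqNgt lt_p.
Qed.

(** On the line p + q = n a bound on the absolute value of p leaves finitely many components, so
    boundedness in p stands in for finite support. *)
Lemma ctensor_mk A B n (f : forall p q, tensor (A p) (B q)) :
  (exists N : nat, forall p q, (N <= `|p|)%N -> f p q = 0) ->
  {c : ctensor_obj A B n | forall p q, p + q = n -> comp c p q = f p q}.
Proof.
move=> hN; pose g : dprod (fun u : bidegree n => tensor (A (val u).1) (B (val u).2)) :=
  fun u => f (val u).1 (val u).2.
have gfin : g \in @fin_supp R _ _.
  case: hN => N fN.
  pose l := [seq (k%:Z, n - k%:Z) | k <- iota 0 N] ++ [seq (- k%:Z, n + k%:Z) | k <- iota 0 N].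
  apply/asboolP; exists (pmap insub l) => -[[p q] pqn] ul.
  have {ul} pql : (p, q) \notin l by apply: contra ul => pql; rewrite mem_pmap_sub.
  apply: fN => /=; rewrite leqNgt; apply: contra pql => pN.
  have /= pq : p + q = n by apply/eqP.
  rewrite mem_cat; apply/orP; case: (leP 0 p) => p0; [left|right];
    apply/mapP; exists `|p|%N; rewrite ?mem_iota //; congr pair; lia.
exists (DSum gfin) => p q pqn; rewrite /comp; case: decP => [//|].
by case; apply/eqP.
Qed.

Definition comp_lin A B n p q : {linear ctensor_obj A B n -> tensor (A p) (B q)} :=
  mk_linear (comp_linear p q).

Lemma ctensor_lin A B A' B' n n'
    (f : forall p q, {linear ctensor_obj A B n -> tensor (A' p) (B' q)}) :
  (forall c, exists N : nat, forall p q, (N <= `|p|)%N -> f p q c = 0) ->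
  {F : {linear ctensor_obj A B n -> ctensor_obj A' B' n'} |
    forall c p q, p + q = n' -> comp (F c) p q = f p q c}.
Proof.
move=> fN; pose F c := sval (ctensor_mk n' (fN c)).
have FE c p q : p + q = n' -> comp (F c) p q = f p q c.
  exact: (svalP (ctensor_mk n' (fN c))).
have FL : linear F.
  move=> a c c'; apply: ctensor_ext => p q pq.
  by rewrite comp_linear !FE // linearP.
by exists (mk_linear FL).
Qed.

Lemma ctensor_diffE A B i j (c : ctensor A B i) p q : p + q = j ->
  comp (diff (ctensor A B) i j c) p q =
    tensor_map (diff A (p + 1) p) (idL (B q)) (comp c (p + 1) q)
    + (-1) ^+ `|p|%N *: tensor_map (idL (A p)) (diff B (q + 1) q) (comp c p (q + 1)).
Proof. by move=> pq; rewrite [LHS]comp_diff pq eqxx. Qed.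

Lemma comp_shift A B n (c : ctensor_obj A B n) p q q' (T : lmodType R)
    (h : forall q, {linear B q -> T}) : q = q' ->
  tensor_map (idL (A p)) (h q) (comp c p q) = tensor_map (idL (A p)) (h q') (comp c p q').
Proof. by move=> ->. Qed.

Lemma signr_sqr (T : lmodType R) (k : nat) (t : T) : (-1) ^+ k *: ((-1) ^+ k *: t) = t.
Proof. by rewrite scalerA -exprD addnn -mul2n exprM sqrrN expr1n expr1n scale1r. Qed.

Lemma zero_tensor (M N : lmodType R) : zero_module M -> zero_module (tensor M N).
Proof.
by move=> M0 t; rewrite -[t](@tmap_id _ _ _ \0 (idL N)) ?tmap0l.
Qed.

Lemma chain_bij_exact X Y (f : chain_map X Y) i : (forall j, injective (f j)) ->
  (forall j y, exists x, f j x = y) -> exact_at X i <-> exact_at Y i.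
Proof.
move=> fi fs; split=> [hX y cy|hY x cx].
  have [x xE] := fs i y.
  have [|z zE] := hX x; last by exists (f _ z); rewrite -cmap_diff zE.
  by apply: fi; rewrite cmap_diff xE linear0.
have [y yE] := hY _ (chain_cycle f cx); have [z zE] := fs _ y.
by exists z; apply: fi; rewrite cmap_diff zE.
Qed.

Lemma tmap_oppr (M N N' : lmodType R) (f g : {linear N -> N'}) (t : tensor M N) :
  (forall x, f x = - g x) -> tensor_map (idL M) f t = - tensor_map (idL M) g t.
Proof.
move=> fg; elim/tens_ind: t => [x y|t u Ht Hu]; last by rewrite !linearD Ht Hu.
rewrite !tensor_mapE fg.
exact: (linearN (mk_linear (tens_linearr x))).
Qed.

Lemma tmap_addr (M N N' : lmodType R) (f g h : {linear N -> N'}) (t : tensor M N) :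
  (forall x, f x = g x + h x) ->
  tensor_map (idL M) f t = tensor_map (idL M) g t + tensor_map (idL M) h t.
Proof.
move=> fg; elim/tens_ind: t => [x y|t u Ht Hu]; last by rewrite !linearD Ht Hu addrACA.
rewrite !tensor_mapE fg.
exact: (linearD (mk_linear (tens_linearr x))).
Qed.

Lemma comp_tr A X i j (x : ctensor A X i) p q : i = j ->
  comp (tr (ctensor A X) i j x : ctensor_obj A X j) p q = comp (x : ctensor_obj A X i) p q.
Proof. by move=> ij; subst j; rewrite tr_id. Qed.

Section Map.
Variables (A X Y : complex R) (f : chain_map X Y).

Lemma ctensor_map_spec i : {F : {linear ctensor_obj A X i -> ctensor_obj A Y i} |
  forall c p q, comp (F c) p q = tensor_map (idL (A p)) (f q) (comp c p q)}.
Proof.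
have [c|F FE] := @ctensor_lin A X A Y i i
  (fun p q => tensor_map (idL (A p)) (f q) \o comp_lin A X i p q).
  have [N cN] := comp_bounded c; exists N => p q pN.
  by rewrite -[LHS]/(tensor_map (idL (A p)) (f q) (comp c p q)) cN // linear0.
exists F => c p q; have [pq|pq] := eqVneq (p + q) i; first exact: FE.
by rewrite !comp_out // linear0.
Qed.

Lemma ctensor_map_diff i j x :
  sval (ctensor_map_spec j) (diff (ctensor A X) i j x) =
  diff (ctensor A Y) i j (sval (ctensor_map_spec i) x).
Proof.
apply: ctensor_ext => p q pq; rewrite (svalP (ctensor_map_spec j)) !ctensor_diffE //.
rewrite !(svalP (ctensor_map_spec i)) linearD [tensor_map _ _ (_ *: _)]linearZ_LR tmapC.
congr (_ + _ *: _).
by rewrite !(@tmap_comp _ _ _ _ _ _ _ _ _ _ _ (idL (A p)) (diff Y (q + 1) q \o f (q + 1))) // => y /=;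
  rewrite cmap_diff.
Qed.

Definition ctensor_map : chain_map (ctensor A X) (ctensor A Y) :=
  @ChainMap R (ctensor A X) (ctensor A Y) (fun i => sval (ctensor_map_spec i))
    ctensor_map_diff.

Lemma comp_map i (c : ctensor A X i) p q :
  comp (ctensor_map i c) p q = tensor_map (idL (A p)) (f q) (comp c p q).
Proof. exact: (svalP (ctensor_map_spec i)). Qed.
End Map.

(** * Symmetry of the tensor product of complexes *)

Section Swap.
Variables (A B : complex R).

(** The sign (-1)^(pq), which makes the exchange of the factors commute with the differentials. *)
Definition swap_sign (p q : int) : R := ((-1) ^+ `|p|%N) ^+ `|q|%N.

Lemma swap_signC p q : swap_sign p q = swap_sign q p.
Proof. by rewrite /swap_sign -!exprM mulnC. Qed.

Lemma swap_signS p q : swap_sign (p + 1) q = (-1) ^+ `|q|%N * swap_sign p q.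
Proof. by rewrite /swap_sign signr_absz_add1 exprNn. Qed.

Lemma swap_sign_sqr p q : swap_sign p q * swap_sign p q = 1.
Proof.
by rewrite /swap_sign -exprM -exprD addnn -mul2n exprM sqrrN expr1n expr1n.
Qed.

Lemma ctensor_swap_spec i : {F : {linear ctensor_obj A B i -> ctensor_obj B A i} |
  forall c p q, comp (F c) p q = swap_sign p q *: tswap _ _ (comp c q p)}.
Proof.
pose L p q : {linear ctensor_obj A B i -> tensor (B p) (A q)} :=
  swap_sign p q \*: (tswap _ _ \o comp_lin A B i q p).
have LE p q c : L p q c = swap_sign p q *: tswap _ _ (comp c q p) by [].
have [c|F FE] := @ctensor_lin A B B A i i L.
  have [N cN] := comp_bounded c; exists (N + `|i|)%N => p q pN.
  rewrite LE; have [pq|pq] := eqVneq (q + p) i; last by rewrite comp_out // linear0 scaler0.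
  by rewrite cN ?linear0 ?scaler0 //; lia.
exists F => c p q; have [pq|pq] := eqVneq (p + q) i; first by rewrite FE.
by rewrite !comp_out ?linear0 ?scaler0 // addrC.
Qed.

Lemma ctensor_swap_diff i j x :
  sval (ctensor_swap_spec j) (diff (ctensor A B) i j x) =
  diff (ctensor B A) i j (sval (ctensor_swap_spec i) x).
Proof.
apply: ctensor_ext => p q pq; rewrite (svalP (ctensor_swap_spec j)).
rewrite !ctensor_diffE //; last by rewrite addrC.
rewrite !(svalP (ctensor_swap_spec i)) linearD [tswap _ _ (_ *: _)]linearZ_LR.
rewrite ![tensor_map _ _ (_ *: _)]linearZ_LR !tswap_map scalerDr [LHS]addrC.
rewrite swap_signS !scalerA [_ * (-1) ^+ _]mulrC; congr (_ + _ *: _).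
rewrite [swap_sign p (q + 1)]swap_signC swap_signS mulrA -exprD addnn -mul2n exprM.
by rewrite sqrrN !expr1n mul1r swap_signC.
Qed.

Lemma ctensor_swap_inj i : injective (sval (ctensor_swap_spec i)).
Proof.
apply: linear_inj => c c0; apply: ctensor_ext => p q pq.
have := svalP (ctensor_swap_spec i) c q p; rewrite c0.
move=> /(congr1 (fun t => tswap _ _ (swap_sign q p *: t))).
rewrite scalerA swap_sign_sqr scale1r tswapK => <-.
have -> : comp (0 : ctensor_obj B A i) q p = 0 by exact: (linear0 (comp_lin B A i q p)).
by rewrite scaler0 linear0; apply/esym; exact: (linear0 (comp_lin A B i p q)).
Qed.
End Swap.

Lemma ctensor_swapK A B i c :
  sval (ctensor_swap_spec A B i) (sval (ctensor_swap_spec B A i) c) = c.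
Proof.
apply: ctensor_ext => p q pq; rewrite !(svalP (ctensor_swap_spec _ _ _)).
by rewrite [tswap _ _ (_ *: _)]linearZ_LR tswapK scalerA swap_signC swap_sign_sqr scale1r.
Qed.

Lemma ctensor_swap_exact A B i : exact_at (ctensor A B) i <-> exact_at (ctensor B A) i.
Proof.
apply: (@chain_bij_exact _ _ (@ChainMap R (ctensor A B) (ctensor B A)
  (fun i => sval (ctensor_swap_spec A B i)) (@ctensor_swap_diff A B))) => j.
  exact: ctensor_swap_inj.
by move=> y; exists (sval (ctensor_swap_spec B A j) y); exact: ctensor_swapK.
Qed.

Lemma ctensor_single A B p0 q0 n (t : tensor (A p0) (B q0)) : p0 + q0 = n ->
  exists c : ctensor_obj A B n, comp c p0 q0 = t /\
    forall p q, p != p0 -> comp c p q = 0.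
Proof.
move=> pq0; pose f p q := tensor_map (tr A p0 p) (tr B q0 q) t.
have f0 p q : p != p0 -> f p q = 0.
  by move=> pp; apply: tmap0l => x; rewrite tr_ne // eq_sym.
have [|c cE] := @ctensor_mk A B n f.
  by exists (`|p0| + 1)%N => p q pN; apply: f0; lia.
exists c; split=> [|p q pp].
  by rewrite cE // /f tmap_id // => x; rewrite tr_id.
have [pq|pq] := eqVneq (p + q) n; last exact: comp_out.
by rewrite cE // f0.
Qed.

Lemma cycle_at X i k (x : X i) : i = k + 1 -> diff X i k x = 0 -> cycle x.
Proof. by move=> ik; have -> : k = i - 1 by lia. Qed.

(** The row p = t alone survives, with (-1)^t times the differential of A_t (x) B; this accounts for
    the signs in the witnesses. *)
Lemma concentrated_exact A B t j k : (forall i, i != t -> zero_module (A i)) ->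
  j = t + k -> exact_at (ctensor A B) j <-> exact_at (mtensor (A t) B) k.
Proof.
move=> At jtk.
have tz p q (u : tensor (A p) (B q)) : p != t -> u = 0.
  by move=> pt; apply: zero_tensor; apply: At.
have dA p q (u : tensor (A (p + 1)) (B q)) :
    tensor_map (diff A (p + 1) p) (idL (B q)) u = 0.
  have [pt|pt] := eqVneq p t; last exact: tz.
  by rewrite [u]tz ?linear0 //; lia.
split=> [hc y cy|hm c cc].
  have [c [ct c0]] := ctensor_single y (esym jtk).
  have [|e eE] := hc c.
    apply: ctensor_ext => p q pq.
    have [pt|pt] := eqVneq p t; last by rewrite [LHS]tz // [RHS]tz.
    subst p; rewrite ctensor_diffE // dA add0r.
    have [qk|qk] := eqVneq (q + 1) k; last by lia.
    subst k; rewrite ct; have /cycleP/(_ q) := cy.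
    rewrite -[diff _ _ _ y]/(tensor_map (idL (A t)) (diff B (q + 1) q) y) => ->.
    by rewrite scaler0; apply/esym; exact: (linear0 (comp_lin A B _ t q)).
  apply: (@boundaryI R (mtensor (A t) B) k (k + 1) _ ((-1) ^+ `|t|%N *: comp e t (k + 1))).
  rewrite -[LHS]/(tensor_map (idL (A t)) (diff B (k + 1) k) _).
  rewrite linearZ_LR -ct -eE ctensor_diffE; last by rewrite jtk.
  by rewrite dA add0r.
have [l kl] : exists l, k = l + 1 by exists (k - 1); lia.
have [|z zE] := hm (comp c t k).
  apply: (cycle_at kl); subst k.
  have /(congr1 (fun c => (-1) ^+ `|t|%N *: comp c t l)) := cc.
  rewrite ctensor_diffE ?dA ?add0r ?signr_sqr; last by lia.
  move=> E; rewrite -[LHS]/(tensor_map (idL (A t)) (diff B (l + 1) l) _) E.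
  by rewrite [comp _ _ _](linear0 (comp_lin A B _ t l)) scaler0.
have [|e [et _]] := @ctensor_single A B t (k + 1) (j + 1) ((-1) ^+ `|t|%N *: z).
  by lia.
exists e; apply: ctensor_ext => p q pq.
have [pt|pt] := eqVneq p t; last by rewrite [LHS]tz // [RHS]tz.
subst p; have qk : q = k by lia.
subst q; rewrite ctensor_diffE // dA add0r et [tensor_map _ _ (_ *: _)]linearZ_LR.
by rewrite signr_sqr.
Qed.

(* Filtering A (x) B by the degree in A, one row is removed at a time. *)
Lemma ctensor_row_exact A B lo hi t j :
  (forall i, i < lo \/ hi < i -> zero_module (A i)) ->
  (forall p q, t < q -> exact_at (mtensor (A p) B) q) -> t + hi < j ->
  exact_at (ctensor A B) j.
Proof.
move=> A0 hrow tj c cc; have [k] : exists k : nat, hi < lo + k%:Z.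
  by exists (`|hi - lo| + 1)%N; lia.
move=> hk; have {hk} : forall p q, lo + k%:Z <= p -> comp c p q = 0.
  by move=> p q lp; apply: zero_tensor; apply: A0; lia.
elim: k c cc => [|k IHk] c cc c0.
  suff -> : c = 0 by exact: boundary0.
  apply: ctensor_ext => p q pq; rewrite [RHS](linear0 (comp_lin A B j p q)).
  have [lp|pl] := leP lo p; first by apply: c0; lia.
  by apply: zero_tensor; apply: A0; left.
pose p0 := lo + k%:Z; have [hp|ph] := ltP hi p0.
  apply: IHk => // p q lp; apply: zero_tensor; apply: A0; rewrite /p0 in hp; lia.
have [l lE] : exists l, j = p0 + (l + 1) by exists (j - p0 - 1); lia.
have tl : t < l + 1 by lia.
(* The component in the top remaining row is a cycle of that row, since the row above it is zero.
   Its degree j - p0 exceeds t because p0 is at most hi. *)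
have [|b bE] := hrow p0 (l + 1) tl (comp c p0 (l + 1)).
  apply: (cycle_at erefl).
  have /(congr1 (fun c => (-1) ^+ `|p0|%N *: comp c p0 l)) := cc.
  rewrite ctensor_diffE; last by lia.
  rewrite c0; last by rewrite /p0; lia.
  rewrite linear0 add0r signr_sqr => E.
  rewrite -[LHS]/(tensor_map (idL (A p0)) (diff B (l + 1) l) _) E.
  by rewrite [comp _ _ _](linear0 (comp_lin A B _ p0 l)) scaler0.
have [|e [ep e0]] := @ctensor_single A B p0 (l + 1 + 1) (j + 1) ((-1) ^+ `|p0|%N *: b).
  by lia.
rewrite -[c](subrK (diff (ctensor A B) (j + 1) j e)); apply: boundaryD; last by exists e.
apply: IHk => [|p q lp]; first by rewrite /cycle linearB cc diff_diff subrr.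
have [pq|pq] := eqVneq (p + q) j; last exact: comp_out.
rewrite -[comp _ _ _]/(comp_lin A B j p q _) linearB /= ctensor_diffE //.
rewrite [comp e (p + 1) q]e0 ?linear0 ?add0r; last by lia.
have [pp|pp] := eqVneq p p0; last first.
  have lp' : lo + k.+1%:Z <= p by move: pp lp; rewrite /p0; lia.
  by rewrite (c0 p) // (e0 p) // linear0 scaler0 subr0.
subst p; have ql : q = l + 1 by lia.
subst q; rewrite ep [tensor_map _ _ (_ *: _)]linearZ_LR signr_sqr.
by rewrite -[tensor_map _ _ b]/(diff (mtensor (A p0) B) _ _ b) bE subrr.
Qed.

(** * Tensoring with a cone *)

Section ConeTensor.
Variables (A X Y : complex R) (f : chain_map X Y).

Lemma cone_fst_linear i : linear (fun u : cone f i => u.1).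
Proof. by []. Qed.
Definition cone_fst i : {linear cone f i -> X (i - 1)} := mk_linear (@cone_fst_linear i).

Lemma cone_snd_linear i : linear (fun u : cone f i => u.2).
Proof. by []. Qed.
Definition cone_snd i : {linear cone f i -> Y i} := mk_linear (@cone_snd_linear i).

Lemma cone_inl_linear i : linear (fun x : X (i - 1) => (x, 0) : cone f i).
Proof. by move=> a x y; congr pair; rewrite /= scaler0 addr0. Qed.
Definition cone_inl i : {linear X (i - 1) -> cone f i} := mk_linear (@cone_inl_linear i).

Definition cone_base q : {linear cone f (q + 1) -> X q} :=
  tr X (q + 1 - 1) q \o cone_fst (q + 1).

(** The sign (-1)^p arises from moving the shift of X past an element of A_p; without it the
    isomorphism with the cone of A (x) f would not be a chain map. *)
Lemma cone_tensor_fst i : {F : {linear ctensor_obj A (cone f) i -> ctensor_obj A X (i - 1)} |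
  forall c p q, comp (F c) p q =
    (-1) ^+ `|p|%N *: tensor_map (idL (A p)) (cone_base q) (comp c p (q + 1))}.
Proof.
pose L p q : {linear ctensor_obj A (cone f) i -> tensor (A p) (X q)} :=
  ((-1) ^+ `|p|%N) \*: (tensor_map (idL (A p)) (cone_base q) \o comp_lin A (cone f) i p (q + 1)).
have LE p q c : L p q c =
  (-1) ^+ `|p|%N *: tensor_map (idL (A p)) (cone_base q) (comp c p (q + 1)) by [].
have [c|F FE] := @ctensor_lin A (cone f) A X i (i - 1) L.
  have [N cN] := comp_bounded c; exists N => p q pN.
  by rewrite LE cN // linear0 scaler0.
exists F => c p q; have [pq|pq] := eqVneq (p + q) (i - 1); first by rewrite FE.
rewrite comp_out // comp_out ?linear0 ?scaler0 //; apply: contra pq; lia.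
Qed.

Lemma cone_tensor_snd i : {F : {linear ctensor_obj A (cone f) i -> ctensor_obj A Y i} |
  forall c p q, comp (F c) p q = tensor_map (idL (A p)) (cone_snd q) (comp c p q)}.
Proof.
have [c|F FE] := @ctensor_lin A (cone f) A Y i i
  (fun p q => tensor_map (idL (A p)) (cone_snd q) \o comp_lin A (cone f) i p q).
  have [N cN] := comp_bounded c; exists N => p q pN.
  by rewrite -[LHS]/(tensor_map (idL (A p)) (cone_snd q) (comp c p q)) cN // linear0.
exists F => c p q; have [pq|pq] := eqVneq (p + q) i; first exact: FE.
by rewrite !comp_out // linear0.
Qed.

Lemma cone_tensor_linear i : linear (fun c : ctensor A (cone f) i =>
  (sval (cone_tensor_fst i) c, sval (cone_tensor_snd i) c) : cone (ctensor_map A f) i).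
Proof. by move=> a c c'; rewrite !linearP. Qed.

Lemma cone_tensor_diff i j c : mk_linear (@cone_tensor_linear j)
    (diff (ctensor A (cone f)) i j c) =
  diff (cone (ctensor_map A f)) i j (mk_linear (@cone_tensor_linear i) c).
Proof.
have [ij|ij] := eqVneq i (j + 1); last by rewrite !diff_shape // linear0.
subst i; congr pair; apply: ctensor_ext => p q pq.
  rewrite (svalP (cone_tensor_fst j)) ctensor_diffE; last by lia.
  rewrite -[comp (- _) p q]/(comp_lin A X _ p q (- _)) linearN.
  rewrite -[comp_lin _ _ _ _ _ _]/(comp (diff (ctensor A X) _ _ _) p q).
  rewrite ctensor_diffE // !(svalP (cone_tensor_fst (j + 1))).
  rewrite ![tensor_map _ _ (_ *: _)]linearZ_LR linearD scalerDr opprD.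
  rewrite [tensor_map _ _ (_ *: _)]linearZ_LR !signr_sqr tmapC; congr (_ + _).
    by rewrite signr_absz_add1 scaleNr opprK.
  rewrite (@tmap_comp _ _ _ _ _ _ _ _ _ _ _ (idL (A p))
    (cone_base q \o diff (cone f) (q + 1 + 1) (q + 1))) //.
  rewrite (@tmap_comp _ _ _ _ _ _ _ _ _ _ _ (idL (A p))
    (diff X (q + 1) q \o cone_base (q + 1))) //.
  by apply: tmap_oppr => u /=; rewrite linearN tr_diff.
rewrite (svalP (cone_tensor_snd j)) ctensor_diffE //.
rewrite -[comp (_ + _) p q]/(comp_lin A Y _ p q (_ + _)) linearD.
rewrite -[RHS]/(comp (ctensor_map A f j (tr (ctensor A X) (j + 1 - 1) j
    (sval (cone_tensor_fst (j + 1)) c)) : ctensor_obj A Y j) p q +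
  comp (diff (ctensor A Y) (j + 1) j (sval (cone_tensor_snd (j + 1)) c) :
    ctensor_obj A Y j) p q).
rewrite comp_map comp_tr; last by lia.
rewrite ctensor_diffE // (svalP (cone_tensor_fst (j + 1))) !(svalP (cone_tensor_snd (j + 1))).
rewrite linearD ![tensor_map _ _ (_ *: _)]linearZ_LR -tmapC [RHS]addrCA -scalerDr.
congr (_ + _ *: _).
rewrite !(@tmap_comp _ _ _ _ _ _ _ (idL (A p)) (cone_base q) _ _ (idL (A p))
  (f q \o cone_base q)) //.
rewrite !(@tmap_comp _ _ _ _ _ _ _ (idL (A p)) (cone_snd (q + 1)) _ _ (idL (A p))
  (diff Y (q + 1) q \o cone_snd (q + 1))) //.
rewrite !(@tmap_comp _ _ _ _ _ _ _ (idL (A p)) (diff (cone f) (q + 1) q) _ _ (idL (A p))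
  (cone_snd q \o diff (cone f) (q + 1) q)) //.
exact: tmap_addr.
Qed.

Definition cone_tensor : chain_map (ctensor A (cone f)) (cone (ctensor_map A f)) :=
  @ChainMap R (ctensor A (cone f)) (cone (ctensor_map A f))
    (fun i => mk_linear (@cone_tensor_linear i)) cone_tensor_diff.

Lemma cone_base_shift p q q' (t : tensor (A p) (cone f q')) : q' = q + 1 ->
  tensor_map (idL (A p)) (tr X (q' - 1) q \o cone_fst q') t = 0 ->
  tensor_map (idL (A p)) (cone_fst q') t = 0.
Proof.
move=> qq t0; have E : q = q' - 1 by lia.
subst q; rewrite -t0; apply: tmap_eq => // x /=.
by rewrite tr_id.
Qed.

Lemma cone_tensor_inj i : injective (cone_tensor i).
Proof.
apply: linear_inj => c [c1 c2]; apply: ctensor_ext => p q pq.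
rewrite [RHS](linear0 (comp_lin A (cone f) i p q)).
have t2 : tensor_map (idL (A p)) (cone_snd q) (comp c p q) = 0.
  rewrite -(svalP (cone_tensor_snd i)) c2.
  exact: (linear0 (comp_lin A Y i p q)).
have t1 : tensor_map (idL (A p)) (cone_fst q) (comp c p q) = 0.
  have [l ql] : exists l, q = l + 1 by exists (q - 1); lia.
  subst q; apply: (@cone_base_shift p l) => //.
  have := svalP (cone_tensor_fst i) c p l; rewrite c1.
  rewrite [comp _ _ _](linear0 (comp_lin A X (i - 1) p l)).
  by move=> /esym/(congr1 (fun t => (-1) ^+ `|p|%N *: t)); rewrite signr_sqr scaler0.
rewrite -[LHS](@tmap_id _ _ _ (idL (A p)) idfun) //.
rewrite (@tmap_addr _ _ _ _ (cone_inl q \o cone_fst q) (cone_in f q \o cone_snd q)); last first.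
  by case=> x y; congr pair; rewrite /= ?addr0 ?add0r.
rewrite -(@tmap_comp _ _ _ _ _ _ _ (idL (A p)) (cone_fst q) (idL (A p)) (cone_inl q)) //.
rewrite -(@tmap_comp _ _ _ _ _ _ _ (idL (A p)) (cone_snd q) (idL (A p)) (cone_in f q)) //.
by rewrite t1 t2 !linear0 addr0.
Qed.

Lemma cone_tensor_surj i u : exists c, cone_tensor i c = u.
Proof.
case: u => x y.
pose g p q : tensor (A p) (cone f q) :=
  (-1) ^+ `|p|%N *: tensor_map (idL (A p)) (cone_inl q) (comp x p (q - 1)) +
  tensor_map (idL (A p)) (cone_in f q) (comp y p q).
have [|c cE] := @ctensor_mk A (cone f) i g.
  have [N xN] := comp_bounded x; have [M yM] := comp_bounded y.
  exists (N + M)%N => p q pN; rewrite /g xN ?yM ?linear0 ?scaler0 ?addr0 //; lia.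
exists c; congr pair; apply: ctensor_ext => p q pq.
  rewrite (svalP (cone_tensor_fst i)) cE; last by lia.
  rewrite /g linearD [tensor_map _ _ (_ *: _)]linearZ_LR scalerDr signr_sqr.
  rewrite (@tmap_comp _ _ _ _ _ _ _ (idL (A p)) (cone_inl (q + 1)) _ _ (idL (A p))
    (tr X (q + 1 - 1) q)) //.
  rewrite tmap0rr ?scaler0 ?addr0; last by move=> z /=; rewrite linear0.
  rewrite (@comp_shift A X (i - 1) x p (q + 1 - 1) q (X q) (fun k => tr X k q)); last by lia.
  by rewrite tmap_id // => z; rewrite tr_id.
rewrite (svalP (cone_tensor_snd i)) cE // /g linearD [tensor_map _ _ (_ *: _)]linearZ_LR.
rewrite tmap0rr // scaler0 add0r.
by rewrite (@tmap_comp _ _ _ _ _ _ _ _ _ _ _ (idL (A p)) idfun) // tmap_id.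
Qed.

Lemma cone_tensor_exact i :
  exact_at (ctensor A (cone f)) i <-> exact_at (cone (ctensor_map A f)) i.
Proof.
by apply: (chain_bij_exact (f := cone_tensor)) => [j|j y]; [exact: cone_tensor_inj|exact: cone_tensor_surj].
Qed.
End ConeTensor.

Section ConeExact.
Variables (X Y : complex R) (f : chain_map X Y).

(* The long exact sequence of H_j(X) -> H_j(Y) -> H_j(cone f). *)
Lemma cone_exact_inj j : exact_at (cone f) (j + 1) ->
  forall x : X j, cycle x -> boundary (f j x) -> boundary x.
Proof.
move=> hc x cx [y yE]; have jk : j = j - 1 + 1 by lia.
have [|u uE] := hc (cpair f x (- y)).
  apply: (cycle_at erefl).
  by rewrite (cpair_diff _ _ _ erefl jk) cx linearN yE subrr oppr0 cpair0.
have [x' [y' E]] := cpair_ex (j := j + 1) u erefl.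
move: uE; rewrite E (cpair_diff _ _ _ erefl erefl) => /cpair_inj[] // xE _.
by exists (- x'); rewrite linearN.
Qed.

Lemma cone_exact_boundary j (y : Y j) : boundary (cone_in f j y) ->
  exists2 x : X j, cycle x & boundary (y - f j x).
Proof.
move=> [u uE]; have jk : j = j - 1 + 1 by lia.
have [x [y' E]] := cpair_ex (j := j) u erefl.
move: uE; rewrite E (cpair_diff _ _ _ erefl jk).
have -> : cone_in f j y = cpair f (0 : X (j - 1)) y by congr pair; rewrite linear0.
move=> /cpair_inj[] // /eqP; rewrite oppr_eq0 => /eqP x0 yE.
by exists x => //; exists y'; rewrite -yE [X in X - _]addrC addrK.
Qed.

Lemma cone_acyclic_exact : acyclic (cone f) -> forall j, exact_at X j <-> exact_at Y j.
Proof.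
move=> hc j; split=> [hX y cy|hY x cx].
  have [x cx bx] := cone_exact_boundary (hc j _ (chain_cycle (cone_in f) cy)).
  rewrite -[y](subrK (f j x)); apply: boundaryD => //.
  by apply: chain_boundary; apply: hX.
by apply: (cone_exact_inj (hc (j + 1)) cx); apply: hY; apply: chain_cycle.
Qed.
End ConeExact.
End TotalTensor.

(** * The injective hull of the residue field *)

Section Baer.
Variable R : comNzRingType.

(* Baer's criterion, for partial maps R -> J given by their graphs. *)
Definition baer (J : lmodType R) : Prop :=
  forall S : (R^o * J)%type -> Prop, submodule S -> (forall y, S (0, y) -> y = 0) ->
  exists y0, forall r y, S (r, y) -> y = r *: y0.

Lemma injective_baer (J : lmodType R) : injective_module J -> baer J.
Proof.
move=> hJ S hS S0; have [N [u [ui uP]]] := submodule_carrier hS.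
have l1 : linear (fun x => (u x).1) by move=> a x y; rewrite linearP.
have l2 : linear (fun x => (u x).2) by move=> a x y; rewrite linearP.
have i1 : injective (mk_linear l1).
  apply: linear_inj => x /= x0; apply: (inj_eq0 ui).
  have Sx : S (u x) by apply/uP; exists x.
  move: Sx x0; case: (u x) => r y /= Sx r0; subst r.
  by rewrite (S0 _ Sx).
have [g gE] := hJ _ _ (mk_linear l1) (mk_linear l2) i1.
exists (g 1) => r y /uP[x xE].
have := gE x; rewrite /= xE /= => <-.
by rewrite -linearZ /= /GRing.scale /= mulr1.
Qed.

Lemma baer_injective (J : lmodType R) : baer J -> injective_module J.
Proof.
move=> hJ M N i f ii.
pose P (A : set (N * J)%type) := [/\ forall a u v, A u -> A v -> A (a *: u + v),
  forall y, A (0, y) -> y = 0 & (exists u, A u) -> forall x, A (i x, f x)].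
have pairE (a : R) (u v : (N * J)%type) : a *: u + v = (a *: u.1 + v.1, a *: u.2 + v.2).
  by [].
have P0 : P (fun u => exists x, u = (i x, f x)).
  split=> [a _ _ [x ->] [y ->]|y [x [/esym ix ->]]|_ x]; last by exists x.
    by exists (a *: x + y); rewrite pairE /= !linearP.
  by rewrite (inj_eq0 ii ix) linear0.
have [|A [[AD A0 Af] Amax]] := @Zorn_bigcup _ P.
  move=> F FP Ftot; split.
  - move=> a u v [X FX Xu] [Y FY Yv].
    have [XY|YX] := Ftot _ _ FX FY.
      by exists Y => //; have [+ _ _] := FP _ FY; apply => //; apply: XY.
    by exists X => //; have [+ _ _] := FP _ FX; apply => //; apply: YX.
  - by move=> y [X FX Xy]; have [_ + _] := FP _ FX; apply.
  - by move=> [u [X FX Xu]] x; exists X => //; have [_ _ +] := FP _ FX; apply; exists u.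
have Ane : exists u, A u.
  apply: contrapT => nA; apply: (Amax _ _ P0); split.
    by move=> u Au; case: nA; exists u.
  by move=> /(_ (i 0, f 0)) h; apply: nA; exists (i 0, f 0); apply: h; exists 0.
have {}Af := Af Ane.
have A00 : A (0, 0) by have := Af 0; rewrite !linear0.
have Atot x0 : exists y, A (x0, y).
  apply: contrapT => nx0.
  (* Applied to the partial map sending r to the value of A at r x0, the criterion yields a value y0
     for x0 that is compatible with A. *)
  have [||y0 y0E] := hJ (fun u => A (u.1 *: x0, u.2)).
  - split=> [|a u v Au Av]; first by rewrite scale0r.
    have := AD a _ _ Au Av; rewrite pairE /= scalerA -scalerDl.
    by [].
  - by move=> y /=; rewrite scale0r; apply: A0.
  pose A' : set (N * J)%type := fun u => exists r x y, A (x, y) /\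
    u = (x + r *: x0, y + r *: y0).
  apply: (Amax A'); first split.
  - move=> [x y] Axy; exists 0, x, y; split=> //.
    by rewrite !scale0r !addr0.
  - move=> h; apply: nx0; exists y0; apply: h; exists 1, 0, 0; split=> //.
    by rewrite !scale1r !add0r.
  split.
  - move=> a _ _ [r [x [y [Axy ->]]]] [r' [x' [y' [Axy' ->]]]].
    exists (a * r + r'), (a *: x + x'), (a *: y + y'); split.
      by have := AD a _ _ Axy Axy'.
    rewrite pairE /= !scalerDr !scalerDl !scalerA; congr pair; exact: addrACA.
  - move=> y [r [x [y' [Axy [/esym x0E ->]]]]].
    have xE : x = (- r) *: x0 by rewrite scaleNr; apply/eqP; rewrite -addr_eq0 x0E.
    have -> : y' = (- r) *: y0 by apply: y0E; rewrite /= -xE.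
    by rewrite scaleNr addNr.
  - move=> _ x; exists 0, (i x), (f x); split=> //.
    by rewrite !scale0r !addr0.
have Afun x y y' : A (x, y) -> A (x, y') -> y = y'.
  move=> Ay Ay'; apply/eqP; rewrite eq_sym -subr_eq0; apply/eqP/A0.
  have := AD (-1) _ _ Ay Ay'.
  by rewrite pairE /= !scaleN1r addNr [X in (_, X)]addrC.
have [g gA] := choice Atot.
have gl : linear g.
  by move=> a x y; apply: Afun (gA _) _; have := AD a _ _ (gA x) (gA y).
by exists (mk_linear gl) => x; apply: Afun (gA _) (Af x).
Qed.

(** The domain of a partial map from R is a finitely generated ideal, so the values on the
    generators involve finitely many coordinates. The criterion is solved in those coordinates, and
    the solution is set to 0 elsewhere. *)
Lemma baer_dsum (I : eqType) (V : I -> lmodType R) : noetherian R ->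
  (forall i, baer (V i)) -> baer (dsum V).
Proof.
move=> hR hV S [S00 SD] S0.
have [io [pr [_ prE _ _]]] := dsum_decomposition V.
pose I0 : {pred R} := fun r => `[< exists y, S (r : R^o, y) >].
have I0P r : r \in I0 <-> exists y, S (r : R^o, y) by split=> /asboolP.
have [] := hR I0.
  split; first by apply/asboolP; exists 0.
  move=> a r r' /I0P[y Sy] /I0P[y' Sy']; apply/I0P.
  by exists (a *: y + y'); have := SD a _ _ Sy Sy'.
move=> n [s sP].
have /choice[y yS] : forall i, exists y, S (s i : R^o, y).
  move=> i; apply/I0P/sP; exists (fun j => (j == i)%:R); rewrite (bigD1 i) //= eqxx mul1r big1 ?addr0 //.
  by move=> j /negbTE ->; rewrite mul0r.
have Ssum (c : 'I_n -> R) : S (\sum_i c i * s i : R^o, \sum_i c i *: y i).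
  apply: (big_ind2 (fun (r : R^o) y => S (r, y))) => // [r1 y1 r2 y2 S1 S2|i _].
    by have := SD 1 _ _ S1 S2; rewrite !scale1r.
  by have := SD (c i) _ _ (yS i) S00; rewrite addr0.
have yE r z : S (r, z) -> exists c, r = \sum_i c i * s i /\ z = \sum_i c i *: y i.
  move=> Sz; have : r \in I0 by apply/I0P; exists z.
  move=> /sP[c rE]; exists c; split=> //.
  apply/eqP; rewrite eq_sym -subr_eq0; apply/eqP/S0.
  have := SD (-1) _ _ Sz (Ssum c); rewrite -rE !scaleN1r.
  rewrite [X in S X -> _](_ : _ = (- (r : R^o) + r, - z + \sum_i c i *: y i)) //.
  by rewrite addNr [X in (_, X)]addrC.
have /choice[t tE] i : exists t : seq I, forall x, x \notin t -> dsum_val (y i) x = 0.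
  by case: (asboolW (valP (y i))) => t tP; exists t.
have Vx x : exists y0, forall r z, S (r, z) -> pr x z = r *: y0.
  have [||y0 y0E] := hV x (fun u => exists2 z, S (u.1, z) & u.2 = pr x z).
  - split=> [|a u v [z Sz uE] [z' Sz' vE]]; first by exists 0; rewrite ?linear0.
    exists (a *: z + z'); first by have := SD a _ _ Sz Sz'.
    by rewrite [RHS]linearP -uE -vE.
  - by move=> w [z /= /S0 z0 wE]; rewrite wE z0 linear0.
  - by exists y0 => r z Sz; apply: y0E; exists z.
pose w x := sval (cid (Vx x)).
have wE x r z : S (r, z) -> pr x z = r *: w x by apply: (svalP (cid (Vx x))).
pose T := flatten [seq t i | i <- enum 'I_n].
pose y0 : dprod V := fun x => if x \in T then w x else 0.
have y0fin : y0 \in fin_supp (V := V).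
  by apply/asboolP; exists T => x /negbTE xT; rewrite /y0 xT.
exists (DSum y0fin) => r z Sz; apply: val_inj; apply: functional_extensionality_dep => x.
rewrite [RHS](_ : _ = r *: y0 x) // -[LHS]prE /y0; case: ifP => xT; first exact: wE.
have [c [_ ->]] := yE r z Sz.
rewrite scaler0 linear_sum big1 // => i _; rewrite linearZ_LR prE tE ?scaler0 //.
apply: contraFN xT => xt; apply/flattenP; exists (t i) => //.
by apply/mapP; exists i => //; rewrite mem_enum.
Qed.

End Baer.

(** * The socle of the hull and direct sums of its copies *)

Section Hull.
Variables (R : comNzRingType) (m : submodClosed R^o).
Hypotheses (hN : noetherian R) (hm : maximal_ideal (m : {pred R})).
Variables (n : nat) (s : 'I_n -> R).
Hypothesis hs : generates s (m : {pred R}).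

Lemma ideal_mulr (a r : R) : a \in m -> r * a \in m.
Proof. by move=> am; exact: (rpredZ r am). Qed.

Lemma idealN (a : R) : a \in m -> - a \in m.
Proof. by move=> am; rewrite -mulN1r; apply: ideal_mulr. Qed.

Lemma idealD (a b : R) : a \in m -> b \in m -> a + b \in m.
Proof. move=> am bm; exact: (rpredD am bm). Qed.

Lemma ideal0 : (0 : R) \in m.
Proof. exact: (rpred0 m). Qed.

Lemma gens_in i : s i \in m.
Proof.
apply/hs; exists (fun j => (j == i)%:R).
by rewrite (bigD1 i) //= eqxx mul1r big1 ?addr0 // => j /negbTE ->; rewrite mul0r.
Qed.

Lemma gens_annihilate (M : lmodType R) (P : M -> Prop) (x : M) : submodule P ->
  (forall i, P (s i *: x)) -> forall a, a \in m -> P (a *: x).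
Proof.
move=> [P0 PD] Px a /hs[c ->]; rewrite scaler_suml; apply: (big_ind P) => // [y z Py Pz|i _].
  by rewrite -[y]scale1r; apply: PD.
by rewrite -scalerA -[_ *: _]addr0; apply: PD.
Qed.

Lemma residue_inverse (b : R) : b \notin m -> exists b', b' * b - 1 \in m.
Proof.
move=> bm; have [_ m1 mmax] := hm.
pose J : {pred R} := fun x => `[< exists r, x - r * b \in m >].
have hJ : ideal J.
  split; first by apply/asboolP; exists 0; rewrite mul0r subr0 ideal0.
  move=> a x y /asboolP[r rm] /asboolP[t tm]; apply/asboolP; exists (a * r + t).
  have -> : a *: x + y - (a * r + t) * b = a * (x - r * b) + (y - t * b) :> R.
    by rewrite /GRing.scale /=; ring.
  by apply: idealD => //; apply: ideal_mulr.
have bJ : b \in J by apply/asboolP; exists 1; rewrite mul1r subrr ideal0.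
have [J1|J1] := boolP (1 \in J).
  have [r rm] := asboolW J1; exists r.
  by rewrite -opprB; apply: idealN.
case/negP: bm; rewrite -(mmax J hJ J1) // => x xm.
by apply/asboolP; exists 0; rewrite mul0r subr0.
Qed.

(** The generators are treated one at a time: multiply by the highest power of s_i that does not
    lead into P. Earlier relations persist under multiplication. Working relative to P covers
    homology classes, with P the boundaries, without forming a quotient. *)
Lemma socle_multiple (M : lmodType R) (P : M -> Prop) (x : M) : submodule P ->
  ~ P x -> (forall i, exists k, P (s i ^+ k *: x)) ->
  exists r, ~ P (r *: x) /\ forall i, P (s i *: (r *: x)).
Proof.
move=> hP nPx tx.
have PZ a y : P y -> P (a *: y).
  by case: hP => P0 PD Py; rewrite -[_ *: _]addr0; apply: PD.
suff H k : (k <= n)%N ->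
    exists r, ~ P (r *: x) /\ forall i : 'I_n, (i < k)%N -> P (s i *: (r *: x)).
  by have [r [nPr Pr]] := H n (leqnn n); exists r; split=> // i; apply: Pr.
elim: k => [|k IHk] kn.
  by exists 1; rewrite scale1r.
have [r [nPr Pr]] := IHk (ltnW kn).
pose i0 := Ordinal kn; have [l Pl] := tx i0.
pose Q j := `[< P (s i0 ^+ j *: (r *: x)) >].
have exQ : exists j, Q j.
  by exists l; apply/asboolP; rewrite scalerA mulrC -scalerA; apply: PZ.
case: (ex_minnP exQ) => -[|j] /asboolP Qj jmin.
  by case: nPr; move: Qj; rewrite expr0 scale1r.
exists (s i0 ^+ j * r); rewrite -scalerA; split=> [Pj|i].
  by have := jmin j (asboolT Pj); rewrite ltnn.
rewrite ltnS leq_eqVlt => /orP[/eqP ik|ik].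
  have -> : i = i0 by apply: val_inj.
  by rewrite [s i0 *: _]scalerA -exprS.
by rewrite [s i *: _]scalerA mulrC -scalerA; apply: PZ; apply: Pr.
Qed.

Section E.
Variable E : lmodType R.
Hypothesis hE : injective_hull (qmod m : lmodType R) E.

Lemma hull_injective : injective_module E.
Proof. by case: hE. Qed.

(** The generator e is the image of 1 in R/m. The two properties recorded here stand for the
    essential embedding of R/m: the annihilator of e is m, and e lies in every nonzero submodule. *)
Lemma hull_socle : exists e : E, (forall a, a *: e = 0 <-> a \in m) /\
  forall y, y != 0 -> exists r, r *: y = e.
Proof.
case: hE => _ [i ii ess]; pose e := i (qmod_pi m (1 : R^o)).
have eE (a : R) : a *: e = i (qmod_pi m (a : R^o)).
  rewrite /e -linearZ; congr (i _).
  rewrite -[a *: _]/(qmod_scale a _) qmod_scaleE; congr qmod_pi.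
  by rewrite /GRing.scale /= mulr1.
have e0 a : a *: e = 0 <-> a \in m.
  have E0 := qmod_piE m (a : R^o) 0; rewrite subr0 linear0 in E0.
  by rewrite eE -E0; split=> [/(inj_eq0 ii)/eqP //|/eqP ->]; rewrite linear0.
exists e; split=> // y y0.
pose N : {pred E} := fun z => `[< exists r, z = r *: y >].
have hNs : submod_closed N.
  split; first by apply/asboolP; exists 0; rewrite scale0r.
  move=> a u v /asboolP[r ->] /asboolP[t ->]; apply/asboolP; exists (a * r + t).
  by rewrite scalerDl scalerA.
have [|x /asboolP[r xE] ix0] := ess N hNs.
  by exists y => //; apply/asboolP; exists 1; rewrite scale1r.
have [b bE] := qmod_pi_surj x.
have bm : (b : R) \notin m.
  by apply: contra ix0 => /e0; rewrite eE bE => ->.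
have [b' b'E] := residue_inverse bm; exists (b' * r).
rewrite -scalerA -xE -bE -eE scalerA; apply/eqP; rewrite -subr_eq0.
by rewrite -[X in _ - X]scale1r -scalerBl; apply/eqP/e0.
Qed.

Lemma hull_socle_neq0 (e : E) : (forall a, a *: e = 0 <-> a \in m) -> e <> 0.
Proof.
move=> eP e0; have [_ /negP m1 _] := hm; apply: m1.
by apply/eP; rewrite e0 scaler0.
Qed.

(** The ideal U of all r with r a^k y = 0 for some k is finitely generated, so one exponent K serves
    all of U. If a^K y were nonzero, some r a^K y would equal e; then r a^(K+1) y = a e = 0 puts r
    in U and forces e = 0. *)
Lemma hull_torsion (a : R) (y : E) : a \in m -> exists k, a ^+ k *: y = 0.
Proof.
move=> am; have [e [eP ess]] := hull_socle.
pose U : {pred R} := fun r => `[< exists k, (r * a ^+ k) *: y = 0 >].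
have UP r : r \in U <-> exists k, (r * a ^+ k) *: y = 0 by split=> /asboolP.
have more r k l : (k <= l)%N -> (r * a ^+ k) *: y = 0 -> (r * a ^+ l) *: y = 0.
  move=> kl rk; rewrite -(subnK kl) exprD mulrCA -scalerA rk scaler0 //.
have hU : ideal U.
  split; first by apply/UP; exists 0%N; rewrite mul0r scale0r.
  move=> c r t /UP[k rk] /UP[l tl]; apply/UP; exists (k + l)%N.
  rewrite -[c *: r]/(c * r) mulrDl scalerDl -mulrA -scalerA.
  by rewrite (more r k) ?leq_addr // (more t l) ?leq_addl // scaler0 addr0.
have [q [u uP]] := hN hU.
have /choice[k kP] i : exists k, (u i * a ^+ k) *: y = 0.
  apply/UP/uP; exists (fun j => (j == i)%:R).
  by rewrite (bigD1 i) //= eqxx mul1r big1 ?addr0 // => j /negbTE ->; rewrite mul0r.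
pose K := \max_i k i; exists K; apply/eqP; apply: contrapT => /negP y0.
have [r rE] := ess _ y0.
have : r \in U.
  apply/UP; exists K.+1; rewrite exprS mulrCA -scalerA -scalerA rE.
  exact/eP.
move=> /uP[c rc]; apply: (hull_socle_neq0 eP).
rewrite -rE scalerA rc mulr_suml scaler_suml big1 // => i _.
by rewrite -mulrA -scalerA (more (u i) (k i)) ?scaler0 //; apply: leq_bigmax.
Qed.

(** The elements annihilated by all s_i are the multiples of e, which f kills. Hence f extends along
    the map E -> E^n with coordinates s_i y, and the g_i are the components of the extension. *)
Lemma hull_factor_socle (J : lmodType R) (e : E) (f : {linear E -> J}) :
  (forall a, a *: e = 0 <-> a \in m) -> (forall y, y != 0 -> exists r, r *: y = e) ->
  injective_module J -> f e = 0 ->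
  exists g : 'I_n -> {linear E -> J}, forall y, f y = \sum_i g i (s i *: y).
Proof.
move=> eP ess hJ fe.
have pl : linear (fun y : E => [ffun i => s i *: y] : {ffun 'I_n -> E}).
  move=> a x y; apply/ffunP => i; rewrite !ffunE scalerDr !scalerA.
  by rewrite mulrC.
have [|h hE'] := injective_extend (p := mk_linear pl) (g := f) hJ.
  move=> y /ffunP y0; apply/eqP; apply: contrapT => /negP fy.
  have sy i : s i *: y = 0 by have := y0 i; rewrite !ffunE.
  have my a : a \in m -> a *: y = 0.
    apply: (gens_annihilate (P := fun z => z = 0)) => //.
    by split=> // b u v -> ->; rewrite scaler0 addr0.
  have yn0 : y != 0 by apply: contraNneq fy => ->; rewrite linear0.
  have [r rE] := ess _ yn0.
  have rm : r \notin m.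
    by apply/negP => /my; rewrite rE; apply: hull_socle_neq0.
  have [r' r'E] := residue_inverse rm.
  case/negP: fy; have -> : y = r' *: e.
    rewrite -rE scalerA; apply/eqP; rewrite eq_sym -subr_eq0.
    by rewrite -[X in _ - X]scale1r -scalerBl my.
  by rewrite linearZ fe /= scaler0.
have dl i : linear (fun y : E => [ffun j => if j == i then y else 0] : {ffun 'I_n -> E}).
  by move=> a x y; apply/ffunP => j; rewrite !ffunE; case: eqP; rewrite ?scaler0 ?addr0.
exists (fun i => h \o mk_linear (dl i)) => y; rewrite -hE' /= -linear_sum; congr (h _).
apply/ffunP => i; rewrite sum_ffunE ffunE (bigD1 i) //= ffunE eqxx big1 ?addr0 // => j ji.
by rewrite ffunE eq_sym (negbTE ji).
Qed.

(** Indexed by all of N, so that a subset of N can select coordinates without becoming a type of its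
    own. *)
Definition hull_sum (N : lmodType R) : lmodType R := dsum (fun _ : N => E).

Lemma hull_sum_injective (N : lmodType R) : injective_module (hull_sum N).
Proof. by apply/baer_injective/baer_dsum => // _; apply: injective_baer hull_injective. Qed.

Lemma hull_sum_torsion (N : lmodType R) (a : R) (y : hull_sum N) :
  a \in m -> exists k, a ^+ k *: y = 0.
Proof.
move=> am; have [io [pr [dec _ _ _]]] := dsum_decomposition (fun _ : N => E).
have [t tE] := dec y.
have [k kP] : exists k, forall x, x \in t -> a ^+ k *: pr x y = 0.
  elim: t {tE} => [|x t [k kP]]; first by exists 0%N.
  have [l lP] := hull_torsion (pr x y) am; exists (k + l)%N => z.
  rewrite inE => /orP[/eqP ->|zt]; first by rewrite exprD -scalerA lP scaler0.
  by rewrite exprD mulrC -scalerA kP ?scaler0.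
exists k; rewrite (tE (undup t)) ?undup_uniq // => [|x]; last by rewrite mem_undup.
rewrite scaler_sumr big_seq big1 // => x; rewrite mem_undup => xt.
by rewrite -linearZ_LR kP // linear0.
Qed.

(* A basis of the socle of H over R/m provides the index set of the direct sum; the
   resulting map is injective on the socle, hence on the torsion module H. *)
Lemma torsion_embedding (N : lmodType R) (H : N -> Prop) : submodule H ->
  (forall x, H x -> forall i, exists k, s i ^+ k *: x = 0) ->
  exists f : {linear N -> hull_sum N}, forall x, H x -> f x = 0 -> x = 0.
Proof.
move=> hH Htors; have [e [eP ess]] := hull_socle.
pose soc x := H x /\ forall i, s i *: x = 0.
have soc0 x a : soc x -> a \in m -> a *: x = 0.
  move=> [_ sx]; apply: (gens_annihilate (P := fun z => z = 0)) => //.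
  by split=> // b u v -> ->; rewrite scaler0 addr0.
pose lc : {linear {freeg N / R} -> N} := free_lift (id : N -> N).
pose supp (B : set N) (D : {freeg N / R}) := forall x, ~ B x -> coeff x D = 0.
(* Linear independence over R/m, expressed in R: a relation supported on B has all its coefficients
   in m. *)
pose P (B : set N) := (forall b, B b -> soc b) /\
  forall D, supp B D -> lc D = 0 -> forall x, coeff x D \in m.
have [|B [[Bsoc Bind] Bmax]] := @Zorn_bigcup _ P.
  move=> F FP Ftot; split; first by move=> b [X FX Xb]; exact: (FP _ FX).1.
  move=> D DF lD x.
  have seqF (t : seq N) : (forall y, y \in t -> exists2 X, F X & X y) ->
      t = [::] \/ exists2 X, F X & forall y, y \in t -> X y.
    elim: t => [|y t IHt] ht; [by left|right].
    have [Y FY Yy] := ht y (mem_head y t).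
    have [|->|[X FX Xt]] := IHt.
    - by move=> z zt; apply: ht; rewrite inE zt orbT.
    - by exists Y => // z; rewrite inE => /eqP ->.
    - have [XY|YX] := Ftot _ _ FX FY.
        by exists Y => // z; rewrite inE => /orP[/eqP ->//|/Xt]; apply: XY.
      by exists X => // z; rewrite inE => /orP[/eqP ->|/Xt //]; apply: YX.
  have [|D0|[X FX Xt]] := seqF (dom D).
  - move=> y; rewrite mem_dom => /eqP yD; apply: contrapT => nF; apply: yD.
    by apply: DF => -[X FX Xy]; apply: nF; exists X.
  - by rewrite coeff_outdom ?D0 // ideal0.
  - apply: (FP _ FX).2 => // y Xy; apply: coeff_outdom.
    by apply/negP => /Xt.
have suppZ a D D' : supp B D -> supp B D' -> supp B (a *: D + D').
  by move=> DB DB' x xB; rewrite coeffD coeffZ DB // DB' // mulr0 addr0.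
have Bspan x : soc x -> exists2 D, supp B D & lc D = x.
  move=> sx; have [Bx|nBx] := pselect (B x).
    exists (Freeg [:: (1, x)]); last by rewrite /lc free_liftU.
    by move=> y nBy; rewrite coeffU; case: eqP => [xy|]; [case: nBy; rewrite -xy|rewrite mulr0].
  have nP : ~ P (fun y => B y \/ y = x).
    apply: Bmax; split; first by move=> y By; left.
    by move=> /(_ x (or_intror erefl)).
  have [D [DB lD [z Dz]]] : exists D, [/\ supp (fun y => B y \/ y = x) D, lc D = 0 &
      exists z, coeff z D \notin m].
    apply: contrapT => nD; apply: nP; split; first by move=> b [/Bsoc//|->].
    move=> D DB lD z; apply: contrapT => /negP Dz; apply: nD.
    by exists D; split=> //; exists z.
  pose a := coeff x D; pose D' := D - a *: Freeg [:: (1, x)].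
  have cD' y : coeff y D' = coeff y D - a * (x == y)%:R.
    by rewrite coeffB coeffZ coeffU mul1r.
  have DB' : supp B D'.
    move=> y nBy; rewrite cD'; have [<-|xy] := eqVneq x y; first by rewrite mulr1 subrr.
    by rewrite mulr0 subr0; apply: DB => -[//|yx]; move: xy; rewrite yx eqxx.
  have lD' : lc D' = - (a *: x).
    by rewrite linearB lD sub0r linearZ_LR [lc _]free_liftU.
  have am : a \notin m.
    apply/negP => am; case/negP: Dz.
    have D'm : coeff z D' \in m by apply: Bind => //; rewrite lD' soc0 // oppr0.
    rewrite -[coeff z D](subrK (a * (x == z)%:R)) -cD'.
    by apply: idealD => //; rewrite mulrC; apply: ideal_mulr.
  have [a' a'E] := residue_inverse am.
  exists ((- a') *: D').
    by rewrite -[_ *: _]addr0; apply: suppZ => // y _; apply: coeff0.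
  rewrite linearZ_LR lD' scaleNr scalerN opprK scalerA; apply/eqP; rewrite -subr_eq0.
  by rewrite -[X in _ - X]scale1r -scalerBl; apply/eqP/soc0.
have [io [pr [_ _ prio prio0]]] := dsum_decomposition (fun _ : N => E).
(* The map [sg] sends a basis element to itself, and [th] sends it to the socle generator of its own
   copy of E. Both kill exactly the combinations whose coefficients on B lie in m, so [th] extends
   along [sg]. *)
pose sg : {linear {freeg N / R} -> N} := free_lift (fun x => if `[< B x >] then x else 0).
pose th : {linear {freeg N / R} -> hull_sum N} :=
  free_lift (fun x => if `[< B x >] then io x e else 0).
pose rs : {linear {freeg N / R} -> {freeg N / R}} :=
  free_lift (fun x => if `[< B x >] then Freeg [:: (1, x)] else 0).
have rsE D y : coeff y (rs D) = if `[< B y >] then coeff y D else 0.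
  rewrite /rs free_liftE raddf_sum.
  have E1 x : coeff y (coeff x D *: (if `[< B x >] then Freeg [:: (1, x)] else 0)) =
      if (x == y) && `[< B y >] then coeff y D else 0.
    rewrite coeffZ; have [->|xy] := eqVneq x y.
      by case: ifP; rewrite ?coeffU ?eqxx ?mulr1 // coeff0 mulr0.
    by case: ifP; rewrite ?coeffU ?(negbTE xy) ?mulr0 // coeff0 mulr0.
  rewrite (eq_bigr (fun x => if (x == y) && `[< B y >] then coeff y D else 0)) => [|x _];
    last exact: E1.
  have [yD|yD] := boolP (y \in dom D); last first.
    by rewrite coeff_outdom // if_same big1 // => x _; rewrite if_same.
  rewrite (bigD1_seq y) ?uniq_dom //= eqxx /= [X in _ + X]big1 ?addr0 //.
  by move=> x /negbTE ->.
have sgE D : sg D = lc (rs D).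
  rewrite [sg D]free_liftE [rs D]free_liftE raddf_sum; apply: eq_bigr => x _.
  apply: etrans (esym (linearZ_LR lc _ _)); congr (_ *: _).
  by case: ifP => _; rewrite ?linear0 // [lc _]free_liftU.
have sgm D : sg D = 0 <-> forall x, B x -> coeff x D \in m.
  split=> [|Dm].
    rewrite sgE => l0 x Bx; have := Bind (rs D) _ l0 x.
    rewrite rsE (asboolT Bx); apply=> y nBy.
    by rewrite rsE asboolF.
  rewrite /sg free_liftE big1 // => x _.
  case: asboolP => Bx; last by rewrite scaler0.
  by apply: soc0; [apply: Bsoc|apply: Dm].
have thm D : th D = 0 <-> forall x, B x -> coeff x D \in m.
  split=> [t0 x Bx|Dm].
    apply/eP; have := congr1 (pr x) t0; rewrite linear0 /th free_liftE linear_sum => <-.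
    have [xD|xD] := boolP (x \in dom D).
      rewrite (bigD1_seq x) ?uniq_dom //= (asboolT Bx) linearZ_LR prio big1 ?addr0 //.
      move=> y yx; rewrite linearZ_LR; case: ifP => _; last by rewrite linear0 scaler0.
      by rewrite prio0 // scaler0.
    rewrite coeff_outdom // scale0r big_seq big1 // => y yD.
    rewrite linearZ_LR; case: ifP => _; last by rewrite linear0 scaler0.
    by rewrite prio0 ?scaler0 //; apply: contraNneq xD => <-.
  rewrite /th free_liftE big1 // => x _.
  case: asboolP => Bx; last by rewrite scaler0.
  by rewrite -linearZ_LR; have /eP -> := Dm x Bx; rewrite linear0.
have [|f fE] := injective_extend (p := sg) (g := th) (@hull_sum_injective N).
  by move=> D /sgm D0; apply/thm.
exists f => x Hx fx; apply: contrapT => nx.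
have [||r [nr sr]] := @socle_multiple N (fun z => z = 0) x _ nx _.
- by split=> // b u v -> ->; rewrite scaler0 addr0.
- exact: Htors.
apply: nr; have [D DB lD] : exists2 D, supp B D & lc D = r *: x.
  apply: Bspan; split=> //; case: hH => H0 HD.
  by rewrite -[_ *: _]addr0; apply: HD.
have sD : sg D = lc D.
  rewrite sgE; congr (lc _); apply/eqP/freeg_eqP => y; rewrite rsE.
  by case: asboolP => // nBy; rewrite DB.
have /thm/sgm : th D = 0 by rewrite -fE sD lD linearZ_LR fx scaler0.
by rewrite sD lD.
Qed.

End E.
End Hull.

(** * Torsion complexes *)

Section Concentrated.
Variable R : comNzRingType.

Lemma zero_tensorr (M N : lmodType R) : zero_module N -> zero_module (tensor M N).
Proof.
move=> N0 t; rewrite -[t]tswapK [tswap M N t](zero_tensor (N := M) N0).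
exact: linear0.
Qed.
Implicit Types X Y G : complex R.

Definition concentrated (t : int) Y : Prop := forall i, i != t -> zero_module (Y i).

(** As t is a variable, the term in degree t does not reduce to J; the inverse maps u and v take the
    place of that conversion. *)
Lemma concentrated_exists (J : lmodType R) (t : int) :
  exists Y, concentrated t Y /\
  exists (u : {linear J -> Y t}) (v : {linear Y t -> J}), cancel u v /\ cancel v u.
Proof.
pose V i : lmodType R := if i == t then J else 'rV[R]_0.
pose d i j : {linear V i -> V j} := \0.
have d0 i j : i != j + 1 -> forall x, d i j x = 0 by [].
have dd i j k x : d j k (d i j x) = 0 by [].
exists (Complex d0 dd); split=> [i it x|].
  move: x; rewrite /= /V (negbTE it) => x.
  by apply/rowP => -[].
have gen (W : lmodType R) : W = J ->
    exists (u : {linear J -> W}) (v : {linear W -> J}), cancel u v /\ cancel v u.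
  by move=> E; subst W; exists idfun, idfun.
by apply: gen; rewrite /= /V eqxx.
Qed.

Lemma concentrated_map X Y t (g : {linear X t -> Y t}) : concentrated t Y ->
  (forall x : X (t + 1), g (diff X (t + 1) t x) = 0) ->
  exists f : chain_map X Y, forall x, f t x = g x.
Proof.
move=> hY gd; pose f i : {linear X i -> Y i} := tr Y t i \o (g \o tr X i t).
have fd i j x : f j (diff X i j x) = diff Y i j (f i x).
  have [jt|jt] := eqVneq j t; last by rewrite [LHS]hY // [RHS]hY.
  subst j; have -> : diff Y i t (f i x) = 0.
    have [it|it] := eqVneq i t; last by rewrite [f i x]hY // linear0.
    by subst i; rewrite diff_shape //; lia.
  rewrite /f /= !tr_id; have [it|it] := eqVneq i (t + 1).
    by subst i; rewrite gd.
  by rewrite diff_shape // linear0.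
by exists (ChainMap fd) => x; rewrite /= /f /= !tr_id.
Qed.

Lemma concentrated_boundary Y t (y : Y t) : concentrated t Y -> boundary y -> y = 0.
Proof.
move=> hY [x <-]; have -> : x = 0 by apply: hY; lia.
exact: linear0.
Qed.

Lemma mtensor_retract_exact (M M' : lmodType R) (u : {linear M -> M'})
    (v : {linear M' -> M}) X i : cancel u v ->
  exact_at (mtensor M' X) i -> exact_at (mtensor M X) i.
Proof.
move=> uv h x cx.
have [|y yE] := h (tensor_map u (idL (X i)) x).
  rewrite /cycle.
  rewrite -[LHS]/(tensor_map (idL M') (diff X i (i - 1)) (tensor_map u (idL (X i)) x)).
  by rewrite tmapC [tensor_map (idL M) _ x]cx linear0.
exists (tensor_map v (idL (X (i + 1))) y).
rewrite -[LHS]/(tensor_map (idL M) (diff X (i + 1) i) (tensor_map v (idL _) y)) tmapC.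
rewrite [tensor_map (idL M') (diff X _ _) y]yE.
by rewrite (@tmap_comp _ _ _ _ _ _ _ _ _ _ _ idfun (idL (X i))) ?tmap_id.
Qed.

Lemma concentrated_tensor_exact G Y t j : concentrated t Y ->
  exact_at (ctensor G Y) (t + j) <-> exact_at (mtensor (Y t) G) j.
Proof. by move=> hY; rewrite ctensor_swap_exact; apply: concentrated_exact. Qed.

End Concentrated.

(** * Totally acyclic complexes of flat modules *)

Section TotallyAcyclic.
Variable R : comNzRingType.

Definition totally_acyclic (F : complex R) : Prop :=
  [/\ forall i, flat (F i), acyclic F &
      forall I : lmodType R, injective_module I -> acyclic (mtensor I F)].

(** The common property of flat and injective modules on which dimension shifting rests. Unlike
    either of the two, it holds for the sum of a flat and an injective module, as occurs in
    cones. *)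
Definition preserves_tacyclic (A : lmodType R) : Prop :=
  forall F, totally_acyclic F -> acyclic (mtensor A F).

Lemma flat_preserves (A : lmodType R) : flat A -> preserves_tacyclic A.
Proof. by move=> hA F [_ aF _] i; apply: flat_mtensor_exact. Qed.

Lemma injective_preserves (A : lmodType R) : injective_module A -> preserves_tacyclic A.
Proof. by move=> hA F [_ _ aF]; apply: aF. Qed.

Lemma zero_flat (A : lmodType R) : zero_module A -> flat A.
Proof. by move=> A0 M N f _ x y _; rewrite [x]zero_tensor // [y]zero_tensor. Qed.

Lemma pair_preserves (A B : lmodType R) : preserves_tacyclic A -> preserves_tacyclic B ->
  preserves_tacyclic (A * B)%type.
Proof.
move=> hA hB F hF i; have [io [pr dec]] := pair_decomposition A B.
by apply: (decomposition_exact dec) => -[]; [exact: hA|exact: hB].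
Qed.

(* Dimension shifting along M -> F_(i-1) -> M' on the right half of F. *)
Lemma tacyclic_row_exact (F X : complex R) (T t : int) : totally_acyclic F ->
  (forall p, T < p -> zero_module (X p)) -> (forall p, preserves_tacyclic (X p)) ->
  (forall j, t < j -> exact_at X j) ->
  forall i (M : lmodType R) (p : {linear F i -> M}), (forall y, exists x, p x = y) ->
  (forall x, p x = 0 <-> boundary x) ->
  forall j, t < j -> exact_at (mtensor M X) j.
Proof.
move=> hF XT hX eX i M p ps pk j tj.
have [k hk] : exists k : nat, T < j + k%:Z by exists (`|T - j| + 1)%N; lia.
elim: k i M p ps pk j tj hk => [|k IHk] i M p ps pk j tj hk.
  move=> z _; have -> : z = 0; last exact: boundary0.
  by rewrite -[z]tswapK [tswap _ _ z]zero_tensor ?linear0 //; apply: XT; lia.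
(* M embeds in F_(i-1) through [dl] with cokernel M', and stays embedded after tensoring with X_q
   because X_q (x) F is exact. As F_(i-1) (x) X is exact in degree j, H_j(M (x) X) is then
   controlled by H_(j+1)(M' (x) X). *)
have [M' [p' [p's p'k]]] := quotient_carrier (@boundary_submodule R F (i - 1)).
have [dl dlE] : exists dl : {linear M -> F (i - 1)}, forall x, dl (p x) = diff F i (i - 1) x.
  by apply: factor_surj => // x /pk/boundary_cycle.
have p'dl x : p' (dl x) = 0.
  by have [y <-] := ps x; apply/p'k; rewrite dlE; apply: boundaryI.
have dlk x : p' x = 0 -> exists y, dl y = x.
  move=> /p'k[y <-]; exists (p (tr F (i - 1 + 1) i y)); rewrite dlE diff_tr //; lia.
have dli q : injective (tensor_map dl (idL (X q))).
  apply: linear_inj => v v0; have [w wE] := tensor_surjl ps v.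
  have [|u uE] := hX q F hF i (tswap _ _ w).
    rewrite /cycle -[LHS]/(tensor_map (idL (X q)) (diff F i (i - 1)) (tswap _ _ w)).
    rewrite -tswap_map.
    rewrite -(@tmap_comp _ _ _ _ _ _ _ p (idL _) dl (idL _)) //.
    by rewrite wE v0 linear0.
  rewrite -wE -[w]tswapK -uE.
  rewrite -[diff (mtensor _ _) _ _ u]/(tensor_map (idL (X q)) (diff F (i + 1) i) u).
  rewrite tswap_map tmap0ll // => x.
  by apply/pk; exists x.
move=> z cz; have {}cz : tensor_map (idL M) (diff X j (j - 1)) z = 0 := cz.
have [fF _ _] := hF.
have [|y yE] := @flat_mtensor_exact _ (F (i - 1)) X j (fF (i - 1)) (eX j tj)
    (tensor_map dl (idL (X j)) z).
  rewrite /cycle -[LHS]/(tensor_map (idL _) (diff X j (j - 1)) (tensor_map dl (idL _) z)).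
  by rewrite tmapC cz linear0.
have {}yE : tensor_map (idL (F (i - 1))) (diff X (j + 1) j) y =
  tensor_map dl (idL (X j)) z := yE.
have tj1 : t < j + 1 by lia.
have hk1 : T < j + 1 + k%:Z by lia.
have [|w wE] := IHk (i - 1) M' p' p's p'k (j + 1) tj1 hk1 (tensor_map p' (idL _) y).
  apply: (cycle_at erefl).
  rewrite -[LHS]/(tensor_map (idL _) (diff X (j + 1) j) (tensor_map p' (idL _) y)).
  by rewrite tmapC yE tmap0ll.
have {}wE : tensor_map (idL M') (diff X (j + 1 + 1) (j + 1)) w =
  tensor_map p' (idL (X (j + 1))) y := wE.
have [w1 w1E] := tensor_surjl p's w.
have [|v vE] := tensor_right_exactl p's dlk
    (t := y - tensor_map (idL _) (diff X (j + 1 + 1) (j + 1)) w1).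
  by rewrite linearB -tmapC w1E wE subrr.
exists v; apply: (dli j).
transitivity (tensor_map dl (idL (X j)) (tensor_map (idL M) (diff X (j + 1) j) v)); first by [].
rewrite -tmapC vE linearB yE.
rewrite tmap0rr ?subr0 // => x; exact: diff_diff.
Qed.

Lemma Gflat_row_exact (M : lmodType R) (X : complex R) (T t : int) : Gflat M ->
  (forall p, T < p -> zero_module (X p)) -> (forall p, preserves_tacyclic (X p)) ->
  (forall j, t < j -> exact_at X j) ->
  forall j, t < j -> exact_at (mtensor M X) j.
Proof.
move=> [F [hF aF aIF [p ps pk]]] XT hX eX.
exact: (tacyclic_row_exact (And3 hF aF aIF) XT hX eX ps pk).
Qed.

End TotallyAcyclic.

(** * Torsion complexes tensored with complexes of G-flat modules *)

Section Depth.
Variables (R : comNzRingType) (m : submodClosed R^o).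
Hypotheses (hN : noetherian R) (hm : maximal_ideal (m : {pred R})).
Variables (n : nat) (s : 'I_n -> R).
Hypothesis hs : generates s (m : {pred R}).
Variable E : lmodType R.
Hypothesis hE : injective_hull (qmod m : lmodType R) E.

(* [t] bounds the homology of X from above, not necessarily its terms. *)
Record torsion_complex (t : int) (X : complex R) : Prop := TorsionComplex {
  torsion_top : exists T : int, forall p, T < p -> zero_module (X p) ;
  torsion_terms : forall p, preserves_tacyclic (X p) ;
  torsion_exact : forall j, t < j -> exact_at X j ;
  torsion_homology : forall j (x : X j), cycle x ->
    forall i, exists k, boundary (s i ^+ k *: x) }.

(* Up to isomorphism, Y is a direct sum of copies of E placed in degree t. *)
Record hull_complex (t : int) (Y : complex R) : Prop := HullComplex {
  hullc_conc : concentrated t Y ;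
  hullc_inj : injective_module (Y t) ;
  hullc_torsion : forall i (y : Y t), exists k, s i ^+ k *: y = 0 ;
  hullc_exact : forall (G : complex R) q,
    exact_at (mtensor E G) q -> exact_at (mtensor (Y t) G) q ;
  hullc_coord : forall y : Y t, y <> 0 -> exists pr : {linear Y t -> E}, pr y <> 0 }.

Lemma injective_retract (J J' : lmodType R) (u : {linear J' -> J}) (v : {linear J -> J'}) :
  cancel u v -> injective_module J -> injective_module J'.
Proof.
move=> uv hJ M N i f ii; have [g gE] := hJ M N i (u \o f) ii.
by exists (v \o g) => x /=; rewrite gE /= uv.
Qed.

(** The torsion embedding is applied to X_t modulo boundaries, with H_t(X) as the submodule on which
    it is injective. The map is thus defined on all of X_t and kills boundaries, as a chain map into
    a complex concentrated in degree t must. *)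
Lemma hull_complex_embedding t X : torsion_complex t X ->
  exists (Y : complex R) (f : chain_map X Y), hull_complex t Y /\
    forall x, cycle x -> f t x = 0 -> boundary x.
Proof.
move=> hX; have [N [q [qs qk]]] := quotient_carrier (@boundary_submodule R X t).
pose H (y : N) := exists2 x, cycle x & q x = y.
have hH : submodule H.
  split=> [|a _ _ [x cx <-] [x' cx' <-]].
    by exists 0; rewrite ?linear0 // /cycle linear0.
  exists (a *: x + x'); last by rewrite linearP.
  by rewrite /cycle linearP cx cx' scaler0 addr0.
have [f0 f0P] : exists f : {linear N -> hull_sum E N}, forall x, H x -> f x = 0 -> x = 0.
  apply: (torsion_embedding hN hm hs hE hH) => _ [x cx <-] i.
  have [k kP] := torsion_homology hX cx i; exists k.
  by rewrite -linearZ_LR; apply/qk.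
have [Y [cY [u [v [uv vu]]]]] := concentrated_exists (hull_sum E N) t.
have [|f fE] := @concentrated_map _ X Y t (u \o (f0 \o q)) cY.
  by move=> x /=; have -> : q (diff X (t + 1) t x) = 0; [apply/qk; exists x|rewrite !linear0].
exists Y, f; split=> [|x cx fx]; last first.
  apply/qk; apply: f0P; first by exists x.
  by rewrite -[f0 _]uv -[u _]/((u \o (f0 \o q)) x) -fE fx linear0.
split=> //.
- exact: injective_retract vu (@hull_sum_injective _ _ hN _ hE N).
- move=> i y; have [k kP] := hull_sum_torsion hN hm hE (v y) (gens_in hs i).
  by exists k; rewrite -[y]vu -linearZ_LR kP linear0.
- move=> G l hG; apply: (mtensor_retract_exact vu).
  have [io [pr [dec _ _ _]]] := dsum_decomposition (fun _ : N => E).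
  by apply: (decomposition_exact dec) => _; apply: hG.
- move=> y y0; have [io [pr [dec _ _ _]]] := dsum_decomposition (fun _ : N => E).
  apply: contrapT => npr; apply: y0; rewrite -[y]vu.
  suff -> : v y = 0 by rewrite linear0.
  have [S SE] := dec (v y); rewrite (SE (undup S)) ?undup_uniq //; last first.
    by move=> x; rewrite mem_undup.
  rewrite big1 // => x _; have -> : pr x (v y) = 0; last by rewrite linear0.
  by apply: contrapT => px; apply: npr; exists (pr x \o v).
Qed.

(** In degree t + 1 a cycle of the cone has Y-component 0 and an X-component killed by f, so
    injectivity of f on H_t is exactly what keeps the bound at t. *)
Lemma cone_torsion_complex t X Y (f : chain_map X Y) : torsion_complex t X ->
  hull_complex t Y -> (forall x, cycle x -> f t x = 0 -> boundary x) ->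
  torsion_complex t (cone f).
Proof.
move=> hX hY fi; have cY := hullc_conc hY.
split.
- have [T hT] := torsion_top hX; exists (`|T| + `|t| + 1) => p hp [x y]; congr pair.
    by apply: hT; lia.
  by apply: cY; lia.
- move=> p; apply: pair_preserves; first exact: torsion_terms hX (p - 1).
  have [pt|pt] := eqVneq p t; last by apply/flat_preserves/zero_flat/cY.
  by subst p; apply/injective_preserves/(hullc_inj hY).
- move=> j tj u cu; have jk : j = (j - 1) + 1 by lia.
  have kl : j - 1 = (j - 1 - 1) + 1 by lia.
  have [x [y uE]] := cpair_ex (j := j - 1) u jk; subst u.
  have : diff (cone f) j (j - 1) (cpair f x y) = 0 := cu.
  rewrite (cpair_diff _ _ _ jk kl) -(cpair0 f _ (j - 1 - 1)) => /cpair_inj[] //.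
  move=> /eqP; rewrite oppr_eq0 => /eqP dx fx.
  have y0 : y = 0 by apply: cY; lia.
  have [x' x'E] : boundary x.
    have [jt|jt] := eqVneq (j - 1) t; last by apply: (torsion_exact hX) => //; lia.
    move: fx; rewrite y0 linear0 addr0.
    by clear cu; move: x dx; rewrite jt => x dx; apply: fi.
  have xj : exists x'' : X j, diff X j (j - 1) x'' = x.
    by exists (tr X _ j x'); rewrite diff_tr //; lia.
  case: xj => x'' x''E.
  exists (cpair f (- x'') (0 : Y (j + 1))); rewrite (cpair_diff _ _ _ erefl jk).
  congr pair; first by rewrite [diff _ _ _ (- _)]linearN opprK x''E.
  by rewrite y0; apply: cY; lia.
- move=> j u cu i; have jk : j = (j - 1) + 1 by lia.
  have kl : j - 1 = (j - 1 - 1) + 1 by lia.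
  have [x [y uE]] := cpair_ex (j := j - 1) u jk; subst u.
  have : diff (cone f) j (j - 1) (cpair f x y) = 0 := cu.
  rewrite (cpair_diff _ _ _ jk kl) -(cpair0 f _ (j - 1 - 1)) => /cpair_inj[] //.
  move=> /eqP; rewrite oppr_eq0 => /eqP dx fx.
  have [k [x' x'E]] := torsion_homology hX dx i.
  have [x'' x''E] : exists x'' : X j, diff X j (j - 1) x'' = s i ^+ k *: x.
    by exists (tr X _ j x'); rewrite diff_tr //; lia.
  (* Once the X-component has been made a boundary, this element of Y_j is what remains; it is
     killed by a further power of s_i, as Y_t is torsion and the other terms of Y are zero. *)
  have [l lE] : exists l, s i ^+ l *: (s i ^+ k *: y + f j x'') = 0.
    have [jt|jt] := eqVneq j t; last by exists 0%N; rewrite [_ + _]cY // scaler0.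
    by subst j; apply: (hullc_torsion hY).
  exists (l + k)%N, (cpair f (- (s i ^+ l *: x'')) (0 : Y (j + 1))).
  rewrite (cpair_diff _ _ _ erefl jk) [diff X _ _ (- _)]linearN opprK.
  rewrite [diff X _ _ (_ *: _)]linearZ_LR x''E scalerA -exprD.
  rewrite -[RHS]/(s i ^+ (l + k) *: tr X (j - 1) (j - 1) x, s i ^+ (l + k) *: y).
  rewrite tr_id /cpair tr_id; congr pair.
  rewrite linear0 addr0 [f j (- _)]linearN [f j (_ *: _)]linearZ_LR; apply/eqP; rewrite eq_sym -addr_eq0; apply/eqP.
  by rewrite exprD -scalerA -scalerDr.
Qed.

Section Bounded.
Variables (G : complex R) (lo hi : int).
Hypothesis G0 : forall i, i < lo \/ hi < i -> zero_module (G i).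
Hypothesis hG : forall i, Gflat (G i).
Variables (t e : int).
Hypothesis hEG : forall q, e < q -> exact_at (mtensor E G) q.

Lemma hull_tensor_exact Y j : hull_complex t Y -> t + e < j -> exact_at (ctensor G Y) j.
Proof.
move=> hY tj; have -> : j = t + (j - t) by lia.
apply/(concentrated_tensor_exact _ _ (hullc_conc hY))/(hullc_exact hY)/hEG; lia.
Qed.

(** The induction runs over all X at once, since each step trades X in degree j for a cone in degree
    j + 1. *)
Lemma torsion_tensor_exact X j : torsion_complex t X -> t + e < j ->
  exact_at (ctensor G X) j.
Proof.
move=> hX tj; have [k hk] : exists k : nat, t + hi < j + k%:Z.
  by exists (absz (t + hi - j)%R).+1; lia.
elim: k X j hX tj hk => [|k IHk] X j hX tj hk.
  have [T hT] := torsion_top hX.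
  apply: (ctensor_row_exact (lo := lo) (hi := hi) (t := t)) => //; last by lia.
  move=> p q; apply: (Gflat_row_exact (hG p) hT); first exact: torsion_terms hX.
  exact: torsion_exact hX.
have [Y [f [hY fi]]] := hull_complex_embedding hX.
have hC : exact_at (cone (ctensor_map G f)) (j + 1).
  apply/cone_tensor_exact/IHk; [exact: cone_torsion_complex|lia|lia].
by move=> x cx; apply: (cone_exact_inj hC cx); apply: hull_tensor_exact => //; apply: chain_cycle.
Qed.

End Bounded.

Lemma tensor_torsion (M N : lmodType R) (a : R) (u : tensor M N) :
  (forall y : N, exists k, a ^+ k *: y = 0) -> exists k, a ^+ k *: u = 0.
Proof.
move=> tN; elim/tens_ind: u => [x y|u v [k kP] [l lP]].
  by have [k kP] := tN y; exists k; rewrite -tensZr kP tensr0.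
exists (k + l)%N; rewrite scalerDr {1}exprD mulrC -scalerA kP scaler0 add0r.
by rewrite exprD -scalerA lP scaler0.
Qed.

Lemma tmap_scaled_sum (M N N' : lmodType R) (h : {linear N -> N'})
    (g : 'I_n -> {linear N -> N'}) (u : tensor M N) :
  (forall y, h y = \sum_i g i (s i *: y)) ->
  tensor_map (idL M) h u = \sum_i tensor_map (idL M) (g i) (s i *: u).
Proof.
move=> hE'; elim/tens_ind: u => [x y|u v Hu Hv].
  rewrite tensor_mapE hE'; transitivity (\sum_i tens x (g i (s i *: y))).
    exact: (raddf_sum (mk_linear (tens_linearr x))).
  by apply: eq_bigr => i _; rewrite -tensZr tensor_mapE.
rewrite linearD Hu Hv -big_split; apply: eq_bigr => i _.
by rewrite scalerDr [RHS]linearD.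
Qed.

Lemma cone_tensor_in (A X Y : complex R) (f : chain_map X Y) j (y : ctensor A Y j) :
  cone_tensor A f j (ctensor_map A (cone_in f) j y) = cone_in (ctensor_map A f) j y.
Proof.
congr pair; apply: ctensor_ext => p q pq.
  rewrite (svalP (cone_tensor_fst A f j)) comp_map tmap0rr ?scaler0.
    by apply/esym; exact: (linear0 (comp_lin A X (j - 1) p q)).
  by move=> x /=; rewrite linear0.
rewrite (svalP (cone_tensor_snd A f j)) comp_map.
by rewrite (@tmap_comp _ _ _ _ _ _ _ _ _ _ _ (idL (A p)) idfun) // tmap_id.
Qed.

(* If H_(t+e)(G (x) K) vanished, then E -> H_t(cone f) -> Y1 would be injective on
   H_e(G (x) E); but it kills the socle of E, hence factors through multiplication by
   the s_i, and so kills the socle of H_e(G (x) E). *)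
Lemma torsion_tensor_nonexact (G K : complex R) (lo hi t e : int) :
  (forall i, i < lo \/ hi < i -> zero_module (G i)) -> (forall i, Gflat (G i)) ->
  (forall q, e < q -> exact_at (mtensor E G) q) -> ~ exact_at (mtensor E G) e ->
  torsion_complex t K -> ~ exact_at K t -> ~ exact_at (ctensor G K) (t + e).
Proof.
move=> G0 hG hEG nEG hK nK hGK.
have [u0 [cu0 nu0]] : exists x : K t, cycle x /\ ~ boundary x.
  apply: contrapT => h; apply: nK => x cx; apply: contrapT => nx; apply: h.
  by exists x.
(* The class of u lies in the socle of H_t(K): it is nonzero, and every s_i u is a boundary. Its
   image v in Y_t is therefore nonzero and annihilated by m. *)
have [r [nu su]] := socle_multiple (@boundary_submodule R K t) nu0
  (torsion_homology hK cu0).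
set u := r *: u0 in nu su.
have cu : cycle u by rewrite /cycle linearZ_LR cu0 scaler0.
have [Y [f [hY fi]]] := hull_complex_embedding hK.
have cY := hullc_conc hY.
pose v := f t u; have v0 : v <> 0 by move=> v0; apply: nu; apply: fi.
have mv a : a \in m -> a *: v = 0.
  apply: (gens_annihilate hs (P := fun z => z = 0)) => [|i].
    by split=> // b y z -> ->; rewrite scaler0 addr0.
  by apply: (concentrated_boundary cY); rewrite -linearZ_LR; apply: chain_boundary.
have [ep [epP ess]] := hull_socle hm hE.
(* As m annihilates v, sending the socle generator [ep] to v is well defined and extends to a map E
   -> Y_t. *)
have [|th thE] := injective_extend (p := mk_linear (scale_linearl ep))
    (g := mk_linear (scale_linearl v))
    (hullc_inj hY).
  by move=> a /= /epP; apply: mv.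
have {}thE : th ep = v by have := thE 1; rewrite /= !scale1r.
have [pr prv] := hullc_coord hY v0.
(* A map out of E that does not kill the socle generator is injective, because every nonzero
   submodule contains the generator. A retraction of [pr \o th] shows that E[t] is a direct summand
   of Y, with inclusion [Th] and projection [Pi]. *)
have prth : injective (pr \o th).
  apply: linear_inj => y py; apply: contrapT => /eqP/ess[a aE].
  by apply: prv; rewrite -thE -aE !linearZ_LR [pr _]py scaler0.
have [rho rhoE] := (hull_injective hE) _ _ (pr \o th) (idL E) prth.
have [YE [cYE [ue [ve [uve vue]]]]] := concentrated_exists E t.
have zYE (x : YE (t + 1)) : x = 0 by apply: cYE; lia.
have zY (x : Y (t + 1)) : x = 0 by apply: cY; lia.
have [|Th ThE] := @concentrated_map _ YE Y t (th \o ve) cY.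
  by move=> x; rewrite [x]zYE !linear0.
have [|Pi PiE] := @concentrated_map _ Y YE t (ue \o (rho \o pr)) cYE.
  by move=> x; rewrite [x]zY !linear0.
have PiTh x : Pi t (Th t x) = x by rewrite PiE ThE /= [rho _]rhoE vue.
have [Y1 [f1 [hY1 f1i]]] := hull_complex_embedding (cone_torsion_complex hK hY fi).
have cY1 := hullc_conc hY1.
pose chi : {linear E -> Y1 t} := f1 t \o (cone_in f t \o th).
(* The map [chi] kills the socle generator: its image v = f u in the first cone is the boundary of
   (u, 0). *)
have [|g gE] := hull_factor_socle hm hs (f := chi) epP ess (hullc_inj hY1).
  apply: (concentrated_boundary cY1); apply: chain_boundary.
  exists (cpair f u (0 : Y (t + 1))).
  have tk : t = t - 1 + 1 by lia.
  rewrite (cpair_diff _ _ _ erefl tk) cu oppr0 linear0 addr0 -/v -thE.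
  by congr pair; rewrite linear0.
have Gam i : exists h : chain_map YE Y1, forall x, h t x = g i (ve x).
  have [|h hE'] := @concentrated_map _ YE Y1 t (g i \o ve) cY1.
    by move=> x; rewrite [x]zYE !linear0.
  by exists h.
pose Ga i := sval (cid (Gam i)).
have GaE i x : Ga i t x = g i (ve x) by apply: (svalP (cid (Gam i))).
have [z0 [cz0 nz0]] : exists x : ctensor G YE (t + e), cycle x /\ ~ boundary x.
  apply: contrapT => h; apply: nEG; apply: (mtensor_retract_exact uve).
  apply/(concentrated_tensor_exact _ _ cYE) => x cx; apply: contrapT => nx; apply: h.
  by exists x.
have tz i : exists k, boundary (s i ^+ k *: z0).
  have [k kP] : exists k, s i ^+ k *: comp (z0 : ctensor_obj G YE (t + e)) e t = 0.
    apply: tensor_torsion => y.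
    have [k kP] := hull_torsion hN hm hE (ve y) (gens_in hs i); exists k.
    by rewrite -[y]vue -linearZ_LR kP linear0.
  exists k; have -> : s i ^+ k *: z0 = 0; last exact: boundary0.
  apply: ctensor_ext => p q pq.
  have [qt|qt] := eqVneq q t; last first.
    by rewrite [LHS](zero_tensorr (cYE _ qt)) [RHS](zero_tensorr (cYE _ qt)).
  subst q; have pe : p = e by lia.
  subst p; rewrite [RHS](linear0 (comp_lin G YE (t + e) e t)) -kP.
  exact: (linearZ_LR (comp_lin G YE (t + e) e t)).
(* The same choice in H_(t+e)(G (x) E[t]): z is no boundary, but every s_i z is. *)
have [r' [nz sz]] := socle_multiple (@boundary_submodule R (ctensor G YE) (t + e)) nz0 tz.
set z := r' *: z0 in nz sz.
have cz : cycle z by rewrite /cycle linearZ_LR cz0 scaler0.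
pose w := ctensor_map G Th (t + e) z.
have cw : cycle w by apply: chain_cycle.
(* The composite E[t] -> Y -> cone f -> Y1 is the sum of the maps g_i after multiplication by s_i,
   and each s_i z is a boundary. *)
have bw1 : boundary (ctensor_map G f1 (t + e) (ctensor_map G (cone_in f) (t + e) w)).
  have -> : ctensor_map G f1 (t + e) (ctensor_map G (cone_in f) (t + e) w) =
      \sum_i ctensor_map G (Ga i) (t + e) (s i *: z).
    apply: ctensor_ext => p q pq.
    rewrite [RHS](raddf_sum (comp_lin G Y1 (t + e) p q)) !comp_map.
    have [qt|qt] := eqVneq q t; last first.
      by rewrite [LHS](zero_tensorr (cY1 _ qt)) [RHS](zero_tensorr (cY1 _ qt)).
    subst q.
    rewrite (@tmap_comp _ _ _ _ _ _ _ _ _ _ _ (idL (G p)) (cone_in f t \o Th t)) //.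
    rewrite (@tmap_comp _ _ _ _ _ _ _ _ _ _ _ (idL (G p)) (f1 t \o (cone_in f t \o Th t))) //.
    rewrite (@tmap_scaled_sum _ _ _ _ (fun i => Ga i t)) => [|y]; last first.
      transitivity (chi (ve y)); first by rewrite /chi /= ThE.
      by rewrite gE; apply: eq_bigr => i _; rewrite GaE [ve (_ *: _)]linearZ_LR.
    apply: eq_bigr => i _; rewrite -[RHS]/(comp (ctensor_map G (Ga i) (t + e) (s i *: z) :
      ctensor_obj G Y1 (t + e)) p t) comp_map; congr (tensor_map _ _ _).
    exact: esym (linearZ_LR (comp_lin G YE (t + e) p t) _ _).
  by apply: boundary_sum => i; apply: chain_boundary.
(* G tensored with the cone of f1 is exact in degree t + e + 1, so f1 induces an injection on
   H_(t+e), and the class of w already vanishes in the first cone. *)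
have bw2 : boundary (ctensor_map G (cone_in f) (t + e) w).
  have hC1 := cone_torsion_complex hK hY fi.
  have hC2 := cone_torsion_complex hC1 hY1 f1i.
  have hex : exact_at (cone (ctensor_map G f1)) (t + e + 1).
    apply/cone_tensor_exact; apply: (torsion_tensor_exact G0 hG hEG hC2); lia.
  by apply: (cone_exact_inj hex) bw1; apply: chain_cycle.
(* Hence w agrees, up to a boundary, with the image of a cycle of G (x) K, which is itself a
   boundary by the assumption to be refuted. Applying the projection [Pi] then makes z a
   boundary. *)
have /cone_exact_boundary[x cx bx] : boundary (cone_in (ctensor_map G f) (t + e) w).
  by rewrite -cone_tensor_in; apply: chain_boundary.
have bw : boundary w.
  rewrite -[w](subrK (ctensor_map G f (t + e) x)); apply: boundaryD => //.
  by apply: chain_boundary; apply: hGK.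
apply: nz; have -> : z = ctensor_map G Pi (t + e) w; last exact: chain_boundary.
apply: ctensor_ext => p q pq; rewrite !comp_map.
have [qt|qt] := eqVneq q t; last first.
  by rewrite [LHS](zero_tensorr (cYE _ qt)) [RHS](zero_tensorr (cYE _ qt)).
subst q; rewrite (@tmap_comp _ _ _ _ _ _ _ _ _ _ _ (idL (G p)) idfun) ?tmap_id //.
Qed.

End Depth.

(** * Koszul complexes and suprema *)

Section KoszulFacts.
Variables (R : comNzRingType) (n : nat) (s : 'I_n -> R).

Lemma koszul_flat i : flat (koszul s i).
Proof. exact: ffun_flat. Qed.

Lemma koszul_zero i : i < 0 \/ n%:Z < i -> zero_module (koszul s i).
Proof.
move=> hi c; apply/ffunP => S; exfalso; have /eqP Si := valP S.
have Sn : (#|val S| <= n)%N by rewrite -[X in (_ <= X)%N](card_ord n) max_card.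
by case: hi; rewrite -Si; lia.
Qed.

Lemma kcoef_ext p (c c' : koszul_obj R n p) :
  (forall S : {set 'I_n}, #|S|%:Z = p -> kcoef c S = kcoef c' S) -> c = c'.
Proof.
move=> h; apply/ffunP => S; have Sp : #|val S|%:Z == p by case: S.
have kE (d : koszul_obj R n p) : kcoef d (val S) = d S.
  by rewrite /kcoef valK.
by rewrite -[LHS]kE -[RHS]kE; apply: h; apply: (eqP Sp).
Qed.

(* Exterior multiplication by the i-th basis vector is a homotopy for s i. *)
Lemma koszul_homotopy p (c : koszul s p) i : cycle c -> boundary (s i *: c).
Proof.
move=> cc.
pose h : koszul_obj R n (p + 1) := [ffun S : psets n (p + 1) =>
  if i \in val S then (-1) ^+ below (val S) i * kcoef (c : koszul_obj R n p) (val S :\ i)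
  else 0].
have hE S : kcoef h S =
    if i \in S then (-1) ^+ below S i * kcoef (c : koszul_obj R n p) (S :\ i) else 0.
  have [Sp|Sp] := eqVneq (#|S|%:Z) (p + 1).
    have Sp' : #|S|%:Z == p + 1 by apply/eqP.
    by rewrite [LHS]/kcoef (insubT (fun S : {set 'I_n} => #|S|%:Z == p + 1) Sp') /= ffunE.
  rewrite kcoef_out //; case: ifP => // iS; rewrite kcoef_out ?mulr0 //.
  by apply: contra Sp; rewrite (cardsD1 i S) iS add1n => /eqP <-; rewrite -addn1 PoszD.
exists h; apply: kcoef_ext => T Tp.
have -> : kcoef (s i *: c : koszul_obj R n p) T = s i * kcoef (c : koszul_obj R n p) T.
  have := kcoef_linear (p := p) T (s i) (c : koszul_obj R n p) 0.
  by rewrite addr0 => ->; rewrite [kcoef 0 T](_ : _ = 0) ?addr0 // /kcoef; case: insub => //= ?; rewrite ffunE.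
rewrite [LHS]kcoef_diff //.
have [iT|iT] := boolP (i \in T); last first.
  rewrite (bigD1 i) //= hE setU11 setU1K // big1 ?addr0 => [|k /andP[kT ki]].
    rewrite belowU1 // ltnn add0n mulrACA -exprD addnn -mul2n.
    by rewrite exprM sqrrN expr1n expr1n mul1r.
  by rewrite hE !inE (negbTE iT) eq_sym (negbTE ki) /= mulr0.
(* For i in T, the equation d c = 0 read at T without i expresses s_i c_T through the coefficients c
   at k and T', which are those occurring in d h. *)
pose T' := T :\ i; have iT' : i \notin T' by rewrite !inE eqxx.
have T'p : #|T'|%:Z = p - 1 by rewrite -Tp (cardsD1 i T) iT add1n -addn1 PoszD addrK.
have TE : T = i |: T' by rewrite finset.setD1K.
have := congr1 (fun c : koszul_obj R n (p - 1) => kcoef c T') cc.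
rewrite [LHS]kcoef_diff // [RHS](_ : _ = 0); last first.
  by rewrite /kcoef; case: insub => //= ?; rewrite ffunE.
rewrite (bigD1 i) //= -TE => /eqP; rewrite addr_eq0 => /eqP E.
have sgn (k : nat) (x : R) : (-1) ^+ k * ((-1) ^+ k * x) = x.
  by rewrite mulrA -exprD addnn -mul2n exprM sqrrN expr1n expr1n mul1r.
have -> : s i * kcoef (c : koszul_obj R n p) T = - (-1) ^+ below T' i *
    (\sum_(j | (j \notin T') && (j != i)) (-1) ^+ below T' j * s j *
      kcoef (c : koszul_obj R n p) (j |: T')).
  by rewrite mulNr -mulrN -E -mulrA sgn.
rewrite mulr_sumr; apply: eq_big => [k|k kT].
  by rewrite TE !inE; case: eqVneq => [->|]; rewrite ?iT' ?andbF //= andbT.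
have ki : k != i by apply: contraNneq kT => ->.
rewrite hE !inE iT orbT; have -> : (k |: T) :\ i = k |: T'.
  apply/setP => x; rewrite !inE; case: (eqVneq x i) => [->|//] /=.
  by rewrite eq_sym (negbTE ki).
rewrite belowU1 // {1}TE belowU1 // [X in (_ + below X i)%N]TE belowU1 // ltnn add0n.
have -> : - (-1) ^+ below T' i = (-1) ^+ ((k < i) + (i < k) + below T' i) :> R.
  have -> : ((k < i) + (i < k) = 1)%N by move: ki; rewrite neq_ltn; case: ltngtP.
  by rewrite exprS mulN1r.
by rewrite !exprD; ring.
Qed.

(** H_0 of the complex is R/m: if the constant 1 were a boundary, it would be a combination of the
    s_i. *)
Lemma koszul_nonexact (m : submodClosed R^o) : generates s (m : {pred R}) ->
  1 \notin (m : {pred R}) -> ~ exact_at (koszul s) 0.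
Proof.
move=> hs m1 h; pose c : koszul_obj R n 0 := [ffun=> 1].
have [|y yE] := h c; first by rewrite /cycle [LHS]koszul_zero //; left.
case/negP: m1; apply/hs.
have S0 : #|finset.set0 : {set 'I_n}|%:Z == 0 by rewrite cards0.
have := congr1 (fun c : koszul_obj R n 0 => kcoef c finset.set0) yE.
rewrite [LHS]kcoef_diff; last exact/eqP.
rewrite [RHS]/kcoef (insubT (fun S : {set 'I_n} => #|S|%:Z == 0) S0) /= ffunE => E.
exists (fun k => (-1) ^+ below finset.set0 k * kcoef (y : koszul_obj R n (0 + 1)) (k |: finset.set0)).
rewrite -[LHS]E; apply: eq_big => [k|k _]; first by rewrite inE.
by rewrite mulrAC.
Qed.

Lemma koszul_torsion_complex t : (forall j, t < j -> exact_at (koszul s) j) ->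
  torsion_complex s t (koszul s).
Proof.
move=> ht; split=> //.
- by exists n%:Z => p pn; apply: koszul_zero; right.
- by move=> p; apply/flat_preserves/koszul_flat.
- by move=> j x cx i; exists 1%N; rewrite expr1; apply: koszul_homotopy.
Qed.

(** The Koszul complex is bounded with flat terms, so tensoring it with the acyclic cone of f leaves
    every row exact. *)
Lemma koszul_tensor_quasi_iso (X Y : complex R) (f : chain_map X Y) : quasi_iso f ->
  forall j, exact_at (ctensor (koszul s) X) j <-> exact_at (ctensor (koszul s) Y) j.
Proof.
move=> hf; apply: (cone_acyclic_exact (f := ctensor_map (koszul s) f)) => j.
apply/cone_tensor_exact; apply: (@ctensor_row_exact _ _ _ 0 n%:Z (j - n%:Z - 1)); last lia.
  exact: koszul_zero.
by move=> p q _; apply: (flat_mtensor_exact (koszul_flat (i := p))); apply: cone_acyclic.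
Qed.

Lemma regular_mtensor_exact (X : complex R) j :
  exact_at (mtensor (R^o : lmodType R) X) j <-> exact_at X j.
Proof.
split=> [h x cx|]; last exact/flat_mtensor_exact/flat_regular.
have [|u uE] := h (tens (1 : R^o) x).
  rewrite /cycle -[LHS]/(tensor_map (idL _) (diff X j (j - 1)) (tens (1 : R^o) x)).
  by rewrite tensor_mapE cx tensr0.
exists (tensor_act _ u); have := congr1 (tensor_act (X j)) uE.
rewrite tensor_actE scale1r => <-; exact: esym (tensor_act_map _ _).
Qed.

End KoszulFacts.

(** * Suprema of sets of degrees *)

Section Sup.

Lemma max_int (P : int -> Prop) (a T : int) : P a -> (forall j, T < j -> ~ P j) ->
  exists t, P t /\ forall j, t < j -> ~ P j.
Proof.
move=> Pa PT; have [k hk] : exists k : nat, T < a + k%:Z.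
  by exists (absz (T - a)%R).+1; lia.
elim: k a Pa hk => [|k IHk] a Pa hk; first by case: (PT a _ Pa); lia.
have [[b [ab Pb]]|nb] := pselect (exists b, a < b /\ P b).
  by apply: (IHk b Pb); lia.
by exists a; split=> // j aj Pj; apply: nb; exists j.
Qed.

Lemma supremumE (A : set (\bar int)) v : (exists x, A x) -> supremums A v ->
  supremum -oo%E A = v.
Proof.
move=> [x Ax] Av; rewrite /supremum ifF; last first.
  by apply/negbTE/eqP => A0; rewrite A0 in Ax.
by apply: (@is_subset1_supremums _ _ A) => //; apply: xgetPex; exists v.
Qed.

Lemma supZ_max (A : set int) t : A t -> (forall j, A j -> (j <= t)%R) -> supZ A = t%:E.
Proof.
move=> At ht; apply: supremumE; first by exists t%:E; exists t.
split=> [_ [j Aj <-]|u hu]; first by rewrite lee_fin ht.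
by apply: hu; exists t.
Qed.

Lemma supZ_empty (A : set int) : (forall j, ~ A j) -> supZ A = -oo%E.
Proof.
move=> h; rewrite /supZ /supremum ifT //; apply/eqP.
by rewrite -subset0 => x [j Aj _]; case: (h j).
Qed.

Lemma supZ_bounded (A : set int) : supZ A <> +oo%E -> exists T, forall j, A j -> (j <= T)%R.
Proof.
move=> hA; apply: contrapT => nT; apply: hA.
have big T : exists2 j, A j & (T < j)%R.
  apply: contrapT => nj; apply: nT; exists T => j Aj; rewrite leNgt; apply/negP => Tj.
  by apply: nj; exists j.
apply: supremumE; first by have [j Aj _] := big 0; exists j%:E; exists j.
split=> [x _|u hu]; first exact: leey.
case: u hu => [r||] hu //.
- have [j Aj rj] := big r; have /hu : [set i%:E | i in A]%classic j%:E by exists j.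
  by rewrite lee_fin leNgt rj.
- have [j Aj _] := big 0; have /hu : [set i%:E | i in A]%classic j%:E by exists j.
  by rewrite leNgt ltNyr.
Qed.

(** Covers the empty set, where the default value is returned. It is used in contrapositive form to
    extract a bounded resolution. *)
Lemma infimum_pinfty (A : set (\bar int)) : (forall d, A d -> d = +oo%E) ->
  infimum +oo%E A = +oo%E.
Proof.
move=> hA; rewrite /infimum; case: ifP => // _.
have [[v Av]|nv] := pselect (exists v, infimums A v); last first.
  by rewrite xgetPN // => v Av; apply: nv; exists v.
have [_ ub] := xgetPex +oo%E (ex_intro _ v Av).
apply/eqP; rewrite -leye_eq; apply: ub => d /hA ->; exact: lexx.
Qed.

Lemma hsup_max (R : comNzRingType) (X : complex R) t : ~ exact_at X t ->
  (forall j, t < j -> exact_at X j) -> hsup X = t%:E.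
Proof.
move=> nt ht; apply: supZ_max => // j nj; rewrite leNgt; apply/negP => tj.
exact/nj/ht.
Qed.

Lemma hsup_acyclic (R : comNzRingType) (X : complex R) : acyclic X -> hsup X = -oo%E.
Proof. by move=> aX; apply: supZ_empty => j; apply; apply: aX. Qed.

Lemma Gfd_fin_resolution (R : comNzRingType) (X : complex R) : Gfd X \is a fin_num ->
  exists G : complex R, Gflat_resolution X G /\
    exists T : int, forall i, T < i -> zero_module (G i).
Proof.
move=> hX; have [d [[G hG dE] dfin]] : exists d, (exists2 G : complex R,
    Gflat_resolution X G & d = supZ [set n | ~ zero_module (G n)]%classic) /\ d <> +oo%E.
  apply: contrapT => nd; move: hX; rewrite /Gfd infimum_pinfty // => d hd.
  by apply: contrapT => dp; apply: nd; exists d.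
exists G; split=> //; have [|T hT] := @supZ_bounded [set n | ~ zero_module (G n)]%classic.
  by rewrite -dE.
exists T => i Ti; apply: contrapT => /hT; lia.
Qed.

End Sup.

(** A projective resolution P and the G-flat resolution G are linked by a quasi-isomorphism P -> G.
    Its cone is exact and bounded below, and its terms, sums of a projective and a G-flat module,
    have no higher Tor against E, so it stays exact after tensoring with E. Viewing E as a stalk
    complex makes the results on cones and tensor products of complexes applicable. *)
Lemma derived_tensor_exact (R : comNzRingType) (E : lmodType R) (W EW G : complex R) :
  injective_module E -> derived_tensor E W EW -> Gflat_resolution W G ->
  forall j, exact_at EW j <-> exact_at (mtensor E G) j.
Proof.
move=> hE [P [p [hp hEW]]] [hG bG hGW] j.
have [phi hphi] := resolution_quasi_iso hp hGW; have [hP bP _] := hp.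
have aC : acyclic (mtensor E (cone phi)).
  apply: tor_vanish_acyclic; last 1 first.
  - move=> i; apply: tor_vanish_pair; last exact: Gflat_tor_vanish.
    exact/flat_tor_vanish/flat_projective.
  - have [a Pa] := bP; have [b Gb] := bG; exists (Num.min a b) => i.
    rewrite lt_min => /andP[ia ib] [x y]; congr pair; [apply: Pa; lia|exact: Gb].
  - exact: cone_acyclic.
have cE : concentrated 0 (stalk E).
  by move=> i i0 x; move: x; rewrite /= /stalk_obj (negbTE i0) => x; apply/rowP => -[].
have st (X : complex R) i : exact_at (ctensor (stalk E) X) i <-> exact_at (mtensor E X) i.
  by apply: (@concentrated_exact _ (stalk E) X 0 i i cE); rewrite add0r.
rewrite (derived_iso_exact hEW) -!st.
apply: (cone_acyclic_exact (f := ctensor_map (stalk E) phi)) => i.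
exact/cone_tensor_exact/st.
Qed.

Theorem theorem8p7 (R : comNzRingType) (m : submodClosed R^o)
    (hR : local_ring (m : {pred R})) (E : lmodType R)
    (hE : injective_hull (qmod m : lmodType R) E)
    (n : nat) (s : 'I_n -> R) (hs : generates s (m : {pred R}))
    (W EW : complex R) (hEW : derived_tensor E W EW)
    (hW : hbounded W) (hGfd : Gfd W \is a fin_num) :
  depth s W = (depth s (stalk (R^o : lmodType R)) - hsup EW)%E /\
  (hsup EW \is a fin_num <-> depth s W \is a fin_num).
Proof.
have [hN hm _] := hR; have [_ m1 _] := hm.
have [G [hG [hi Ghi]]] := Gfd_fin_resolution hGfd.
have [Gfl [lo Glo] hGW] := hG.
have G0 i : i < lo \/ hi < i -> zero_module (G i) by case; [exact: Glo|exact: Ghi].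
have iE := hull_injective hE.
have EWG := derived_tensor_exact iE hEW hG.
pose K := koszul s.
have KW j : exact_at (ctensor K W) j <-> exact_at (ctensor G K) j.
  have [Z [f [g [hf hg]]]] := hGW.
  rewrite -(ctensor_swap_exact K G) -(koszul_tensor_quasi_iso s hf).
  by rewrite (koszul_tensor_quasi_iso s hg).
(* The supremum of K exists because H_0(K) is nonzero and K vanishes above n; since K (x) R has the
   same homology, depth R = n - t. *)
have [t [nt tK]] : exists t, ~ exact_at K t /\ forall j, t < j -> ~ ~ exact_at K j.
  apply: (@max_int _ 0 n%:Z); first exact: koszul_nonexact hs m1.
  by move=> j nj; apply => x _; rewrite [x]koszul_zero; [exact: boundary0|right].
have {}tK j : t < j -> exact_at K j by move=> tj; apply: contrapT; apply: tK.
have tcK : torsion_complex s t K by apply: koszul_torsion_complex.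
have hKR : hsup (ctensor K (stalk (R^o : lmodType R))) = t%:E.
  have cR : concentrated 0 (stalk (R^o : lmodType R)).
    by move=> i i0 x; move: x; rewrite /= /stalk_obj (negbTE i0) => x; apply/rowP => -[].
  have KR j : exact_at (ctensor K (stalk (R^o : lmodType R))) j <-> exact_at K j.
    by rewrite -[j]add0r (concentrated_tensor_exact _ _ cR) add0r; apply: regular_mtensor_exact.
  by apply: hsup_max => [/KR //|j /tK h]; apply/KR.
rewrite /depth hKR.
have [aE|nE] := pselect (acyclic (mtensor E G)).
  have -> : hsup EW = -oo%E by apply: hsup_acyclic => j; apply/EWG/aE.
  have -> : hsup (ctensor K W) = -oo%E.
    apply: hsup_acyclic => j; apply/KW.
    (* When E (x) G is acyclic any integer bounds its homology, and j - t - 1 is the largest e with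
       t + e < j. Both depths being compared then equal +oo. *)
    apply: (torsion_tensor_exact hN hm hs hE G0 Gfl (e := j - t - 1) _ tcK) => //; lia.
  by [].
have [e [ne eE]] : exists e, ~ exact_at (mtensor E G) e /\
    forall j, e < j -> ~ ~ exact_at (mtensor E G) j.
  have [e0 ne0] : exists e, ~ exact_at (mtensor E G) e.
    by apply: contrapT => h; apply: nE => j; apply: contrapT => nj; apply: h; exists j.
  apply: (@max_int _ e0 hi) => // j hj; apply=> x _.
  by rewrite [x](zero_tensorr (Ghi j hj)); exact: boundary0.
have {}eE j : e < j -> exact_at (mtensor E G) j by move=> ej; apply: contrapT; apply: eE.
have -> : hsup EW = e%:E.
  by apply: hsup_max => [/EWG //|j /eE h]; apply/EWG.
have -> : hsup (ctensor K W) = (t + e)%:E.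
  apply: hsup_max => [/KW|j tj].
    exact: (torsion_tensor_nonexact hN hm hs hE G0 Gfl eE ne tcK nt).
  by apply/KW/(torsion_tensor_exact hN hm hs hE G0 Gfl eE tcK).
split=> //; rewrite -!EFinB opprD addrA //.
Qed.
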